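(* Fix an integer $r \geq 3$. Let $\widehat{\mathcal{P}}^r = \{ (d_3(\lambda), d_4(\lambda)) : \lambda \text{ is an } r\text{-regular unimodular random graph} \}$ and $\mathcal{P}^r = \{ (d_3(G), d_4(G)) : G \text{ is an } r\text{-regular finite simple graph} \}$. Let $\mathcal{Q}^r$ be the convex hull of the points $P^r_0, \ldots, P^r_r$ defined below. Then $\widehat{\mathcal{P}}^r = \mathcal{Q}^r$, and this set equals the closure of $\mathcal{P}^r$.
   Context: For a finite simple graph $G$, $c_k(G)$ is the number of $k$-cycles in $G$ and $d_k(G) = c_k(G)/|V(G)|$ (graphs need not be connected). A rooted graph $(G,o)$ is a connected, locally finite simple graph (finitely or countably many vertices) with a distinguished vertex $o$, considered up to rooted isomorphism; the space of rooted graphs with degree bound $D$ is given the metric in which the distance of $(G_1,o_1)$ and $(G_2,o_2)$ is $1/k$, where $k$ is the largest integer such that the $k$-balls around $o_1$ and $o_2$ are isomorphic as rooted graphs. A random graph is a Borel probability measure $\lambda$ on this space; it is $r$-regular if it is concentrated on $r$-regular rooted graphs. An $r$-regular random graph $\lambda$ is unimodular if the following holds: choosing $(G,o)$ according to $\lambda$ and a uniformly random neighbor $v$ of $o$ gives a probability measure on (isomorphism classes of) connected graphs with a distinguished directed edge $(o,v)$, and this measure coincides with the measure obtained by reversing the directed edge to $(v,o)$. For a rooted graph, $c_k(G,o)$ denotes the number of $k$-cycles in $G$ containing $o$, and $d_k(\lambda) = \frac{1}{k}\int c_k(G,o)\, d\lambda((G,o))$. Define $P^r_0 = \left(0, \frac{r(r-1)^2}{8}\right)$,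 and for $1 \leq l \leq r$, with $r_i = \lfloor (r+i-1)/l \rfloor$ for $i=1,\ldots,l$, $$P^r_l = \left( \frac{1}{3}\sum_{i=1}^{l} \binom{r_i}{2},\ \frac{1}{4} \sum_{i=1}^{l} r_i \binom{r_i - 1}{2} \right).$$ *)

(* Defs.v *)
From HB Require Import structures.
From mathcomp Require Import all_boot all_order all_algebra generic_quotient.
From mathcomp Require Import finmap.
From mathcomp Require Import all_classical all_reals all_analysis.

Set Implicit Arguments.
Unset Strict Implicit.
Unset Printing Implicit Defensive.

Import Order.TTheory GRing.Theory Num.Theory.
Import numFieldNormedType.Exports.

Local Open Scope card_scope.
Local Open Scope classical_set_scope.
Local Open Scope ring_scope.
Local Open Scope quotient_scope.

(* A k-cycle is a subgraph, encoded by its set of edges, an edge being a set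
   of two vertices.  `next s x` is the cyclic successor of x in s. *)
Definition is_cycle (T : choiceType) (e : rel T) (k : nat)
    (C : {fset {fset T}}) : Prop :=
  exists s : seq T, [/\ (2 < k)%N, size s = k, uniq s, path.cycle e s
    & C = [fset [fset x; next s x]%fset | x in s]%fset].

(* `fset_set` is meaningful on finite sets only: this is the number of k-cycles
   when there are finitely many of them, as in finite graphs. *)
Definition num_cycles (T : choiceType) (e : rel T) (k : nat) : nat :=
  #|` fset_set [set C | is_cycle e k C] |.

Definition num_cycles_at (T : choiceType) (e : rel T) (k : nat) (o : T) : nat :=
  #|` fset_set [set C | is_cycle e k C /\ exists2 E, E \in C & o \in E] |.

(* Finitely or countably many vertices: up to isomorphism, the vertex set is a
   set of natural numbers. *)
Record graph (D : nat) := Graph {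
  vertices : set nat;
  adj : rel nat;
  adj_sym : symmetric adj;
  adj_irr : irreflexive adj;
  adj_vertices : forall x y, adj x y -> vertices x;
  graph_connected : forall x y, vertices x -> vertices y ->
    exists2 p : seq nat, path adj x p & last x p = y;
  degree_bound : forall x, [set y | adj x y] #<= `I_D }.

(* Connected graphs with a distinguished walk of n steps: for n = 0 these are
   the rooted graphs (G, o), and for n = 1 the graphs with a distinguished
   directed edge (o, v). *)
Record walk_graph (D n : nat) := WalkGraph {
  wg_graph :> graph D;
  walk : n.+1.-tuple nat;
  walk_vertices : forall x, x \in tval walk -> vertices wg_graph x;
  walk_adj : sorted (adj wg_graph) walk }.

Notation rooted_graph D := (walk_graph D 0).
Notation edge_graph D := (walk_graph D 1).

HB.instance Definition _ D n := gen_eqMixin (walk_graph D n).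
HB.instance Definition _ D n := gen_choiceMixin (walk_graph D n).

(* The subgraphs induced by e on A and by e' on B are isomorphic, by an
   isomorphism that maps the list of vertices s to the list s'. *)
Definition iso_on (A B : set nat) (e e' : rel nat) (s s' : seq nat) : Prop :=
  exists f : nat -> nat, [/\ set_bij A B f, map f s = s'
    & forall x y, A x -> A y -> e' (f x) (f y) = e x y].

Definition wg_iso D n (G H : walk_graph D n) : Prop :=
  iso_on (vertices G) (vertices H) (adj G) (adj H) (walk G) (walk H).

(* Vertices at distance at most k from the distinguished walk; for n = 0, the
   k-ball around the root. *)
Definition wg_ball D n (G : walk_graph D n) (k : nat) : set nat :=
  [set x | exists o p, [/\ o \in tval (walk G), path (adj G) o p,
                           last o p = x & (size p <= k)%N]].

Definition wg_ball_iso D n (k : nat) (G H : walk_graph D n) : Prop :=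
  iso_on (wg_ball G k) (wg_ball H k) (adj G) (adj H) (walk G) (walk H).

(* 1/k for the largest k such that the k-balls are isomorphic; it is +oo when
   already the 1-balls differ (k = 0), and 0 when all the k-balls are
   isomorphic. *)
Definition wg_dist (R : realType) D n (G H : walk_graph D n) : \bar R :=
  ereal_inf [set ((k%:R : R)%:E)^-1%E | k in [set k | wg_ball_iso k G H]].

Lemma iso_on_refl A e s : iso_on A A e e s s.
Proof.
exists id; split => //; last by rewrite map_id.
by split => // x Ax; exists x.
Qed.

Lemma iso_on_sym A B e e' (s s' : seq nat) : (forall x, x \in s -> A x) ->
  iso_on A B e e' s s' -> iso_on B A e' e s' s.
Proof.
move=> sA [f [[fA finj fB] fs fe]].
have /boolp.choice[g gP] : forall y, exists x, B y -> A x /\ f x = y.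
  move=> y; have [By|nBy] := pselect (B y).
    by have [x Ax <-] := fB y By; exists x.
  by exists 0%N.
have gK x : A x -> g (f x) = x.
  move=> Ax; have [Ag fg] := gP _ (fA _ Ax).
  by apply: finj; rewrite ?inE.
exists g; split.
- split => [y By|y z /set_mem By /set_mem Bz gyz|x Ax].
  + exact: (gP _ By).1.
  + by rewrite -(gP _ By).2 gyz (gP _ Bz).2.
  + by exists (f x); [exact: fA|exact: gK].
- rewrite -fs -map_comp -[RHS]map_id; apply/eq_in_map => x /sA Ax /=.
  exact: gK.
- move=> x y Bx By; have [Agx fgx] := gP _ Bx; have [Agy fgy] := gP _ By.
  by rewrite -fe // fgx fgy.
Qed.

Lemma iso_on_trans A B C e1 e2 e3 s1 s2 s3 :
  iso_on A B e1 e2 s1 s2 -> iso_on B C e2 e3 s2 s3 -> iso_on A C e1 e3 s1 s3.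
Proof.
move=> [f [[fA finj fB] fs fe]] [g [[gB ginj gC] gs ge]].
exists (g \o f); split.
- split => [x Ax|x y /set_mem Ax /set_mem Ay /= gxy|z Cz].
  + by apply: gB; exact: fA.
  + apply: finj; rewrite ?inE//; apply: ginj; rewrite ?inE//; exact: fA.
  + have [y By <-] := gC _ Cz; have [x Ax <-] := fB _ By.
    by exists x.
- by rewrite map_comp fs gs.
- by move=> x y Ax Ay /=; rewrite ge ?fe//; exact: fA.
Qed.

Lemma wg_iso_equiv D n :
  equiv_class_of (fun G H : walk_graph D n => `[< wg_iso G H >]).
Proof.
split => [G|G H|H G K].
- by apply/asboolP; exact: iso_on_refl.
- by apply/idP/idP => /asboolP h; apply/asboolP;
    apply: iso_on_sym h; exact: walk_vertices.
- by move=> /asboolP h1 /asboolP h2; apply/asboolP; exact: iso_on_trans h1 h2.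
Qed.

Canonical wg_iso_equivRel D n := EquivRelPack (@wg_iso_equiv D n).

Lemma wg_ball_walk D n (G : walk_graph D n) k x :
  x \in tval (walk G) -> wg_ball G k x.
Proof. by move=> xG; exists x, [::]. Qed.

Lemma wg_ball_le D n (G : walk_graph D n) j k :
  (j <= k)%N -> wg_ball G j `<=` wg_ball G k.
Proof.
move=> jk x [u [p [uG po lp sp]]]; exists u, p; split=> //.
exact: leq_trans sp jk.
Qed.

Lemma wg_ball_iso_sym D n k (G H : walk_graph D n) :
  wg_ball_iso k G H -> wg_ball_iso k H G.
Proof. by apply: iso_on_sym => x; exact: wg_ball_walk. Qed.

Lemma wg_ball_image D n j k (G H : walk_graph D n) (f : nat -> nat) :
  (j <= k)%N -> map f (walk G) = walk H ->
  (forall x y, wg_ball G k x -> wg_ball G k y ->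
     adj H (f x) (f y) = adj G x y) ->
  forall x, wg_ball G j x -> wg_ball H j (f x).
Proof.
move=> jk fw fe x [u [p [uG po lp sp]]].
exists (f u), (map f p); split; last by rewrite size_map.
- by rewrite -fw map_f.
- suff : forall q, (size q <= k)%N -> path (adj G) u q ->
      path (adj H) (f u) (map f q).
    by apply => //; exact: leq_trans jk.
  elim/last_ind => //= q y IH; rewrite size_rcons => sq.
  rewrite map_rcons !rcons_path last_map => /andP[pq qy].
  rewrite IH ?(ltnW sq)//= fe //.
  + by exists u, q; split => //; exact: ltnW.
  + exists u, (rcons q y); rewrite last_rcons size_rcons; split => //.
    by rewrite rcons_path pq.
- by rewrite last_map lp.
Qed.

Lemma wg_ball_iso_le D n j k (G H : walk_graph D n) :
  (j <= k)%N -> wg_ball_iso k G H -> wg_ball_iso j G H.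
Proof.
move=> jk [f [[fA finj fB] fs fe]].
have jkG := wg_ball_le (G := G) jk; have jkH := wg_ball_le (G := H) jk.
exists f; split => //; last by move=> x y /jkG ? /jkG ?; exact: fe.
split => [x Gx|x y /set_mem/jkG Gx /set_mem/jkG Gy|y Hy].
- exact: wg_ball_image jk fs fe _ Gx.
- by apply: finj; rewrite inE.
have /boolp.choice[g gP] : forall z, exists x, wg_ball H k z ->
    wg_ball G k x /\ f x = z.
  move=> z; have [By|nBy] := pselect (wg_ball H k z).
    by have [x Ax <-] := fB z By; exists x.
  by exists 0%N.
have gK x : wg_ball G k x -> g (f x) = x.
  move=> Ax; have [Ag fg] := gP _ (fA _ Ax).
  by apply: finj; rewrite ?inE.
exists (g y); last exact: (gP _ (jkH _ Hy)).2.
apply: wg_ball_image jk _ _ _ Hy.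
- rewrite -fs -map_comp -[RHS]map_id; apply/eq_in_map => x xw /=.
  by apply: gK; exact: wg_ball_walk.
- move=> x z Bx Bz; have [Agx fgx] := gP _ Bx; have [Agz fgz] := gP _ Bz.
  by rewrite -fe // fgx fgz.
Qed.

Section dist.
Context {R : realType} {D n : nat}.
Implicit Types (G H K : walk_graph D n) (e : R).

Lemma wg_dist_ltP G H e : 0 < e ->
  (wg_dist R G H < e%:E)%E <->
  exists k, [/\ (0 < k)%N, k%:R^-1 < e & wg_ball_iso k G H].
Proof.
move=> e0; split => [/ereal_inf_lt[_ [k kGH <-]]|[k [k0 ke kGH]]].
  rewrite /inve pnatr_eq0; case: eqP => // /eqP k0.
  by rewrite lte_fin => ke; exists k; rewrite lt0n.
apply: (@le_lt_trans _ _ (k%:R^-1)%:E); last by rewrite lte_fin.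
by apply: ereal_inf_lbound; exists k => //; rewrite /inve pnatr_eq0 gtn_eqF.
Qed.

Lemma wg_dist_ge0 G H : (0 <= wg_dist R G H)%E.
Proof.
apply: le_ereal_inf_tmp => _ [k _ <-]; rewrite /inve.
by case: eqP => // _; rewrite lee_fin invr_ge0.
Qed.

Lemma wg_dist_lt_gt0 G H e : (wg_dist R G H < e%:E)%E -> 0 < e.
Proof. by move=> /(le_lt_trans (wg_dist_ge0 G H)); rewrite lte_fin. Qed.

Lemma wg_dist_refl G e : 0 < e -> (wg_dist R G G < e%:E)%E.
Proof.
move=> e0; apply/wg_dist_ltP => //.
exists (Num.truncn e^-1).+1; split => //; last exact: iso_on_refl.
rewrite -[ltRHS]invrK ltf_pV2 ?posrE ?invr_gt0 ?ltr0Sn//.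
by rewrite truncnS_gt.
Qed.

Lemma wg_dist_sym G H e :
  (wg_dist R G H < e%:E)%E -> (wg_dist R H G < e%:E)%E.
Proof.
move=> GH; have e0 := wg_dist_lt_gt0 GH.
move/(wg_dist_ltP _ _ e0): GH => [k [k0 ke kGH]].
by apply/wg_dist_ltP => //; exists k; split => //; exact: wg_ball_iso_sym.
Qed.

Lemma wg_dist_triangle G H K e1 e2 :
  (wg_dist R G H < e1%:E)%E -> (wg_dist R H K < e2%:E)%E ->
  (wg_dist R G K < (e1 + e2)%:E)%E.
Proof.
move=> GH HK; have e10 := wg_dist_lt_gt0 GH; have e20 := wg_dist_lt_gt0 HK.
move/(wg_dist_ltP _ _ e10): GH => [j [j0 je jGH]].
move/(wg_dist_ltP _ _ e20): HK => [k [k0 ke kHK]].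
apply/wg_dist_ltP; first exact: addr_gt0.
have [jk|/ltnW kj] := leqP j k.
- exists j; split => //; first by rewrite (lt_le_trans je)// lerDl ltW.
  by apply: iso_on_trans jGH _; exact: wg_ball_iso_le kHK.
- exists k; split => //; first by rewrite (lt_le_trans ke)// lerDr ltW.
  by apply: iso_on_trans kHK; exact: wg_ball_iso_le jGH.
Qed.

End dist.

(* The spaces of isomorphism classes.  The field R is a parameter because it is
   where the distances live in the library's pseudometric structures. *)
Definition walk_space (R : realType) (D n : nat) : Type :=
  {eq_quot (wg_iso_equivRel D n)}.
HB.instance Definition _ R D n := Choice.on (walk_space R D n).
HB.instance Definition _ R D n := EqQuotient.on (walk_space R D n).

Section space.
Context (R : realType) (D n : nat).
Local Notation X := (walk_space R D n).

Definition space_ball (x : X) (e : R) : set X :=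
  [set y | (wg_dist R (repr x) (repr y) < e%:E)%E].

HB.instance Definition _ := hasNbhs.Build X (nbhs_ (entourage_ space_ball)).

Let ball_center (x : X) (e : R) : 0 < e -> space_ball x e x.
Proof. exact: wg_dist_refl. Qed.

Let ball_sym (x y : X) (e : R) : space_ball x e y -> space_ball y e x.
Proof. exact: wg_dist_sym. Qed.

Let ball_triangle (x y z : X) (e1 e2 : R) :
  space_ball x e1 y -> space_ball y e2 z -> space_ball x (e1 + e2) z.
Proof. exact: wg_dist_triangle. Qed.

HB.instance Definition _ := @Nbhs_isPseudoMetric.Build R X
  (entourage_ space_ball) erefl space_ball ball_center ball_sym ball_triangle
  erefl.

End space.

Notation rooted_space R D := (walk_space R D 0).
Notation edge_space R D := (walk_space R D 1).

Section one_vertex.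
Context (D : nat).
Let no_adj : rel nat := fun _ _ => false.

Let connected1 (x y : nat) : [set 0%N] x -> [set 0%N] y ->
  exists2 p : seq nat, path no_adj x p & last x p = y.
Proof. by move=> -> ->; exists [::]. Qed.

Let degree1 (x : nat) : [set y | no_adj x y] #<= `I_D.
Proof.
rewrite (_ : [set y | _] = set0) ?card_le0x//.
by apply/seteqP; split.
Qed.

Definition one_vertex_graph : graph D :=
  @Graph D [set 0%N] no_adj (fun _ _ => erefl) (fun _ => erefl)
    (fun x y (h : false) => False_ind _ (notF h)) connected1 degree1.

Let root1 (x : nat) : x \in [:: 0%N] -> vertices one_vertex_graph x.
Proof. by rewrite mem_seq1 => /eqP. Qed.

Definition one_vertex_rooted : rooted_graph D :=
  @WalkGraph D 0 one_vertex_graph [tuple 0%N] root1 isT.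

End one_vertex.

HB.instance Definition _ (R : realType) (D : nat) :=
  isPointed.Build (rooted_space R D)
    (\pi_(rooted_space R D) (one_vertex_rooted D)).

Definition borel_rooted (R : realType) (D : nat) :=
  g_sigma_algebraType (@open (rooted_space R D)).

Notation random_graph R D := (probability (borel_rooted R D) R).

Definition wg_root D (G : rooted_graph D) : nat := thead (walk G).

Definition wg_regular D n (r : nat) (G : walk_graph D n) : Prop :=
  forall x, vertices G x -> [set y | adj G x y] #= `I_r.

Definition random_regular (R : realType) (D r : nat)
    (lambda : random_graph R D) : Prop :=
  {ae lambda, forall x : borel_rooted R D,
    wg_regular r (repr (x : rooted_space R D))}.

Section edges.
Context (D : nat).

Let edge_vertices (G : rooted_graph D) (v : nat) (h : adj G (wg_root G) v) :
  forall x, x \in [:: wg_root G; v] -> vertices G x.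
Proof.
move=> x; rewrite !inE => /orP[] /eqP ->; first exact: adj_vertices h.
by rewrite adj_sym in h; exact: adj_vertices h.
Qed.

Let edge_sorted (G : rooted_graph D) (v : nat) (h : adj G (wg_root G) v) :
  sorted (adj G) [:: wg_root G; v].
Proof. by rewrite /= h. Qed.

(* (G, o, v) for a neighbour v of the root o of (G, o) *)
Definition add_edge (G : rooted_graph D) (v : nat) (h : adj G (wg_root G) v) :
    edge_graph D :=
  @WalkGraph D 1 G [tuple wg_root G; v] (edge_vertices h) (edge_sorted h).

Let rev_vertices (G : edge_graph D) (x : nat) :
  x \in rev (walk G) -> vertices G x.
Proof. by rewrite mem_rev; exact: walk_vertices. Qed.

Let rev_adj (G : edge_graph D) : sorted (adj G) (rev (walk G)).
Proof.
rewrite rev_sorted; have := walk_adj G.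
by apply: sub_sorted => x y; rewrite adj_sym.
Qed.

Definition rev_edge (G : edge_graph D) : edge_graph D :=
  @WalkGraph D 1 G [tuple of rev (walk G)] (@rev_vertices G) (rev_adj G).

End edges.

Definition space_rev (R : realType) (D : nat) (x : edge_space R D) :
    edge_space R D := \pi_(edge_space R D) (rev_edge (repr x)).

(* The probability that (G, o, v) is in A, v being a uniformly random
   neighbour of o. *)
Definition neighbour_prob (R : realType) (D : nat) (A : set (edge_space R D))
    (G : rooted_graph D) : R :=
  #|` fset_set [set v | exists h : adj G (wg_root G) v,
                 A (\pi_(edge_space R D) (add_edge h))] |%:R
  / #|` fset_set [set v | adj G (wg_root G) v] |%:R.

Definition edge_law (R : realType) (D : nat) (lambda : random_graph R D)
    (A : set (edge_space R D)) : \bar R :=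
  (\int[lambda]_x (neighbour_prob A (repr (x : rooted_space R D)))%:E)%E.

(* Equality, as Borel measures, of the law of (G, o, v) and of its
   image by the reversal. *)
Definition unimodular (R : realType) (D : nat) (lambda : random_graph R D) :
    Prop :=
  forall A : set (edge_space R D), <<s @open (edge_space R D) >> A ->
    edge_law lambda A = edge_law lambda (@space_rev R D @^-1` A).

Definition random_cycle_density (R : realType) (D k : nat)
    (lambda : random_graph R D) : R :=
  k%:R^-1 * \int[lambda]_x
    (let G := repr (x : rooted_space R D) in
     (num_cycles_at (adj G) k (wg_root G))%:R).

Definition cycle_density (R : realType) (T : finType) (e : rel T) (k : nat) :
    R := (num_cycles e k)%:R / #|T|%:R.

Definition random_densities (R : realType) (D r : nat) : set (R^o * R^o) :=
  [set p | exists lambda : random_graph R D,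
    [/\ random_regular r lambda, unimodular lambda
      & p = (random_cycle_density 3 lambda, random_cycle_density 4 lambda)]].

Definition finite_densities (R : realType) (r : nat) : set (R^o * R^o) :=
  [set p | exists (T : finType) (e : rel T),
    [/\ (0 < #|T|)%N, symmetric e, irreflexive e, forall x, #|e x| = r
      & p = (cycle_density R e 3, cycle_density R e 4)]].

(* For 0 < l <= r these l numbers have sum r and differ by at most 1. *)
Definition part_size (r l i : nat) : nat := ((r + i - 1) %/ l)%N.

Definition extreme_point (R : realType) (r l : nat) : R^o * R^o :=
  if l is 0%N then (0, (r * (r - 1) ^ 2)%:R / 8%:R)
  else (3%:R^-1 * \sum_(1 <= i < l.+1) 'C(part_size r l i, 2)%:R,
        4%:R^-1 * \sum_(1 <= i < l.+1)
          (part_size r l i * 'C(part_size r l i - 1, 2))%:R).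

Definition density_polygon (R : realType) (r : nat) : set (R^o * R^o) :=
  smallest (@convex_set R (R^o * R^o)%type)
    [set extreme_point R r l | l in [set l | (l <= r)%N]].

Arguments random_densities : clear implicits.
Arguments finite_densities : clear implicits.
Arguments density_polygon : clear implicits.

(* Main.v *)
(* Fix a root o of degree r and let T, S, C, K be the numbers of ordered
   triangles, ordered squares, paths of two edges in the link of o, and ordered
   triangles in the link of o, so that 2 c_3 = T and 2 c_4 = S at o.

   The point (T / 6, (3 C - K) / 16) is determined by the link, a graph on r
   vertices, and lies in the polygon: by inclusion-exclusion it depends on the
   numbers of edges and triangles of the complement, which are affine when
   weight is moved between two vertices that are not adjacent in the
   complement.  As in the proof of the Motzkin-Straus theorem, this reduces the
   claim to links that are disjoint unions of cliques, and then to cliques of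
   nearly equal sizes, which give the points P_l.

   For the lower bound on d_4, the C paths of the link and the induced diamonds
   whose non-edge contains o give distinct squares at o.  Unimodularity moves
   the root of these diamonds to an end of the chord, where there are C - K of them,
   so the mean of S is at least that of 2 C - K >= (3 C - K) / 2.  The upper
   bound is S + T <= r (r - 1)^2, the segment from P_0 to P_1.

   Conversely P_0 is the point of K_{r,r} and P_l that of a finite graph in
   which each vertex lies in l cliques of nearly equal sizes and every short
   cycle lies in a clique.  Disjoint unions of such graphs, with weights on
   the vertices, are unimodular random graphs and give the whole polygon;
   rational weights are obtained by finite graphs. *)

Require Import Defs.
From HB Require Import structures.
From mathcomp Require Import all_boot all_order all_algebra finmap.
From mathcomp Require Import all_classical all_reals all_analysis measurable_realfun.
From mathcomp Require Import lra zify.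

Set Implicit Arguments.
Unset Strict Implicit.
Unset Printing Implicit Defensive.

Import Order.TTheory GRing.Theory Num.Theory.
Import numFieldNormedType.Exports.

Local Open Scope classical_set_scope.
Local Open Scope ring_scope.
Local Open Scope quotient_scope.

(** * The hull of the clique partitions *)

(** Why [3 C - K]: expanding the product that counts ordered triangles of the complement of the link
    gives [r (r - 1) (r - 2) - 3 (r - 2) T + 3 C - K], and the ordered edges number [r (r - 1) - T],
    so the point is an affine function of these two counts. In a disjoint union of cliques every
    path closes, [C = K], and [(3 C - K) / 16] becomes the [K / 8] of the graphs behind [P_l]; in
    general the lower bound gives away [2 C - K - (3 C - K) / 2 = (C - K) / 2]. The other obstacle
    is measure theory on isomorphism classes, where integrands are read off an arbitrary
    representative. For an arbitrary random graph only statistics determined by a ball of fixed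
    radius are used: they are locally constant, hence Borel, and bounded in terms of [D], so seven
    of them together have finite range and every mean is a finite sum. The constructed random graphs
    are supported on finitely many finite graphs, whose classes are isolated points, so the integral
    of any nonnegative function is a finite sum. *)

Definition convex2 (R : numDomainType) (Q : R -> R -> Prop) :=
  forall t x y x' y', 0 <= t -> t <= 1 -> Q x y -> Q x' y' ->
    Q (t * x + (1 - t) * x') (t * y + (1 - t) * y').

(** With [r = l m + c], the numerator [r + i - 1] reaches the next multiple of [l] exactly when
    [i > l - c]: the first [l - c] parts are [m] and the last [c] are [m + 1]. *)
Lemma sum_part_size (V : nmodType) (g : nat -> V) (m c l : nat) : (c < l)%N ->
  \sum_(1 <= i < l.+1) g (part_size (l * m + c) l i) =
  g m *+ (l - c) + g m.+1 *+ c.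
Proof.
move=> cl; rewrite big_add1 /= (@big_cat_nat _ _ _ (l - c)) ?leq_subr//=.
congr (_ + _).
  rewrite -[in RHS](subn0 (l - c)%N) -sumr_const_nat.
  apply: eq_big_nat => i /andP[_ il]; congr g.
  rewrite /part_size addnS subn1 /= -addnA mulnC divnMDl ?(leq_ltn_trans _ cl)//.
  by rewrite divn_small ?addn0//; lia.
rewrite -{3}(subKn (ltnW cl)) -sumr_const_nat.
apply: eq_big_nat => i /andP[li il]; congr g.
rewrite /part_size addnS subn1 /= -addnA mulnC divnMDl ?(leq_ltn_trans _ cl)//.
rewrite -addn1; congr addn; apply/eqP; rewrite eqn_leq -ltnS ltn_divLR ?leq_divRL; lia.
Qed.

(** If [m] is the least entry, each entry is [m] or [m.+1]. The number [c] of larger entries is less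
    than the length, so [m] and [c] are quotient and remainder of [r], and the entries are the
    numbers [part_size] up to order. *)
Lemma sum_balanced (V : nmodType) (g : nat -> V) (s : seq nat) (r : nat) :
  (0 < size s)%N -> sumn s = r ->
  (forall a b, a \in s -> b \in s -> (a <= b.+1)%N) ->
  \sum_(a <- s) g a = \sum_(1 <= i < (size s).+1) g (part_size r (size s) i).
Proof.
move=> s0 <- bal.
have [m ms mmin] : exists2 m, m \in s & forall a, a \in s -> (m <= a)%N.
  case: s s0 {bal} => // a s _; elim: s a => [|b s IH] a.
    by exists a => [|c]; rewrite inE// => /eqP ->.
  have [m] := IH b => ms mm.
  case: (leqP a m) => am.
    exists a; first by rewrite inE eqxx.
    by move=> c; rewrite inE => /orP[/eqP->//|/mm]; exact: leq_trans.
  exists m; first by rewrite inE ms orbT.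
  by move=> c; rewrite inE => /orP[/eqP->//|/mm//]; exact: ltnW.
have two a : a \in s -> a != m -> a = m.+1.
  move=> as_ am; apply/eqP; rewrite eqn_leq bal// ltn_neqAle eq_sym am.
  exact: mmin.
set c := count (predC (pred1 m)) s.
have cl : (c < size s)%N.
  by rewrite -(count_predC (pred1 m)) -[ltnLHS]add0n ltn_add2r -has_count has_pred1.
have gE (W : nmodType) (h : nat -> W) :
    \sum_(a <- s) h a = h m *+ (size s - c) + h m.+1 *+ c.
  rewrite (bigID (pred1 m)) /= -(count_predC (pred1 m) s) addnK.
  rewrite -!iter_addr_0 -!big_const_seq; congr (_ + _).
    by apply: eq_bigr => a /eqP ->.
  rewrite [LHS]big_seq_cond [RHS]big_seq_cond.
  by apply: eq_bigr => a /andP[/two + h1] => ->.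
rewrite gE.
have -> : sumn s = (size s * m + c)%N.
  have natmulE (a b : nat) : a *+ b = (b * a)%N.
    by elim: b => // b IH; rewrite mulrS IH mulSn.
  have -> : sumn s = \sum_(a <- s) a by rewrite sumnE.
  by rewrite gE !natmulE mulnBl mulnS; nia.
by rewrite sum_part_size.
Qed.

Section hull.
Context (R : realFieldType) (Q : R -> R -> Prop).

(** Contributions to the two coordinates of a clique with [a + 1] vertices: each vertex lies on
    [a (a - 1) / 2] of its triangles and [a (a - 1) (a - 2) / 2] of its squares, to be divided by 3
    and by 4. *)
Definition clique_x (a : nat) : R := a%:R * (a%:R - 1) / 6%:R.
Definition clique_y (a : nat) : R := a%:R * (a%:R - 1) * (a%:R - 2%:R) / 8%:R.

(* The clique functions of two parts a, b with a + b fixed are affine in the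
   product a * b, so an unbalanced pair is a convex combination of a single
   merged part and of a more balanced pair. *)
Lemma hull_partition (r : nat) : convex2 Q -> (0 < r)%N ->
  (forall l, (0 < l <= r)%N ->
     Q (\sum_(1 <= i < l.+1) clique_x (part_size r l i))
       (\sum_(1 <= i < l.+1) clique_y (part_size r l i))) ->
  forall s : seq nat, all (leq 1) s -> sumn s = r ->
    Q (\sum_(a <- s) clique_x a) (\sum_(a <- s) clique_y a).
Proof.
move=> cQ r0 Qbal s.
(* Outer induction on the number of parts, inner on the sum of their squares: merging two parts
   lowers the former, moving a unit from [a] to [b] lowers the latter. *)
have [n] := ubnP (size s); elim: n s => // n IHn s.
have [k] := ubnP (\sum_(a <- s) a ^ 2)%N; elim: k s => // k IHk s.
move=> sk sn s1 sr.
have sz0 : (0 < size s)%N by case: (s) sr r0 => //= <-.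
have szr : (size s <= r)%N.
  rewrite -sr; elim: (s) s1 => //= a s' IH /andP[a1 /IH]; lia.
have [bal|] := pselect (forall a b, a \in s -> b \in s -> (a <= b.+1)%N).
  rewrite !(sum_balanced _ _ sr bal)//; apply: Qbal.
  by rewrite sz0.
move=> /existsNP[a /existsNP[b /not_implyP[sa /not_implyP[sb /negP]]]].
rewrite -ltnNge => ab.
have [s' ps] : exists s', perm_eq s (a :: b :: s').
  exists (rem b (rem a s)).
  rewrite (perm_trans (perm_to_rem sa))// perm_cons perm_to_rem//.
  have bna : b != a by apply/eqP; lia.
  by have := sb; rewrite (perm_mem (perm_to_rem sa)) inE (negbTE bna).
have a1 : (0 < a)%N by move/allP: s1 => /(_ _ sa).
have b1 : (0 < b)%N by move/allP: s1 => /(_ _ sb).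
have s'1 : all (leq 1) s' by move: s1; rewrite (perm_all _ ps) /= => /and3P[].
have sr' : (a + (b + sumn s'))%N = r.
  by rewrite -sr (perm_sumn ps).
rewrite !(perm_big _ ps) /= !big_cons.
have szs : size s = (size s').+2 by rewrite (perm_size ps).
move: sk; rewrite (perm_big _ ps) /= !big_cons => sk.
have H1 : Q (\sum_(i <- (a + b)%N :: s') clique_x i)
            (\sum_(i <- (a + b)%N :: s') clique_y i).
  apply: IHn => /=; first by rewrite szs ltnS in sn.
    by rewrite s'1 andbT; lia.
  lia.
have H2 : Q (\sum_(i <- [:: a.-1, b.+1 & s']) clique_x i)
            (\sum_(i <- [:: a.-1, b.+1 & s']) clique_y i).
  apply: IHk => /=; rewrite -?szs//.
  - by rewrite !big_cons; case: (a) ab sk => // a' ab /=; nia.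
  - by rewrite s'1 andbT; lia.
  - lia.
(* [d] is the product of the balanced pair, and the merged part counts as the pair [(a + b, 0)] of
   product 0; hence [t] must satisfy [t * d = a * b]. The gap [a >= b + 2] gives [t <= 1]. *)
pose d : R := (a%:R - 1) * (b%:R + 1).
have ab' : (b%:R + 2%:R <= a%:R :> R) by rewrite -natrD ler_nat; lia.
have b1' : (1 <= b%:R :> R) by rewrite ler1n.
have d0 : 0 < d by rewrite mulr_gt0//; lra.
pose t := a%:R * b%:R / d.
have td : t * d = a%:R * b%:R by rewrite divfK// gt_eqF.
have t0 : 0 <= t by exact: divr_ge0 (mulr_ge0 (ler0n _ _) (ler0n _ _)) (ltW d0).
have t1 : t <= 1 by rewrite ler_pdivrMr// mul1r /d; lra.
have td' : t * d * (a%:R + b%:R - 2%:R) = a%:R * b%:R * (a%:R + b%:R - 2%:R).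
  by rewrite td.
have := cQ _ _ _ _ _ t0 t1 H2 H1.
rewrite !big_cons -subn1 -(addn1 b) /clique_x /clique_y natrB// !natrD.
move: td td'; rewrite /d => td td'.
set X := \sum_(_ <- _) _; set Y := \sum_(_ <- _) _.
by congr Q; lra.
Qed.

(** * Motzkin-Straus weights on the complement of the link *)

Section weights.
Context (T : finType) (F : rel T).
Hypotheses (Fsym : symmetric F) (Firr : irreflexive F).

(** An integral weight [n x] stands for [n x] copies of [x], pairwise non-adjacent for [F]. When [F]
    is the complement of the link, the copies form a clique of the link. *)
Definition edge_weight (n : T -> R) : R :=
  \sum_x \sum_y n x * n y * (F x y)%:R.

Definition triangle_weight (n : T -> R) : R :=
  \sum_x \sum_y \sum_z n x * n y * n z * (F x y && F y z && F x z)%:R.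

(* Each edge or triangle meets the non-edge pq in at most one vertex. *)
Lemma weight_affine (p q : T) (t : R) (n n1 n2 : T -> R) : ~~ F p q ->
  (forall x, n x = t * n1 x + (1 - t) * n2 x) ->
  (forall x, x != p -> x != q -> n1 x = n2 x) ->
  edge_weight n = t * edge_weight n1 + (1 - t) * edge_weight n2 /\
  triangle_weight n = t * triangle_weight n1 + (1 - t) * triangle_weight n2.
Proof.
move=> Fpq nE n12.
have in_pq x y : x \in [:: p; q] -> y \in [:: p; q] -> F x y = false.
  rewrite !inE => /orP[] /eqP -> /orP[] /eqP ->; rewrite ?Firr//.
    exact: negbTE.
  by rewrite Fsym; exact: negbTE.
have n12' x : x \notin [:: p; q] -> n1 x = n2 x.
  by rewrite !inE negb_or => /andP[]; exact: n12.
split.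
  rewrite /edge_weight !mulr_sumr -big_split; apply: eq_bigr => x _ /=.
  rewrite !mulr_sumr -big_split; apply: eq_bigr => y _ /=.
  rewrite !nE; have [Fxy|] := boolP (F x y); last by rewrite !mulr0 addr0.
  have [xpq|/n12' ->] := boolP (x \in [:: p; q]).
    have [ypq|/n12' ->] := boolP (y \in [:: p; q]); last by rewrite /=; lra.
    by rewrite in_pq in Fxy.
  by rewrite /=; lra.
rewrite /triangle_weight !mulr_sumr -big_split; apply: eq_bigr => x _ /=.
rewrite !mulr_sumr -big_split; apply: eq_bigr => y _ /=.
rewrite !mulr_sumr -big_split; apply: eq_bigr => z _ /=.
rewrite !nE; have [/andP[/andP[Fxy Fyz] Fxz]|] := boolP (_ && _ && _);
  last by rewrite !mulr0 addr0.
have [xpq|/n12' ->] := boolP (x \in [:: p; q]);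
  have [ypq|/n12' ->] := boolP (y \in [:: p; q]);
  have [zpq|/n12' ->] := boolP (z \in [:: p; q]).
all: try by [rewrite in_pq in Fxy|rewrite in_pq in Fyz|rewrite in_pq in Fxz].
all: by rewrite /= !mulr1; lra.
Qed.

(** On the support [F] is [x != y], so these are sums over ordered pairs and triples of distinct
    vertices; inclusion-exclusion on coincidences yields the power sums. *)
Lemma clique_weight (n : T -> R) (r : R) : \sum_x n x = r ->
  (forall x y, n x != 0 -> n y != 0 -> x != y -> F x y) ->
  edge_weight n = r ^+ 2 - \sum_x n x ^+ 2 /\
  triangle_weight n =
    r ^+ 3 - 3%:R * r * (\sum_x n x ^+ 2) + 2%:R * \sum_x n x ^+ 3.
Proof.
move=> nr Fn.
have sumD1 (g : T -> R) x : \sum_y g y * (x != y)%:R = \sum_y g y - g x.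
  rewrite [X in _ = X - _](bigD1 x)//= [g x + _]addrC addrK.
  rewrite (bigD1 x)//= eqxx mulr0 add0r.
  by apply: eq_bigr => y; rewrite eq_sym => ->; rewrite mulr1.
have sum_ne x : \sum_y n y * (x != y)%:R = r - n x by rewrite sumD1 nr.
have e2 x : \sum_y n x * n y * (F x y)%:R = n x * (r - n x).
  rewrite -sum_ne mulr_sumr; apply: eq_bigr => y _.
  have [->|x0] := eqVneq (n x) 0; first by rewrite !mul0r.
  have [->|y0] := eqVneq (n y) 0; first by rewrite !(mulr0, mul0r).
  rewrite -mulrA; congr (_ * (_ * _%:R)).
  have [<-|xy] := eqVneq x y; first by rewrite Firr.
  by rewrite Fn.
have e3 x y : \sum_z n x * n y * n z * (F x y && F y z && F x z)%:R =
    n x * n y * (F x y)%:R * (r - n x - n y).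
  have [->|x0] := eqVneq (n x) 0.
    by rewrite !mul0r big1// => z _; rewrite !mul0r.
  have [->|y0] := eqVneq (n y) 0.
    by rewrite !(mulr0, mul0r) big1// => z _; rewrite !(mulr0, mul0r).
  have [Fxy|] := boolP (F x y); last first.
    by rewrite !(mulr0, mul0r) big1// => z _; rewrite !(mulr0, mul0r).
  have xy : x != y by apply: contraTneq Fxy => ->; rewrite Firr.
  have -> : r - n x - n y = \sum_z n z * ((x != z) && (y != z))%:R.
    under eq_bigr => z _ do rewrite andbC -mulnb natrM mulrA.
    rewrite (sumD1 (fun z => n z * (y != z)%:R)) sum_ne eq_sym xy mulr1.
    by lra.
  rewrite mulr_sumr; apply: eq_bigr => z _; rewrite /= mulr1 -!mulrA; congr (_ * (_ * _)).
  have [->|z0] := eqVneq (n z) 0; first by rewrite !mul0r.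
  congr (_ * _%:R).
  have [<-|xz] := eqVneq x z; first by rewrite Firr andbF.
  have [<-|yz] := eqVneq y z; first by rewrite Firr.
  by rewrite !Fn.
have e3' x : \sum_y n x * n y * (F x y)%:R * (r - n x - n y) =
    n x * (r - n x) * (r - n x) - n x * (\sum_y n y ^+ 2 - n x ^+ 2).
  transitivity (\sum_y (n x * n y * (F x y)%:R * (r - n x)
                        - n x * (n y ^+ 2 * (x != y)%:R))).
    apply: eq_bigr => y _; rewrite mulrBr; congr (_ - _).
    have [->|x0] := eqVneq (n x) 0; first by rewrite !mul0r.
    have [->|y0] := eqVneq (n y) 0; first by rewrite !(expr0n, mulr0, mul0r).
    have [<-|xy] := eqVneq x y; first by rewrite Firr !(mulr0, mul0r).
    by rewrite Fn//; lra.
  rewrite sumrB -mulr_suml e2; congr (_ - _); rewrite -mulr_sumr; congr (_ * _).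
  exact: sumD1.
split.
  rewrite /edge_weight (eq_bigr _ (fun x _ => e2 x)).
  transitivity (\sum_x (n x * r - n x ^+ 2)).
    by apply: eq_bigr => x _; lra.
  by rewrite sumrB -mulr_suml nr; lra.
rewrite /triangle_weight.
under eq_bigr => x _ do rewrite (eq_bigr _ (fun y _ => e3 x y)) e3'.
set S2 := \sum_y n y ^+ 2.
transitivity (\sum_x (n x * (r ^+ 2 - S2) - (2%:R * r) * n x ^+ 2
                      + 2%:R * n x ^+ 3)).
  by apply: eq_bigr => x _; lra.
by rewrite big_split sumrB -mulr_suml -!mulr_sumr nr -/S2 /=; lra.
Qed.

(** Induction on the size of the support. If the support is a clique of [F], the link is a disjoint
    union of cliques of sizes [n x] and [hull_partition] applies; otherwise a non-edge [p q] allows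
    the weight of one of its ends to be emptied into the other. *)
Lemma hull_weight (r : nat) : convex2 Q -> (0 < r)%N ->
  (forall l, (0 < l <= r)%N ->
     Q (\sum_(1 <= i < l.+1) clique_x (part_size r l i))
       (\sum_(1 <= i < l.+1) clique_y (part_size r l i))) ->
  forall n : T -> nat, (\sum_x n x = r)%N ->
  Q ((r%:R * (r%:R - 1) - edge_weight (fun x => (n x)%:R)) / 6%:R)
    ((triangle_weight (fun x => (n x)%:R)
      + 2%:R * (r%:R * (r%:R - 1) * (r%:R - 2%:R))
      - 3%:R * (r%:R - 2%:R) * edge_weight (fun x => (n x)%:R)) / 16%:R).
Proof.
move=> cQ r0 Qbal n.
have [k] := ubnP #|[pred x | n x != 0%N]|; elim: k n => // k IHk n nk nr.
have [cl|] := pselect (forall x y, n x != 0%N -> n y != 0%N -> x != y -> F x y).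
  have nr' : \sum_x (n x)%:R = r%:R :> R by rewrite -natr_sum nr.
  have [|-> ->] := @clique_weight (fun x => (n x)%:R) r%:R nr'.
    by move=> x y; rewrite !pnatr_eq0; exact: cl.
  have := @hull_partition r cQ r0 Qbal [seq n x | x <- enum T & n x != 0%N].
  rewrite all_map sumnE !big_map !big_filter.
  have sum0 (g : nat -> R) : g 0%N = 0 ->
      \sum_(i <- enum T | n i != 0%N) g (n i) = \sum_i g (n i).
    move=> g0; rewrite [RHS](bigID (fun i => n i == 0%N)) /= [X in X + _]big1 ?add0r.
      by rewrite big_enum_cond.
    by move=> i /eqP ->.
  rewrite !sum0; try by rewrite /clique_x /clique_y !mul0r.
  have -> : (\sum_(i <- enum T | n i != 0%N) n i = r)%N.
    rewrite -nr [RHS](bigID (fun i => n i == 0%N)) /= [X in (X + _)%N]big1 ?add0n.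
      by rewrite big_enum_cond.
    by move=> i /eqP ->.
  move=> /(_ _ erefl) H.
  have : Q (\sum_i clique_x (n i)) (\sum_i clique_y (n i)).
    by apply: H; apply/allP => x; rewrite mem_filter /= lt0n => /andP[].
  have -> : \sum_i clique_x (n i) = (\sum_x (n x)%:R ^+ 2 - r%:R) / 6%:R.
    by rewrite -mulr_suml -nr' -sumrB; congr (_ / _); apply: eq_bigr => x _; lra.
  have -> : \sum_i clique_y (n i) = (\sum_x (n x)%:R ^+ 3
       - 3%:R * \sum_x (n x)%:R ^+ 2 + 2%:R * r%:R) / 8%:R.
    rewrite -mulr_suml -nr' !mulr_sumr -sumrB -big_split; congr (_ / _).
    by apply: eq_bigr => x _ /=; lra.
  by congr Q; lra.
move=> /existsNP[p /existsNP[q /not_implyP[p0 /not_implyP[q0 /not_implyP[pq /negP Fpq]]]]].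
pose n1 x := if x == p then (n p + n q)%N else if x == q then 0%N else n x.
pose n2 x := if x == q then (n p + n q)%N else if x == p then 0%N else n x.
have sumE n' : (forall x, x != p -> x != q -> n' x = n x) ->
    (n' p + n' q = n p + n q)%N -> (\sum_x n' x = r)%N.
  move=> n'E n'pq; rewrite -nr (bigD1 p)//= [in RHS](bigD1 p)//=.
  rewrite (bigD1 q) 1?eq_sym//= [in RHS](bigD1 q) 1?eq_sym//= !addnA n'pq.
  by congr addn; apply: eq_bigr => x /andP[]; exact: n'E.
have Q1 : (\sum_x n1 x = r)%N.
  apply: sumE => [x xp xq|]; first by rewrite /n1 (negbTE xp) (negbTE xq).
  by rewrite /n1 eqxx eq_sym (negbTE pq) eqxx addn0.
have Q2 : (\sum_x n2 x = r)%N.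
  apply: sumE => [x xp xq|]; first by rewrite /n2 (negbTE xp) (negbTE xq).
  by rewrite /n2 eqxx (negbTE pq) eqxx.
have/IHk/(_ Q1) H1 : (#|[pred x | n1 x != 0%N]| < k)%N.
  rewrite ltnS in nk; apply: leq_trans nk; apply: proper_card; apply/properP; split.
    apply/fintype.subsetP => x; rewrite !inE; apply: contraNN => /eqP x0.
    have /negbTE xp : x != p by apply: contraNneq p0 => <-; rewrite x0.
    have /negbTE xq : x != q by apply: contraNneq q0 => <-; rewrite x0.
    by rewrite /n1 xp xq x0.
  by exists q; rewrite !inE//= /n1 [q == p]eq_sym (negbTE pq) eqxx.
have/IHk/(_ Q2) H2 : (#|[pred x | n2 x != 0%N]| < k)%N.
  rewrite ltnS in nk; apply: leq_trans nk; apply: proper_card; apply/properP; split.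
    apply/fintype.subsetP => x; rewrite !inE; apply: contraNN => /eqP x0.
    have /negbTE xp : x != p by apply: contraNneq p0 => <-; rewrite x0.
    have /negbTE xq : x != q by apply: contraNneq q0 => <-; rewrite x0.
    by rewrite /n2 xp xq x0.
  by exists p; rewrite !inE//= /n2 (negbTE pq) eqxx.
(* [n1] and [n2] put all of [n p + n q] on [p] and on [q]. This [t] makes [n] their convex
   combination, while both remain integral, as clique sizes must be. *)
pose t : R := (n p)%:R / ((n p)%:R + (n q)%:R).
have p0' : 0 < (n p)%:R :> R by rewrite ltr0n lt0n.
have q0' : 0 < (n q)%:R :> R by rewrite ltr0n lt0n.
have s0 : 0 < (n p)%:R + (n q)%:R :> R by rewrite addr_gt0.
have [] := @weight_affine p q t (fun x => (n x)%:R) (fun x => (n1 x)%:R)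
   (fun x => (n2 x)%:R) Fpq.
- move=> x; rewrite /n1 /n2; case: (eqVneq x p) => [->|xp].
    by rewrite (negbTE pq) natrD mulr0 addr0 /t divfK// gt_eqF.
  case: (eqVneq x q) => [->|xq].
    by rewrite natrD mulr0 add0r mulrBl mul1r /t divfK ?gt_eqF//; lra.
  by lra.
- by move=> x xp xq; rewrite /n1 /n2 (negbTE xp) (negbTE xq).
move=> -> ->.
have := cQ t _ _ _ _ _ _ H1 H2.
have t0 : 0 <= t by rewrite divr_ge0 ?ltW.
have t1 : t <= 1 by rewrite ler_pdivrMr// mul1r lerDl ltW.
by move=> /(_ t0 t1); congr Q; lra.
Qed.

End weights.
End hull.

Lemma fset2_eqP (T : choiceType) (x y u v : T) :
  [fset x; y]%fset = [fset u; v]%fset -> x = u /\ y = v \/ x = v /\ y = u.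
Proof.
move=> /fsetP xyuv.
have : x \in [fset u; v]%fset by rewrite -xyuv !inE eqxx.
have : y \in [fset u; v]%fset by rewrite -xyuv !inE eqxx orbT.
have : u \in [fset x; y]%fset by rewrite xyuv !inE eqxx.
have : v \in [fset x; y]%fset by rewrite xyuv !inE eqxx orbT.
by rewrite !inE; do 4 case/orP => /eqP ?; subst; auto.
Qed.

(** * Cycles through a vertex *)

Section local_counts.
Local Open Scope nat_scope.

Lemma sum_bool_seq (X : Type) (s : seq X) (p : pred X) :
  \sum_(x <- s) p x = count p s.
Proof. by elim: s => [|x s IH]; rewrite ?big_nil// big_cons IH. Qed.

(** Each fibre of [f] on [W] is a pair [{w, s w}]. In the applications [s] reverses a closed walk,
    which keeps its set of edges. *)
Lemma size_two_to_one (X Y : eqType) (W : seq X) (f : X -> Y) (s : X -> X) :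
  uniq W -> (forall w, w \in W -> [/\ s w \in W, s w != w & f (s w) = f w]) ->
  (forall w w', w \in W -> w' \in W -> f w' = f w -> w' = w \/ w' = s w) ->
  size W = (size (undup (map f W))).*2.
Proof.
move=> uW sW fW.
have fib w : w \in W -> \sum_(w' <- W) (f w' == f w) = 2%N.
  move=> wW; have [swW sw fsw] := sW _ wW.
  rewrite sum_bool_seq -size_filter (_ : 2%N = size [:: w; s w])//; apply: perm_size.
  apply: uniq_perm; first exact: filter_uniq.
    by rewrite /= inE eq_sym sw.
  move=> w'; rewrite mem_filter !inE; apply/andP/orP => [[/eqP fw w'W]|].
    by have [->|->] := fW _ _ wW w'W fw; [left|right].
  by case=> /eqP ->; rewrite ?fsw eqxx.
transitivity (\sum_(y <- undup (map f W)) \sum_(w <- W) (f w == y))%N.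
  rewrite exchange_big /= -sum1_size [LHS]big_seq [RHS]big_seq.
  apply: eq_bigr => w wW.
  rewrite (sum_bool_seq _ (fun y => f w == y)) (eq_count (eq_sym _)).
  by rewrite count_uniq_mem ?undup_uniq// mem_undup map_f.
rewrite big_seq (eq_bigr (fun=> 2 * 1)%N) => [|y]; last first.
  by rewrite mem_undup => /mapP[w wW ->]; exact: fib.
by rewrite -big_seq -big_distrr /= sum1_size mul2n.
Qed.

Definition cycle_edges (T : choiceType) (s : seq T) : {fset {fset T}} :=
  [fset [fset x; next s x]%fset | x in s]%fset.

Lemma cycle_edges_rot (T : choiceType) n (s : seq T) : uniq s ->
  cycle_edges (rot n s) = cycle_edges s.
Proof.
move=> us; apply/fsetP => E; apply/imfsetP/imfsetP => -[x /= xs ->].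
  by exists x; rewrite ?next_rot//= -(mem_rot n).
by exists x; rewrite ?next_rot//= mem_rot.
Qed.

Lemma cycle_edges_mem (T : choiceType) (s : seq T) x :
  (exists2 E, E \in cycle_edges s & x \in E) <-> x \in s.
Proof.
split=> [[E /imfsetP[y /= ys ->]]|xs].
  by rewrite !inE => /orP[] /eqP -> //; rewrite mem_next.
exists [fset x; next s x]%fset; last by rewrite !inE eqxx.
by apply/imfsetP; exists x.
Qed.

(** A cycle through [o] can be rotated to start at [o] without changing its edges; only the two
    directions of traversal remain to be identified. *)
Lemma is_cycle_at (T : choiceType) (e : rel T) k o C :
  (is_cycle e k C /\ exists2 E, E \in C & o \in E) <->
  exists s, [/\ 2 < k, size (o :: s) = k, uniq (o :: s), path.cycle e (o :: s)
    & C = cycle_edges (o :: s)].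
Proof.
split=> [[[s [k2 sk us cs CE]] oC]|[s [k2 sk us cs CE]]].
  have os : o \in s by apply/cycle_edges_mem; rewrite /cycle_edges -CE.
  have [i s' sE] := rot_to os; exists s'; rewrite -sE.
  by rewrite size_rot rot_uniq rot_cycle cycle_edges_rot.
split; first by exists (o :: s).
by rewrite CE; apply/cycle_edges_mem; rewrite inE eqxx.
Qed.

Lemma cycle_edges3 (T : choiceType) (o a b : T) E : uniq [:: o; a; b] ->
  E \in cycle_edges [:: o; a; b] <->
  [\/ E = [fset o; a]%fset, E = [fset a; b]%fset | E = [fset b; o]%fset].
Proof.
rewrite /= !inE !negb_or andbT => /andP[/andP[oa ob] ab].
have n1 : next [:: o; a; b] o = a by rewrite /= eqxx.
have n2 : next [:: o; a; b] a = b by rewrite /= eq_sym (negbTE oa) eqxx.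
have n3 : next [:: o; a; b] b = o.
  by rewrite /= eq_sym (negbTE ob) eq_sym (negbTE ab) eqxx.
split=> [/imfsetP[x xs ->]|].
  have {xs} : x \in [:: o; a; b] := xs.
  rewrite !inE => /or3P[] /eqP ->.
  - by rewrite n1; constructor 1.
  - by rewrite n2; constructor 2.
  - by rewrite n3; constructor 3.
case=> ->; apply/imfsetP.
- by exists o; rewrite ?n1//; rewrite /= !inE eqxx ?orbT.
- by exists a; rewrite ?n2//; rewrite /= !inE eqxx ?orbT.
- by exists b; rewrite ?n3//; rewrite /= !inE eqxx ?orbT.
Qed.

Lemma cycle_edges4 (T : choiceType) (o a b c : T) E : uniq [:: o; a; b; c] ->
  E \in cycle_edges [:: o; a; b; c] <->
  [\/ E = [fset o; a]%fset, E = [fset a; b]%fset, E = [fset b; c]%fset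
    | E = [fset c; o]%fset].
Proof.
rewrite /= !inE !negb_or andbT => /and3P[/and3P[oa ob oc] /andP[ab ac] bc].
have n1 : next [:: o; a; b; c] o = a by rewrite /= eqxx.
have n2 : next [:: o; a; b; c] a = b by rewrite /= eq_sym (negbTE oa) eqxx.
have n3 : next [:: o; a; b; c] b = c.
  by rewrite /= eq_sym (negbTE ob) eq_sym (negbTE ab) eqxx.
have n4 : next [:: o; a; b; c] c = o.
  by rewrite /= eq_sym (negbTE oc) eq_sym (negbTE ac) eq_sym (negbTE bc) eqxx.
split=> [/imfsetP[x xs ->]|].
  have {xs} : x \in [:: o; a; b; c] := xs.
  rewrite !inE => /or4P[] /eqP ->.
  - by rewrite n1; constructor 1.
  - by rewrite n2; constructor 2.
  - by rewrite n3; constructor 3.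
  - by rewrite n4; constructor 4.
case=> ->; apply/imfsetP.
- by exists o; rewrite ?n1//; rewrite /= !inE eqxx ?orbT.
- by exists a; rewrite ?n2//; rewrite /= !inE eqxx ?orbT.
- by exists b; rewrite ?n3//; rewrite /= !inE eqxx ?orbT.
- by exists c; rewrite ?n4//; rewrite /= !inE eqxx ?orbT.
Qed.

Lemma card_fset_set_seq (Y : choiceType) (A : set Y) (s : seq Y) :
  (forall y, A y <-> y \in s) -> #|` fset_set A| = size (undup s).
Proof.
move=> As; rewrite (_ : A = [set` [fset x in s]%fset]).
  by rewrite set_fsetK card_fseq.
by apply/seteqP; split=> y /=; rewrite inE /=; apply As.
Qed.

Section counts.
Context (T : choiceType) (N : T -> {fset T}).

Definition triangle_walks o : nat :=
  \sum_(a <- N o) \sum_(b <- N o) (b \in N a).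

(** [a] and [c] are the neighbours of [o] on the square and [b] is the vertex opposite to [o];
    chords are allowed. *)
Definition square_walks o : nat :=
  \sum_(a <- N o) \sum_(c <- N o) \sum_(b <- N a)
    [&& a != c, b != o & b \in N c].

Context (e : rel T).
Hypotheses (e_sym : symmetric e) (e_irr : irreflexive e).
Hypothesis NE : forall x y, (y \in N x) = e x y.

Lemma num_cycles_at3 o : triangle_walks o = (num_cycles_at e 3 o).*2.
Proof.
pose W := [seq (a, b) | a <- N o, b <- [seq b <- N o | b \in N a]].
have WP a b : (a, b) \in W = [&& e o a, e o b & e a b].
  rewrite -!NE; apply/allpairsPdep/and3P => [[a' [b' [a'o]]]|[ao bo ba]].
    by rewrite mem_filter => /andP[ba bo] [-> ->].
  by exists a, b; rewrite mem_filter ba.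
have Wu a b : (a, b) \in W -> uniq [:: o; a; b].
  rewrite WP => /and3P[oa ob ab]; rewrite /= !inE !negb_or !andbT.
  have ne x y : e x y -> x != y by apply: contraTneq => ->; rewrite e_irr.
  by rewrite !ne.
pose f (w : T * T) := cycle_edges [:: o; w.1; w.2].
have -> : triangle_walks o = size W.
  rewrite size_allpairs_dep sumnE big_map; apply: eq_bigr => a _.
  by rewrite size_filter sum_bool_seq.
rewrite (@size_two_to_one _ _ W f (fun w => (w.2, w.1))).
- congr _.*2; apply/esym/card_fset_set_seq => C.
  split=> [/is_cycle_at[s [_]]|/mapP[[a b] abW ->]].
    case: s => [|a [|b [|c s]]]//= _ us.
    rewrite andbT => /and3P[oa ab bo] ->.
    by apply/mapP; exists (a, b) => //; rewrite WP oa ab e_sym bo.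
  apply/is_cycle_at; exists [:: a; b]; split=> //; first exact: Wu.
  by move: abW; rewrite WP /= (e_sym b) andbT => /and3P[-> -> ->].
- apply: allpairs_uniq_dep => // [a _|]; first exact: filter_uniq.
  by move=> [a b] [a' b'] _ _ /= [-> ->].
- move=> [a b] abW; have u := Wu _ _ abW.
  have baW : (b, a) \in W.
    by move: abW; rewrite !WP (e_sym a) => /and3P[-> -> ->].
  have u' := Wu _ _ baW; split=> //=.
  + move: u; rewrite /= !inE => /andP[_ /andP[ab _]].
    by apply: contraNneq ab => -[->].
  + apply/fsetP => E; apply/idP/idP => /cycle_edges3 H; apply/cycle_edges3 => //;
      case: (H _) => // ->; [constructor 3|constructor 2|constructor 1
       |constructor 3|constructor 2|constructor 1]; exact: fsetUC.
- move=> [a b] [a' b'] /Wu u /Wu u' ff.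
  have H x : [fset o; x]%fset \in f (a, b) -> x = a \/ x = b.
    move=> /cycle_edges3 -/(_ u).
    move: u; rewrite /= !inE !negb_or !andbT => /andP[/andP[/eqP oa /eqP ob] _].
    by case=> /fset2_eqP[[]|[]]; auto; congruence.
  have Ha : a' = a \/ a' = b.
    by apply: H; rewrite -ff; apply/cycle_edges3 => //; constructor 1.
  have Hb : b' = a \/ b' = b.
    apply: H; rewrite -ff; apply/cycle_edges3 => //; constructor 3.
    exact: fsetUC.
  have ab' : a' != b' by move: u'; rewrite /= !inE andbT => /andP[].
  by case: Ha Hb => -> [] -> in ab' *; rewrite ?eqxx// in ab'; auto.
Qed.

(** The edges at [o] determine the pair [{a, c}], and the other edge at [a] then determines [b], so
    walks with the same edges differ at most by their direction. *)
Lemma num_cycles_at4 o : square_walks o = (num_cycles_at e 4 o).*2.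
Proof.
pose W := [seq (a, cb) | a <- N o, cb <-
  [seq (c, b) | c <- [seq c <- N o | a != c],
                b <- [seq b <- N a | (b != o) && (b \in N c)]]].
have WP a b c : (a, (c, b)) \in W =
    [&& e o a, e o c, e a b, e c b & (a != c) && (b != o)].
  rewrite -!NE; apply/allpairsPdep/and5P => [[a' [cb' [a'o]]]|[ao co ba bc /andP[ac bo]]].
    move=> /allpairsPdep[c' [b' []]]; rewrite !mem_filter.
    by move=> /andP[ac co] /andP[/andP[bo bc] ba] -> [-> -> ->]; rewrite ac bo.
  exists a, (c, b); split=> //; apply/allpairsPdep; exists c, b.
  by rewrite !mem_filter bo bc ba ac co.
have Wu a b c : (a, (c, b)) \in W -> uniq [:: o; a; b; c].
  rewrite WP => /and5P[oa oc ab cb /andP[ac bo]].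
  have ne x y : e x y -> x != y by apply: contraTneq => ->; rewrite e_irr.
  by rewrite /= !inE !negb_or !andbT (ne _ _ oa) (ne _ _ oc) (ne _ _ ab) ac
    eq_sym bo eq_sym (ne _ _ cb).
pose f (w : T * (T * T)) := cycle_edges [:: o; w.1; w.2.2; w.2.1].
have -> : square_walks o = size W.
  rewrite size_allpairs_dep sumnE big_map; apply: eq_bigr => a _.
  rewrite size_allpairs_dep sumnE big_map big_filter [RHS]big_mkcond /=.
  apply: eq_bigr => c _; case: eqP => /= ac; last by rewrite size_filter sum_bool_seq.
  by rewrite big1.
rewrite (@size_two_to_one _ _ W f (fun w => (w.2.1, (w.1, w.2.2)))).
- congr _.*2; apply/esym/card_fset_set_seq => C.
  split=> [/is_cycle_at[s [_]]|/mapP[[a [c b]] abW ->]].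
    case: s => [|a [|b [|c [|d s]]]]//= _ us.
    rewrite andbT => /and4P[oa ab bc co] ->.
    apply/mapP; exists (a, (c, b)) => //; rewrite WP oa ab (e_sym o) co (e_sym c) bc.
    move: us; rewrite /= !inE !negb_or => /and3P[/and3P[_ ob _] /andP[_ ->] _].
    by rewrite eq_sym ob.
  apply/is_cycle_at; exists [:: a; b; c]; split=> //; first exact: Wu.
  move: abW; rewrite WP /= (e_sym c b) andbT.
  by rewrite (e_sym c) => /and5P[-> -> -> -> _].
- apply: allpairs_uniq_dep => // [a _|]; last first.
    by move=> [a cb] [a' cb'] _ _ /= [-> ->].
  apply: allpairs_uniq_dep => // [|c _|]; try exact: filter_uniq.
  by move=> [c b] [c' b'] _ _ /= [-> ->].
- move=> [a [c b]] abW; have u := Wu _ _ _ abW.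
  have caW : (c, (a, b)) \in W.
    by move: abW; rewrite !WP (eq_sym a) => /and5P[-> -> -> -> /andP[-> ->]].
  have u' := Wu _ _ _ caW; split=> //=.
  + move: u; rewrite /= !inE => /and3P[_ /norP[_ ac] _].
    by apply: contraNneq ac => -[->].
  + apply/fsetP => E; apply/idP/idP => /cycle_edges4 H; apply/cycle_edges4 => //;
      case: (H _) => // ->; [constructor 4|constructor 3|constructor 2|constructor 1
       |constructor 4|constructor 3|constructor 2|constructor 1]; exact: fsetUC.
- move=> [a [c b]] [a' [c' b']] /Wu u /Wu u' ff.
  have H x : [fset o; x]%fset \in f (a, (c, b)) -> x = a \/ x = c.
    move=> /cycle_edges4 -/(_ u).
    move: u; rewrite /= !inE !negb_or !andbT.
    move=> /and3P[/and3P[/eqP oa /eqP ob /eqP oc] _ _].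
    by case=> /fset2_eqP[[]|[]]; auto; congruence.
  have Ha : a' = a \/ a' = c.
    by apply: H; rewrite -ff; apply/cycle_edges4 => //; constructor 1.
  have Hc : c' = a \/ c' = c.
    apply: H; rewrite -ff; apply/cycle_edges4 => //; constructor 4.
    exact: fsetUC.
  have Hb : b' = b.
    have : [fset a'; b']%fset \in f (a, (c, b)).
      by rewrite -ff; apply/cycle_edges4 => //; constructor 2.
    move=> /cycle_edges4 -/(_ u).
    move: u u'; rewrite /= !inE !negb_or !andbT.
    move=> /and3P[/and3P[/eqP oa /eqP ob /eqP oc] /andP[/eqP ab /eqP ac] /eqP bc].
    move=> /and3P[/and3P[_ /eqP ob' _] _ _].
    by case: Ha => ->; case=> /fset2_eqP[[]|[]]; auto; congruence.
  have ac' : a' != c'.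
    by move: u'; rewrite /= !inE !negb_or !andbT => /and3P[_ /andP[_ ->]].
  by rewrite Hb; case: Ha Hc => -> [] -> in ac' *; rewrite ?eqxx// in ac'; auto.
Qed.

End counts.

(** Double count of the pairs of a [k]-cycle and a vertex on it. *)
Lemma num_cyclesE (T : finType) (e : rel T) k :
  k * num_cycles e k = \sum_o num_cycles_at e k o.
Proof.
have finC : finite_set [set C | is_cycle e k C].
  apply: (@sub_finite_set _ _ [set cycle_edges (val t) | t in [set: k.-tuple T]]).
    move=> C [s [_ sk _ _ ->]]; move/eqP: sk => sk.
    by exists (Tuple sk).
  exact/finite_image/finite_finset.
rewrite /num_cycles; set CC := fset_set _.
have -> : \sum_o num_cycles_at e k o =
    \sum_o \sum_(C <- CC) has (fun E : {fset T} => o \in E) C.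
  apply: eq_bigr => o _; rewrite sum_bool_seq -size_filter.
  rewrite [LHS](@card_fset_set_seq _ _
    [seq C : {fset {fset T}} <- CC | has (fun E : {fset T} => o \in E) C]) ?undup_id//.
    by rewrite filter_uniq// fset_uniq.
  move=> C; rewrite mem_filter in_fset_set//; split.
    move=> [Ccyc [E EC oE]]; apply/andP; split; last by rewrite inE.
    by apply/hasP; exists E.
  by move=> /andP[/hasP[E EC oE]]; rewrite inE; split=> //; exists E.
rewrite exchange_big /= -sum1_size big_distrr /= big_seq [RHS]big_seq.
apply: eq_bigr => C; rewrite in_fset_set// inE muln1 => -[s [k2 <- us cs CE]].
have hasE o : has (fun E : {fset T} => o \in E) C = (o \in s).
  apply/hasP/idP => [[E EC oE]|]; last first.
    by move=> /cycle_edges_mem[E]; rewrite /cycle_edges -CE; exists E.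
  by apply/cycle_edges_mem; exists E => //; rewrite /cycle_edges -CE.
under eq_bigr => o _ do rewrite hasE.
rewrite -(card_uniqP us) -sum1_card [LHS]big_mkcond /=.
by apply: eq_bigr => o _; case: ifP.
Qed.

Lemma sum_neq (T : choiceType) (X : {fset T}) b : b \in X ->
  \sum_(y <- X) (y != b) = #|` X|.-1.
Proof.
move=> bX; rewrite sum_bool_seq -[#|` _|]/(size X).
by rewrite -(count_predC (pred1 b)) count_uniq_mem ?fset_uniq// bX.
Qed.

(** * Paths, triangles and diamonds around a vertex *)

Section walks.
Context (T : choiceType) (N : T -> {fset T}).

Definition cherry_walks o : nat :=
  \sum_(a <- N o) \sum_(c <- N o) \sum_(b <- N o)
    [&& a != b, c \in N a & b \in N c].

Definition clique_walks o : nat :=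
  \sum_(a <- N o) \sum_(c <- N o) \sum_(b <- N o)
    [&& c \in N a, b \in N c & b \in N a].

(* The vertices o, a, b, c induce a diamond; its non-edge is ob in diamonds_out
   and ab in diamonds_in. *)
Definition diamonds o a : nat :=
  \sum_(c <- N o) \sum_(b <- N a) [&& c \in N a, b \in N c, b \notin N o & b != o].

Definition diamonds_out o : nat := \sum_(a <- N o) diamonds o a.
Definition diamonds_in o : nat := \sum_(a <- N o) diamonds a o.

Lemma sum_fset_exchange (X Y : {fset T}) (P : pred T) :
  \sum_(b <- X) ((b \in Y) && P b) = \sum_(b <- Y) ((b \in X) && P b).
Proof.
rewrite !sum_bool_seq -!size_filter; apply: perm_size; apply: uniq_perm.
- exact/filter_uniq/fset_uniq.
- exact/filter_uniq/fset_uniq.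
- by move=> b; rewrite !mem_filter; case: (b \in X); case: (b \in Y); case: (P b).
Qed.

Hypothesis Nsym : forall x y, (y \in N x) = (x \in N y).
Hypothesis Nirr : forall x, x \notin N x.

(** In [diamonds_in] the root is an end of the chord, so the other three vertices form a path of the
    link with non-adjacent ends; the remaining paths of two edges close up to triangles of the
    link. *)
Lemma diamonds_inE o : diamonds_in o + clique_walks o = cherry_walks o.
Proof.
rewrite -big_split big_seq [RHS]big_seq; apply: eq_bigr => a ao /=.
rewrite /diamonds.
have -> : \sum_(c <- N a) \sum_(b <- N o)
      [&& c \in N o, b \in N c, b \notin N a & b != a] =
    \sum_(c <- N o) \sum_(b <- N o)
      [&& c \in N a, b \in N c, b \notin N a & b != a].
  rewrite exchange_big /= [RHS]exchange_big /=; apply: eq_bigr => b _.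
  exact: sum_fset_exchange.
rewrite -big_split; apply: eq_bigr => c _; rewrite -big_split.
apply: eq_bigr => b _ /=; rewrite (eq_sym a).
have [->|_] := eqVneq b a; first by rewrite (negbTE (Nirr a)) !andbF.
by case: (c \in N a); case: (b \in N c); case: (b \in N a).
Qed.

(** Sort the squares [o a b c] by their chords: a path [a b c] of the link gives one with chord
    [ob], a diamond gives one with chord [ac] and without [ob]. Hence the two families are
    disjoint. *)
Lemma square_walks_ge o :
  cherry_walks o + diamonds_out o <= square_walks N o.
Proof.
rewrite -big_split; apply: leq_sum => a _ /=.
(* The centre and the last vertex of the path exchange names, so that the centre becomes the vertex
   opposite to [o]. *)
have -> : \sum_(c <- N o) \sum_(b <- N o) [&& a != b, c \in N a & b \in N c] =
    \sum_(c <- N o) \sum_(b <- N a) [&& b \in N o, a != c & b \in N c].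
  rewrite exchange_big /=; apply: eq_bigr => c _; rewrite sum_fset_exchange.
  apply: eq_bigr => b _; rewrite [c \in N b]Nsym [LHS]/=.
  by case: (b \in N o); rewrite ?andbF ?andbT//= andbCA.
rewrite -big_split; apply: leq_sum => c co; rewrite -big_split.
apply: leq_sum => b _ /=.
have [bc|] := boolP (b \in N c); last by rewrite !andbF.
have [->|ac] := eqVneq a c; first by rewrite (negbTE (Nirr _)) !andbF.
have [->|bo] := eqVneq b o; first by rewrite (negbTE (Nirr _)) !andbF.
by case: (b \in N o); case: (c \in N a).
Qed.

(** The right side counts the walks [o a b c] without backtracking. Those with [c] adjacent to [o]
    are the squares, those with [c = o] the triangles. [A] will be the vertex set of a graph on
    natural numbers: numbers outside it have no neighbours, so the degree is [r] on [A] only. *)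
Lemma square_walks_le (A : T -> Prop) r o : A o ->
  (forall x y, A x -> y \in N x -> A y) -> (forall x, A x -> #|` N x| = r) ->
  square_walks N o + triangle_walks N o <= r * r.-1 ^ 2.
Proof.
move=> Ao AN Nr.
have sum_ne x (b : T) : A x -> b \in N x -> \sum_(y <- N x) (y != b) = r.-1.
  by move=> Ax bx; rewrite sum_neq// Nr.
have -> : r * r.-1 ^ 2 =
    \sum_(a <- N o) \sum_(b <- N a) (b != o) * \sum_(c <- N b) (c != a).
  rewrite -{1}(Nr o Ao) -sum1_size big_distrl /= big_seq [RHS]big_seq.
  apply: eq_bigr => a ao; rewrite mul1n; have Aa := AN _ _ Ao ao.
  rewrite big_seq (eq_bigr (fun b => (b != o) * r.-1)); last first.
    by move=> b ba; rewrite (sum_ne _ _ (AN _ _ Aa ba))// Nsym.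
  by rewrite -big_seq -big_distrl /= (sum_ne _ _ Aa) ?mulnn// Nsym.
rewrite -big_split /= big_seq [leqRHS]big_seq; apply: leq_sum => a ao.
have -> : \sum_(b <- N o) (b \in N a) = \sum_(b <- N a) (b \in N o).
  have := sum_fset_exchange (N o) (N a) xpredT.
  by under eq_bigr do rewrite andbT; under [in RHS]eq_bigr do rewrite andbT.
rewrite exchange_big -big_split /= big_seq [leqRHS]big_seq.
apply: leq_sum => b ba.
have [->|bo] := eqVneq b o.
  by rewrite (negbTE (Nirr _)) big1// => c _; rewrite andbF.
rewrite mul1n; under eq_bigr => c _ do rewrite Nsym (andbC (a != c)).
rewrite /= (sum_fset_exchange (N o) (N b) (fun c => a != c)).
apply: (@leq_trans (\sum_(c <- N b) ((c \in N o) && (a != c) + (c == o)))).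
  rewrite big_split leq_add2l /= sum_bool_seq count_uniq_mem ?fset_uniq//.
  by rewrite Nsym.
apply: leq_sum => c _; have [->|_] := eqVneq c o.
  by case: (eqVneq o a) ao => [<-|_ _]; rewrite (negbTE (Nirr _)).
by rewrite addn0 eq_sym; case: (c \in N o).
Qed.

End walks.

(** * Transport of local counts along partial isomorphisms *)

Section transfer.
Context (T T' : choiceType) (N : T -> {fset T}) (N' : T' -> {fset T'}).
Context (f : T -> T') (A : T -> Prop).
Hypothesis f_inj : forall x y, A x -> A y -> f x = f y -> x = y.
Hypothesis f_adj : forall x y, A x -> A y -> (f y \in N' (f x)) = (y \in N x).

(** [f] is an isomorphism on [A] only, for instance on a ball; at [x] it must carry the whole
    neighbourhood, which in a ball is guaranteed only away from the boundary. *)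
Definition nbhs_iso x :=
  [/\ A x, forall y, y \in N x -> A y & N' (f x) = (f @` N x)%fset].

Let f_eq x y : A x -> A y -> (f x == f y) = (x == y).
Proof.
by move=> Ax Ay; apply/eqP/eqP => [|-> //]; exact: f_inj.
Qed.

Let sum_nbhs x (G : T' -> nat) : nbhs_iso x ->
  \sum_(y <- N' (f x)) G y = \sum_(y <- N x) G (f y).
Proof.
move=> [_ NA ->]; rewrite big_imfset//= => y z yx zx.
by apply: f_inj; exact: NA.
Qed.

Lemma card_nbhs_iso x : nbhs_iso x -> #|` N' (f x)| = #|` N x|.
Proof.
move=> [_ NA ->]; rewrite card_in_imfset// => y z yx zx.
by apply: f_inj; exact: NA.
Qed.

Lemma triangle_walks_iso o : nbhs_iso o ->
  triangle_walks N' (f o) = triangle_walks N o.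
Proof.
move=> ho; have [_ NA _] := ho.
rewrite /triangle_walks sum_nbhs// big_seq [RHS]big_seq.
apply: eq_bigr => a ao; rewrite sum_nbhs// big_seq [RHS]big_seq.
by apply: eq_bigr => b bo; rewrite f_adj//; exact: NA.
Qed.

Lemma square_walks_iso o : nbhs_iso o -> (forall a, a \in N o -> nbhs_iso a) ->
  square_walks N' (f o) = square_walks N o.
Proof.
move=> ho hN; have [Ao NA _] := ho.
rewrite /square_walks sum_nbhs// big_seq [RHS]big_seq.
apply: eq_bigr => a ao; rewrite sum_nbhs// big_seq [RHS]big_seq.
apply: eq_bigr => c co; rewrite sum_nbhs; last exact: hN.
have [Aa NaA _] := hN _ ao; rewrite big_seq [RHS]big_seq.
by apply: eq_bigr => b /NaA Ab; rewrite f_adj ?f_eq//; exact: NA.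
Qed.

Lemma cherry_walks_iso o : nbhs_iso o -> cherry_walks N' (f o) = cherry_walks N o.
Proof.
move=> ho; have [_ NA _] := ho.
rewrite /cherry_walks sum_nbhs// big_seq [RHS]big_seq.
apply: eq_bigr => a /NA Aa; rewrite sum_nbhs// big_seq [RHS]big_seq.
apply: eq_bigr => c /NA Ac; rewrite sum_nbhs// big_seq [RHS]big_seq.
by apply: eq_bigr => b /NA Ab; rewrite !f_adj ?f_eq.
Qed.

Lemma clique_walks_iso o : nbhs_iso o -> clique_walks N' (f o) = clique_walks N o.
Proof.
move=> ho; have [_ NA _] := ho.
rewrite /clique_walks sum_nbhs// big_seq [RHS]big_seq.
apply: eq_bigr => a /NA Aa; rewrite sum_nbhs// big_seq [RHS]big_seq.
apply: eq_bigr => c /NA Ac; rewrite sum_nbhs// big_seq [RHS]big_seq.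
by apply: eq_bigr => b /NA Ab; rewrite !f_adj.
Qed.

Lemma diamonds_iso o a : nbhs_iso o -> nbhs_iso a ->
  diamonds N' (f o) (f a) = diamonds N o a.
Proof.
move=> ho ha; have [Ao NA _] := ho; have [Aa NaA _] := ha.
rewrite /diamonds sum_nbhs// big_seq [RHS]big_seq.
apply: eq_bigr => c /NA Ac; rewrite sum_nbhs// big_seq [RHS]big_seq.
by apply: eq_bigr => b /NaA Ab; rewrite !f_adj ?f_eq.
Qed.

Lemma sum_diamonds_iso (F : nat -> nat) o :
  nbhs_iso o -> (forall a, a \in N o -> nbhs_iso a) ->
  \sum_(a <- N' (f o)) F (diamonds N' (f o) a) = \sum_(a <- N o) F (diamonds N o a) /\
  \sum_(a <- N' (f o)) F (diamonds N' a (f o)) = \sum_(a <- N o) F (diamonds N a o).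
Proof.
move=> ho hN; split; rewrite sum_nbhs// big_seq [RHS]big_seq;
  by apply: eq_bigr => a /hN ha; rewrite diamonds_iso.
Qed.

End transfer.
End local_counts.

(** * Inclusion-exclusion in the complement of the link *)

Section link.
Context (R : realFieldType) (T : choiceType) (N : T -> {fset T}).
Hypothesis Nsym : forall x y, (y \in N x) = (x \in N y).
Hypothesis Nirr : forall x, x \notin N x.

Definition nonadjacent (x y : T) := (x != y) && (y \notin N x).

(** Adjacency in the complement is [d - e]. The product of three such factors has eight terms, which
    [e = e * d] and permutations of the variables reduce to four sums. *)
Lemma nonadjacent_weights r o : #|` N o| = r ->
  let F : rel (N o) := fun x y => nonadjacent (val x) (val y) in
  edge_weight F (fun=> 1%N%:R) =
    r%:R * (r%:R - 1) - (triangle_walks N o)%:R :> R /\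
  triangle_weight F (fun=> 1%N%:R) =
    r%:R * (r%:R - 1) * (r%:R - 2%:R)
    - 3%:R * (r%:R - 2%:R) * (triangle_walks N o)%:R
    + 3%:R * (cherry_walks N o)%:R - (clique_walks N o)%:R :> R.
Proof.
move=> Nr F; pose X : finType := N o.
have rX : \sum_(x : X) (1 : R) = r%:R.
  by rewrite sumr_const -Nr cardfE.
pose e (x y : X) : R := (val y \in N (val x))%:R.
pose d (x y : X) : R := (x != y)%:R.
have sum_d x : \sum_y d x y = r%:R - 1.
  rewrite -rX (bigD1 x)//= [in RHS](bigD1 x)//= /d eqxx add0r [1 + _]addrC addrK.
  by apply: eq_bigr => y; rewrite eq_sym => ->.
have sum_dd x y : x != y -> \sum_z d x z * d y z = r%:R - 2%:R.
  move=> xy; rewrite (bigD1 x)//= {1}/d eqxx mul0r add0r.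
  have := sum_d y; rewrite (bigD1 x)//= /d eq_sym xy /= => H.
  rewrite (eq_bigr (fun z => (y != z)%:R)); last first.
    by move=> z; rewrite eq_sym => ->; rewrite mul1r.
  lra.
have e_ne x y : e x y = e x y * d x y.
  rewrite /e /d; have [<-|_] := eqVneq x y; last by rewrite mulr1.
  by rewrite (negbTE (Nirr _)) mul0r.
have d_sym x y : d x y = d y x by rewrite /d eq_sym.
have e_sym x y : e x y = e y x by rewrite /e Nsym.
have FE x y : (F x y)%:R = d x y - e x y.
  rewrite /F /nonadjacent /d /e -(inj_eq val_inj).
  have [->|_] := eqVneq; first by rewrite (negbTE (Nirr _)) subrr.
  by case: (_ \in _); rewrite /= ?subrr ?subr0.
have S3E : \sum_x \sum_y e x y = (triangle_walks N o)%:R.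
  rewrite /triangle_walks natr_sum [RHS]big_seq_fsetE /=; apply: eq_bigr => x _.
  by rewrite natr_sum [RHS]big_seq_fsetE.
pose S (f : X -> X -> X -> R) := \sum_x \sum_y \sum_z f x y z.
have S12 f : S (fun x y z => f y x z) = S f by rewrite /S exchange_big.
have S23 f : S (fun x y z => f x z y) = S f.
  by apply: eq_bigr => x _; rewrite exchange_big.
have ChE : S (fun x y z => e x y * e y z * d x z) = (cherry_walks N o)%:R.
  rewrite /cherry_walks natr_sum [RHS]big_seq_fsetE /=; apply: eq_bigr => x _.
  rewrite natr_sum [RHS]big_seq_fsetE; apply: eq_bigr => y _ /=.
  rewrite natr_sum [RHS]big_seq_fsetE; apply: eq_bigr => z _ /=.
  by rewrite -mulnb natrM -mulnb natrM mulrC /d (inj_eq val_inj).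
have TrE : S (fun x y z => e x y * e y z * e x z) = (clique_walks N o)%:R.
  rewrite /clique_walks natr_sum [RHS]big_seq_fsetE /=; apply: eq_bigr => x _.
  rewrite natr_sum [RHS]big_seq_fsetE; apply: eq_bigr => y _ /=.
  rewrite natr_sum [RHS]big_seq_fsetE; apply: eq_bigr => z _ /=.
  by rewrite -mulnb natrM -mulnb natrM mulrA.
have D3 : S (fun x y z => d x y * (d x z * d y z)) =
    r%:R * (r%:R - 1) * (r%:R - 2%:R).
  rewrite /S -{1}rX !mulr_suml; apply: eq_bigr => x _.
  rewrite mul1r -(sum_d x) mulr_suml; apply: eq_bigr => y _.
  rewrite -mulr_sumr; have [<-|xy] := eqVneq x y.
    by rewrite {1 4}/d eqxx !mul0r.
  by rewrite sum_dd.
have E1 : S (fun x y z => e x y * (d x z * d y z)) =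
    (r%:R - 2%:R) * (triangle_walks N o)%:R.
  rewrite -S3E mulr_sumr; apply: eq_bigr => x _.
  rewrite mulr_sumr; apply: eq_bigr => y _.
  rewrite -mulr_sumr; have [<-|xy] := eqVneq x y.
    by rewrite /e (negbTE (Nirr _)) mul0r mulr0.
  by rewrite sum_dd// mulrC.
split.
  transitivity (\sum_x (\sum_y d x y - \sum_y e x y)).
    apply: eq_bigr => x _; rewrite -sumrB; apply: eq_bigr => y _.
    by rewrite FE !mul1r.
  rewrite sumrB S3E; congr (_ - _).
  by rewrite -{1}rX mulr_suml; apply: eq_bigr => x _; rewrite mul1r sum_d.
transitivity (S (fun x y z =>
    d x y * (d x z * d y z)
    - (e x y * (d x z * d y z) + e y z * (d y x * d z x) + e x z * (d x y * d z y))
    + (e x y * e y z * d x z + e x z * e z y * d x y + e y x * e x z * d y z)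
    - e x y * e y z * e x z)).
  apply: eq_bigr => x _; apply: eq_bigr => y _; apply: eq_bigr => z _.
  rewrite -mulnb natrM -mulnb natrM !FE !mul1r.
  rewrite (d_sym y x) (d_sym z x) (d_sym z y) (e_sym z y) (e_sym y x).
  have := e_ne x y; have := e_ne y z; have := e_ne x z.
  move: (e x y) (e y z) (e x z) (d x y) (d y z) (d x z) => a b c a' b' c' -> -> ->.
  lra.
rewrite -D3 -(mulrA 3%:R) -E1 -ChE -TrE.
have SD f g : S (fun x y z => f x y z + g x y z) = S f + S g.
  rewrite /S -big_split; apply: eq_bigr => x _; rewrite -big_split.
  by apply: eq_bigr => y _; rewrite -big_split.
have SB f g : S (fun x y z => f x y z - g x y z) = S f - S g.
  rewrite /S -sumrB; apply: eq_bigr => x _; rewrite -sumrB.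
  by apply: eq_bigr => y _; rewrite -sumrB.
rewrite SB SD SB !SD.
rewrite (S23 (fun x y z => e x y * (d x z * d y z))).
rewrite (S23 (fun x y z => e x y * e y z * d x z)).
rewrite (S12 (fun x y z => e x y * e y z * d x z)).
rewrite (S12 (fun x y z => e x z * (d x y * d z y))).
rewrite (S23 (fun x y z => e x y * (d x z * d y z))).
lra.
Qed.

Lemma link_hull (Q : R -> R -> Prop) r o : convex2 Q -> (0 < r)%N ->
  (forall l, (0 < l <= r)%N ->
     Q (\sum_(1 <= i < l.+1) clique_x R (part_size r l i))
       (\sum_(1 <= i < l.+1) clique_y R (part_size r l i))) ->
  #|` N o| = r ->
  Q ((triangle_walks N o)%:R / 6%:R)
    ((3%:R * (cherry_walks N o)%:R - (clique_walks N o)%:R) / 16%:R).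
Proof.
move=> cQ r0 Qb Nr; pose F : rel (N o) := fun x y => nonadjacent (val x) (val y).
have Fsym : symmetric F by move=> x y; rewrite /F /nonadjacent eq_sym Nsym.
have Firr : irreflexive F by move=> x; rewrite /F /nonadjacent eqxx.
have := hull_weight Fsym Firr cQ r0 Qb (n := fun=> 1%N).
rewrite sum1_card -cardfE => /(_ Nr).
have [-> ->] := nonadjacent_weights Nr.
by congr Q; congr (_ / _); lra.
Qed.

End link.

Section neighbours.
Context (T : choiceType) (e : rel T).

Definition neighbours (x : T) : {fset T} := fset_set [set y | e x y].

Lemma in_neighbours x y : finite_set [set y | e x y] ->
  (y \in neighbours x) = e x y.
Proof. by move=> fin; rewrite in_fset_set//; apply/idP/idP; rewrite inE. Qed.

End neighbours.

(** * Finite graphs *)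

Section finite_graphs.
Local Open Scope nat_scope.

Section sums.
Context (T : finType) (e : rel T).
Hypotheses (e_sym : symmetric e) (e_irr : irreflexive e).

Lemma in_neighboursT x y : (y \in neighbours e x) = e x y.
Proof. by rewrite in_neighbours//; exact: finite_finset. Qed.

Lemma sum_neighbours x (G : T -> nat) :
  \sum_(y <- neighbours e x) G y = \sum_y e x y * G y.
Proof.
transitivity (\sum_(y | e x y) G y).
  rewrite -[RHS]big_enum; apply: perm_big; apply: uniq_perm.
  - exact: fset_uniq.
  - exact: enum_uniq.
  - by move=> y; rewrite mem_enum in_neighboursT.
rewrite [LHS]big_mkcond; apply: eq_bigr => y _.
by case: ifP; rewrite ?mul1n ?mul0n.
Qed.

Lemma card_neighbours x : #|` neighbours e x| = #|e x|.
Proof.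
rewrite -[LHS]/(size (neighbours e x)) -sum1_size sum_neighbours -sum1_card.
rewrite [RHS]big_mkcond; apply: eq_bigr => y _; rewrite muln1 unfold_in /=.
by case: (e x y).
Qed.

Lemma triangle_walksE o : triangle_walks (neighbours e) o =
  \sum_a \sum_b [&& e o a, e o b & e a b].
Proof.
rewrite /triangle_walks sum_neighbours; apply: eq_bigr => a _.
rewrite sum_neighbours big_distrr; apply: eq_bigr => b _ /=.
by rewrite in_neighboursT !mulnb.
Qed.

Lemma square_walksE o : square_walks (neighbours e) o =
  \sum_a \sum_c \sum_b
    [&& e o a, e o c, e a b & [&& a != c, b != o & e c b]].
Proof.
rewrite /square_walks sum_neighbours; apply: eq_bigr => a _.
rewrite sum_neighbours big_distrr; apply: eq_bigr => c _ /=.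
rewrite sum_neighbours !big_distrr; apply: eq_bigr => b _ /=.
by rewrite in_neighboursT !mulnb.
Qed.

Lemma num_cycles3E : 6 * num_cycles e 3 = \sum_o triangle_walks (neighbours e) o.
Proof.
rewrite -[6]/(2 * 3) -mulnA num_cyclesE big_distrr; apply: eq_bigr => o _ /=.
by rewrite mul2n (num_cycles_at3 e_sym e_irr in_neighboursT).
Qed.

Lemma num_cycles4E : 8 * num_cycles e 4 = \sum_o square_walks (neighbours e) o.
Proof.
rewrite -[8]/(2 * 4) -mulnA num_cyclesE big_distrr; apply: eq_bigr => o _ /=.
by rewrite mul2n (num_cycles_at4 e_sym e_irr in_neighboursT).
Qed.

End sums.

Section bipartite.
Context (r : nat).
Let T : finType := (bool * 'I_r)%type.

Definition bipartite_rel : rel T := fun x y => x.1 != y.1.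

Lemma card_bipartite_rel x : #|bipartite_rel x| = r.
Proof.
rewrite -[RHS]card_ord -(card_imset _ (f := fun j : 'I_r => (~~ x.1, j))).
  apply: eq_card => -[b j]; rewrite [LHS]unfold_in /bipartite_rel /=; apply/idP/imsetP.
    by move=> xb; exists j => //; case: (x.1) b xb => [] [].
  by case=> j' _ [-> _]; case: (x.1).
by move=> j j' [].
Qed.

Lemma bipartite_triangles o : triangle_walks (neighbours bipartite_rel) o = 0.
Proof.
rewrite triangle_walksE big1// => a _; rewrite big1// => b _.
by rewrite /bipartite_rel; case: (o.1) (a.1) (b.1) => [] [] [].
Qed.

Lemma bipartite_squares o :
  square_walks (neighbours bipartite_rel) o = r * r.-1 ^ 2.
Proof.
have Nr x : #|` neighbours bipartite_rel x| = r.
  by rewrite card_neighbours card_bipartite_rel.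
rewrite /square_walks.
transitivity (\sum_(a <- neighbours bipartite_rel o) r.-1 ^ 2).
  rewrite big_seq [RHS]big_seq; apply: eq_bigr => a; rewrite in_neighboursT => oa.
  transitivity (\sum_(c <- neighbours bipartite_rel o) (c != a) * r.-1).
    rewrite big_seq [RHS]big_seq; apply: eq_bigr => c; rewrite in_neighboursT => oc.
    rewrite eq_sym -{1}(Nr a) -(sum_neq (b := o)); last first.
      by rewrite in_neighboursT /bipartite_rel eq_sym.
    rewrite big_distrr big_seq [RHS]big_seq; apply: eq_bigr => b /=.
    rewrite !in_neighboursT mulnb => ab; suff -> : bipartite_rel c b by rewrite andbT.
    by move: oa oc ab; rewrite /bipartite_rel; case: (o.1) (a.1) (b.1) (c.1) => [] [] [] [].
  by rewrite -big_distrl /= sum_neq ?in_neighboursT// Nr mulnn.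
rewrite -[X in X * _](Nr o) -[X in X * _]/(size (neighbours _ o)) -sum1_size big_distrl.
by apply: eq_bigr => a _; rewrite /= mul1n.
Qed.

End bipartite.

(** * Graphs glued from cliques *)

Section cliques.
Context (T : finType) (U : eqType) (l : nat) (f : 'I_l -> T -> U) (n : 'I_l -> nat).

(** [f i x] names the clique of kind [i] through [x]. The hypotheses below on triangles and squares
    compare only the two edges that meet at [x]; the other corners are reached by rotating the
    cycle. *)
Definition clique_rel : rel T :=
  fun x y => (x != y) && [exists i, f i x == f i y].

Lemma clique_rel_sym : symmetric clique_rel.
Proof.
move=> x y; rewrite /clique_rel eq_sym; congr andb.
by apply: eq_existsb => i; rewrite eq_sym.
Qed.

Lemma clique_rel_irr : irreflexive clique_rel.
Proof. by move=> x; rewrite /clique_rel eqxx. Qed.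

Hypothesis fiber_card : forall i x, #|[pred y | f i y == f i x]| = n i.
Hypothesis edge_clique : forall x y i j, x != y ->
  f i x = f i y -> f j x = f j y -> i = j.
Hypothesis triangle_clique : forall x y z i j k, uniq [:: x; y; z] ->
  f i x = f i y -> f j y = f j z -> f k z = f k x -> i = k.
Hypothesis square_clique : forall x y z t i j k m, uniq [:: x; y; z; t] ->
  f i x = f i y -> f j y = f j z -> f k z = f k t -> f m t = f m x -> i = m.

Let sum_unique (I : finType) (P : pred I) :
  (forall i j, P i -> P j -> i = j) -> \sum_i P i = [exists i, P i] :> nat.
Proof.
move=> uP; case: existsP => [[i Pi]|nP]; last first.
  by rewrite big1// => i _; apply/eqP; rewrite eqb0; apply/negP => Pi; apply: nP; exists i.
rewrite (bigD1 i)//= Pi big1// => j ji; apply/eqP.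
by rewrite eqb0; apply: contraNN ji => Pj; apply/eqP; exact: uP.
Qed.

Let sum_fiber i o (s : seq T) : uniq s -> all (fun x => f i x == f i o) s ->
  \sum_x ((f i x == f i o) && (x \notin s)) = n i - size s.
Proof.
move=> us sf; rewrite -(fiber_card i o) -(card_uniqP us) -sum1_card.
rewrite -[in RHS]sum1_card [X in X - _](bigID (mem s)) /= addnC.
rewrite [X in _ + X - _](_ : _ = \sum_(x in s) 1) ?addnK; last first.
  apply: eq_bigl => x; rewrite !inE andb_idl// => xs.
  exact: (allP sf).
by rewrite [RHS]big_mkcond; apply: eq_bigr => x _; case: ifP.
Qed.

Lemma card_clique_rel o : #|clique_rel o| = \sum_i (n i - 1).
Proof.
transitivity (\sum_i \sum_x ((f i x == f i o) && (x \notin [:: o]))).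
  rewrite exchange_big -sum1_card [LHS]big_mkcond; apply: eq_bigr => x _ /=.
  rewrite (sum_unique (P := fun i => (f i x == f i o) && (x \notin [:: o]))).
    rewrite mem_seq1 unfold_in /clique_rel (eq_sym o x); have [->|xo] := eqVneq x o.
      by rewrite /= (_ : [exists i, _] = false)//; apply/existsP => -[i]; rewrite andbF.
    rewrite /= (_ : [exists i, f i o == f i x] = [exists i, (f i x == f i o) && true]).
      by case: [exists i, _].
    by apply: eq_existsb => i; rewrite andbT eq_sym.
  move=> i j /andP[/eqP fi xo] /andP[/eqP fj _]; apply: edge_clique fi fj.
  by rewrite mem_seq1 in xo.
by apply: eq_bigr => i _; rewrite sum_fiber//= eqxx.
Qed.

Lemma clique_triangles o : triangle_walks (neighbours clique_rel) o =
  \sum_i (n i - 1) * (n i - 2).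
Proof.
rewrite triangle_walksE.
pose P i (x : T) (s : seq T) := (f i x == f i o) && (x \notin s).
transitivity (\sum_i \sum_a \sum_b (P i a [:: o] && P i b [:: o; a])).
  rewrite [RHS]exchange_big /=; apply: eq_bigr => a _.
  rewrite [RHS]exchange_big /=; apply: eq_bigr => b _.
  rewrite sum_unique; last first.
    move=> i j; rewrite /P !inE => /andP[/andP[/eqP fi ao] _] /andP[/andP[/eqP fj _] _].
    exact: edge_clique ao fi fj.
  congr nat_of_bool; apply/idP/existsP.
    move=> /and3P[/andP[oa /existsP[i /eqP fi]] /andP[ob /existsP[j /eqP fj]]].
    move=> /andP[ab /existsP[k /eqP fk]]; exists i.
    have u : uniq [:: o; a; b] by rewrite /= !inE negb_or oa ob ab.
    (* Both edges at [o] have kind [i], so [a] and [b] lie in the clique of kind [i] through [o],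
       whatever the kind of [ab]. *)
    have ij := triangle_clique u fi fk (esym fj); rewrite -ij in fj.
    by rewrite /P -fi -fj !inE !eqxx negb_or (eq_sym a o) oa (eq_sym b o) ob eq_sym ab.
  move=> [i]; rewrite /P !inE negb_or.
  move=> /andP[/andP[/eqP fa ao] /andP[/eqP fb /andP[bo ba]]].
  rewrite /clique_rel (eq_sym o a) ao (eq_sym o b) bo (eq_sym a b) ba /=.
  by apply/and3P; split; apply/existsP; exists i; rewrite ?fa ?fb.
apply: eq_bigr => i _.
rewrite -(@sum_fiber i o [:: o]) ?/= ?eqxx//.
rewrite big_distrl; apply: eq_bigr => a _; rewrite -/(P i a [:: o]).
have [Pa|_] := boolP (P i a [:: o]); last by rewrite big1.
move: Pa => /andP[fa ao]; rewrite inE in ao.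
by rewrite /= mul1n -(@sum_fiber i o [:: o; a]) //= ?fa ?eqxx// inE eq_sym ao.
Qed.

Lemma clique_squares o : square_walks (neighbours clique_rel) o =
  \sum_i (n i - 1) * (n i - 2) * (n i - 3).
Proof.
rewrite square_walksE.
pose P i (x : T) (s : seq T) := (f i x == f i o) && (x \notin s).
transitivity (\sum_i \sum_a \sum_c \sum_b
    [&& P i a [:: o], P i c [:: o; a] & P i b [:: o; a; c]]).
  rewrite [RHS]exchange_big /=; apply: eq_bigr => a _.
  rewrite [RHS]exchange_big /=; apply: eq_bigr => c _.
  rewrite [RHS]exchange_big /=; apply: eq_bigr => b _.
  rewrite sum_unique; last first.
    move=> i j; rewrite /P !inE => /andP[/andP[/eqP fi ao] _] /andP[/andP[/eqP fj _] _].
    exact: edge_clique ao fi fj.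
  congr nat_of_bool; apply/idP/existsP.
    move=> /and4P[/andP[oa /existsP[i /eqP fi]] /andP[oc /existsP[j /eqP fj]]].
    move=> /andP[ab /existsP[k /eqP fk]].
    move=> /and3P[ac bo /andP[cb /existsP[m /eqP fm]]]; exists i.
    have u : uniq [:: o; a; b; c].
      by rewrite /= !inE !negb_or oa ac ab oc eq_sym bo eq_sym cb.
    have ij := square_clique u fi fk (esym fm) (esym fj); rewrite -ij in fj.
    (* The square rotated to start at [a] shows that [ab] has the same kind as [oa]. *)
    have ki : k = i.
      apply: square_clique (fk) (esym fm) (esym fj) (fi).
      by move: u; rewrite -(rot_uniq 1).
    rewrite ki in fk.
    by rewrite /P -fk -fi -fj !inE !eqxx !negb_or (eq_sym a o) oa (eq_sym c o) oc
      (eq_sym c a) ac bo (eq_sym b a) ab (eq_sym b c) cb.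
  move=> [i]; rewrite /P !inE !negb_or => /and3P[/andP[/eqP fa ao]].
  move=> /andP[/eqP fc /andP[co ca]] /andP[/eqP fb /and3P[bo ba bc]].
  rewrite /clique_rel (eq_sym o a) ao (eq_sym o c) co (eq_sym a b) ba.
  rewrite bo (eq_sym a c) ca (eq_sym c b) bc /=.
  by apply/and4P; split; apply/existsP; exists i; rewrite ?fa ?fb ?fc.
apply: eq_bigr => i _.
rewrite -mulnA -(@sum_fiber i o [:: o]) ?/= ?eqxx//.
rewrite big_distrl; apply: eq_bigr => a _; rewrite -/(P i a [:: o]).
have [Pa|_] := boolP (P i a [:: o]); last first.
  by rewrite big1// => c _; rewrite big1.
move: Pa => /andP[fa ao]; rewrite inE in ao.
rewrite /= mul1n -(@sum_fiber i o [:: o; a]) /= ?fa ?eqxx//; last first.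
  by rewrite inE eq_sym ao.
rewrite big_distrl; apply: eq_bigr => c _; rewrite -/(P i c [:: o; a]).
have [Pc|_] := boolP (P i c [:: o; a]); last by rewrite big1.
move: Pc => /andP[fc]; rewrite !inE negb_or => /andP[co ca].
rewrite /= mul1n -(@sum_fiber i o [:: o; a; c]) //= ?fa ?fc ?eqxx//.
by rewrite !inE negb_or eq_sym ao eq_sym co eq_sym ca.
Qed.

End cliques.

(* Lifting the points of a finite set, partitioned into cliques in l ways,
   along voltages in a power of Z/3: walking along a clique of the i-th kind
   from x = (b, v) to (b', v') adds delta_(b, i) - delta_(b', i) to v, so in a
   short cycle that changes its kind of clique at x the coordinate (b, i) of
   the voltages does not return to its initial value. *)
Lemma exists_clique_graph (l : nat) (n : 'I_l -> nat) : (forall i, 0 < n i) ->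
  exists (T : finType) (e : rel T), [/\ 0 < #|T|, symmetric e, irreflexive e,
    forall x, #|e x| = \sum_i (n i - 1) &
    forall o, triangle_walks (neighbours e) o = \sum_i (n i - 1) * (n i - 2) /\
      square_walks (neighbours e) o = \sum_i (n i - 1) * (n i - 2) * (n i - 3)].
Proof.
(* Every [n i] divides [M], so the base points split into full blocks of [n i] consecutive ones. *)
move=> n0; pose M := \prod_i n i.
have M0 : 0 < M by rewrite prodn_gt0.
(* Modulo 3, because around a square the tested coordinate gains 1 on leaving [x] and at most 1 more
   on leaving [z], and neither 1 nor 2 vanishes. *)
pose V := {ffun 'I_M * 'I_l -> 'Z_3}.
pose T : finType := ('I_M * V)%type.
pose delta b i : V := [ffun p => (p == (b, i))%:R%R].
(* A clique of kind [i] has one point over each base point of a block, namely the voltage that makes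
   the second component constant; so distinct points of a clique have distinct base points, which is
   [base]. *)
pose f i (x : T) := (x.1 %/ n i, (x.2 + delta x.1 i)%R).
have base x y i : x != y -> f i x = f i y -> (x.1 == y.1) = false.
  move=> xy [_ fxy]; apply: contraNF xy => /eqP xy1.
  by move: fxy; rewrite xy1 => /addIr xy2; apply/eqP; apply: injective_projections.
have fE i x y p : f i x = f i y ->
    (x.2 p + (p == (x.1, i))%:R)%R = (y.2 p + (p == (y.1, i))%:R)%R.
  by case=> _ /ffunP/(_ p); rewrite !ffunE.
have fiber i x : #|[pred y | f i y == f i x]| = n i.
  have [q qE] : exists q, M = q * n i.
    by apply/dvdnP; rewrite /M (bigD1 i)//= dvdn_mulr.
  have ltM (j : 'I_(n i)) : (x.1 %/ n i) * n i + j < M.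
    have : x.1 %/ n i < q by rewrite ltn_divLR// -qE.
    move=> xq; apply: (@leq_trans ((x.1 %/ n i).+1 * n i)).
      by rewrite mulSn addnC ltn_add2r.
    by rewrite [leqRHS]qE leq_mul2r xq orbT.
  pose g (j : 'I_(n i)) : T :=
    (Ordinal (ltM j), (x.2 + delta x.1 i - delta (Ordinal (ltM j)) i)%R).
  rewrite -[RHS]card_ord -(card_imset _ (f := g)); last first.
    by move=> j j' [/addnI jj' _]; exact: val_inj.
  apply: eq_card => y; rewrite !inE; apply/eqP/imsetP => [[fy1 fy2]|[j _ ->]].
    have yn : y.1 %% n i < n i by rewrite ltn_mod.
    have gy : Ordinal (ltM (Ordinal yn)) = y.1.
      by apply: val_inj; rewrite /= -fy1 -divn_eq.
    exists (Ordinal yn) => //; rewrite /g gy -fy2 addrK.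
    by case: (y).
  rewrite /f /g; congr pair; last exact: subrK.
  by rewrite /= divnMDl// (divn_small (ltn_ord j)) addn0.
have linear x y i j : x != y -> f i x = f i y -> f j x = f j y -> i = j.
  move=> xy fi fj; apply/eqP; apply: contraT => ij.
  have := fE i x y (x.1, i) fi; have := fE j x y (x.1, i) fj.
  rewrite !xpair_eqE !eqxx (negbTE ij) (base _ _ _ xy fi) /= !addr0 => ->.
  by move=> /eqP; rewrite -subr_eq0 addrAC subrr add0r.
have triangle x y z i j k : uniq [:: x; y; z] ->
    f i x = f i y -> f j y = f j z -> f k z = f k x -> i = k.
  rewrite /= !inE negb_or andbT => /andP[/andP[xy xz] yz] fi fj fk.
  apply/eqP; apply: contraT => ik; rewrite eq_sym in xz.
  have := fE i x y (x.1, i) fi; have := fE j y z (x.1, i) fj.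
  have := fE k z x (x.1, i) fk.
  rewrite !xpair_eqE !eqxx (negbTE ik) (base _ _ _ xy fi).
  rewrite [x.1 == z.1]eq_sym (base _ _ _ xz fk) /= !addr0 => -> ->.
  by move=> /eqP; rewrite -subr_eq0 addrAC subrr add0r.
have square x y z t i j k m : uniq [:: x; y; z; t] ->
    f i x = f i y -> f j y = f j z -> f k z = f k t -> f m t = f m x -> i = m.
  rewrite /= !inE !negb_or andbT => /and3P[/and3P[xy xz xt] /andP[yz yt] zt].
  move=> fi fj fk fm; apply/eqP; apply: contraT => im; rewrite eq_sym in xt.
  have := fE i x y (x.1, i) fi; have := fE j y z (x.1, i) fj.
  have := fE k z t (x.1, i) fk; have := fE m t x (x.1, i) fm.
  rewrite !xpair_eqE !eqxx (negbTE im) (base _ _ _ xy fi).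
  rewrite [x.1 == t.1]eq_sym (base _ _ _ xt fm) /= !addr0 => tx.
  (* Otherwise [x] and [z] would be distinct points of one clique over the same base point. *)
  have -> : (x.1 == z.1) && (i == j) = false.
    apply/negP => /andP[/eqP xz1 /eqP ij]; rewrite -ij in fj.
    by have := base _ _ _ xz (etrans fi fj); rewrite xz1 eqxx.
  rewrite addr0 tx => + yz' xE; rewrite -yz' -xE -addrA => /eqP.
  by rewrite -subr_eq0 addrAC subrr add0r; case: (_ && _).
exists T, (clique_rel f); split.
- by rewrite card_prod card_ord muln_gt0 M0 card_ffun expn_gt0 card_ord.
- exact: clique_rel_sym.
- exact: clique_rel_irr.
- by move=> x; rewrite (card_clique_rel fiber linear).
- move=> o; split; first exact: (clique_triangles fiber linear triangle).
  exact: (clique_squares fiber linear square).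
Qed.

Section disjoint_union.
Context (T1 T2 : finType) (e1 : rel T1) (e2 : rel T2).

Definition sum_rel : rel (T1 + T2)%type := fun x y =>
  match x, y with
  | inl x, inl y => e1 x y
  | inr x, inr y => e2 x y
  | _, _ => false
  end.

Lemma nbhs_iso_inl x :
  nbhs_iso (neighbours e1) (neighbours sum_rel) inl (fun=> True) x.
Proof.
split=> //; apply/fsetP => y; rewrite in_neighboursT; apply/idP/imfsetP.
  by case: y => //= y xy; exists y; rewrite //= in_neighboursT.
by case=> z /= + ->; rewrite in_neighboursT.
Qed.

Lemma nbhs_iso_inr x :
  nbhs_iso (neighbours e2) (neighbours sum_rel) inr (fun=> True) x.
Proof.
split=> //; apply/fsetP => y; rewrite in_neighboursT; apply/idP/imfsetP.
  by case: y => //= y xy; exists y; rewrite //= in_neighboursT.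
by case=> z /= + ->; rewrite in_neighboursT.
Qed.

Let inlP : (forall x y : T1, True -> True -> @inl T1 T2 x = inl y -> x = y) /\
  (forall x y, True -> True ->
    (@inl T1 T2 y \in neighbours sum_rel (inl x)) = (y \in neighbours e1 x)).
Proof. by split=> [x y _ _ []|x y _ _]; rewrite ?in_neighboursT. Qed.

Let inrP : (forall x y : T2, True -> True -> @inr T1 T2 x = inr y -> x = y) /\
  (forall x y, True -> True ->
    (@inr T1 T2 y \in neighbours sum_rel (inr x)) = (y \in neighbours e2 x)).
Proof. by split=> [x y _ _ []|x y _ _]; rewrite ?in_neighboursT. Qed.

Lemma sum_rel_inl x : [/\ #|sum_rel (inl x)| = #|e1 x|,
  triangle_walks (neighbours sum_rel) (inl x) = triangle_walks (neighbours e1) x &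
  square_walks (neighbours sum_rel) (inl x) = square_walks (neighbours e1) x].
Proof.
have [i1 i2] := inlP; split.
- by rewrite -!card_neighbours; exact: (card_nbhs_iso i1 (nbhs_iso_inl x)).
- exact: (triangle_walks_iso i1 i2 (nbhs_iso_inl x)).
- exact: (square_walks_iso i1 i2 (nbhs_iso_inl x) (fun a _ => nbhs_iso_inl a)).
Qed.

Lemma sum_rel_inr x : [/\ #|sum_rel (inr x)| = #|e2 x|,
  triangle_walks (neighbours sum_rel) (inr x) = triangle_walks (neighbours e2) x &
  square_walks (neighbours sum_rel) (inr x) = square_walks (neighbours e2) x].
Proof.
have [i1 i2] := inrP; split.
- by rewrite -!card_neighbours; exact: (card_nbhs_iso i1 (nbhs_iso_inr x)).
- exact: (triangle_walks_iso i1 i2 (nbhs_iso_inr x)).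
- exact: (square_walks_iso i1 i2 (nbhs_iso_inr x) (fun a _ => nbhs_iso_inr a)).
Qed.

Lemma sum_rel_sym : symmetric e1 -> symmetric e2 -> symmetric sum_rel.
Proof. by move=> s1 s2 [] x [] y /=. Qed.

Lemma sum_rel_irr : irreflexive e1 -> irreflexive e2 -> irreflexive sum_rel.
Proof. by move=> i1 i2 [] x /=. Qed.

End disjoint_union.
End finite_graphs.

(** * Random rooted graphs *)

Section graph_neighbours.
Context (D : nat) (G : graph D).

Lemma finite_adj x : finite_set [set y | adj G x y].
Proof. exact: card_le_finite (degree_bound G x) (finite_II D). Qed.

Lemma in_neighboursG x y : (y \in neighbours (adj G) x) = adj G x y.
Proof. exact/in_neighbours/finite_adj. Qed.

Lemma neighboursG_sym x y :
  (y \in neighbours (adj G) x) = (x \in neighbours (adj G) y).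
Proof. by rewrite !in_neighboursG adj_sym. Qed.

Lemma neighboursG_irr x : x \notin neighbours (adj G) x.
Proof. by rewrite in_neighboursG adj_irr. Qed.

Lemma card_neighboursG_le x : (#|` neighbours (adj G) x| <= D)%N.
Proof. exact/geq_card_fset_set/degree_bound. Qed.

End graph_neighbours.

Section ball_iso.
Context (D n : nat).
Implicit Types G H : walk_graph D n.

Lemma wg_ball_vertices G k : wg_ball G k `<=` vertices G.
Proof.
move=> x [u [p [uG + <- _]]]; elim/last_ind: p => [_|p y _].
  exact: walk_vertices uG.
rewrite last_rcons rcons_path => /andP[_]; rewrite adj_sym.
exact: adj_vertices.
Qed.

Lemma wg_ball_adj G k x y : wg_ball G k x -> adj G x y -> wg_ball G k.+1 y.
Proof.
move=> [u [p [uG po lp sp]]] xy; exists u, (rcons p y).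
by rewrite rcons_path po lp xy last_rcons size_rcons.
Qed.

Lemma wg_iso_ball G H k : wg_iso G H -> wg_ball_iso k G H.
Proof.
move=> [f [[fV finj fsurj] fw fe]].
have sub (I : walk_graph D n) := @wg_ball_vertices I k.
have im (I J : walk_graph D n) (h : nat -> nat) : map h (walk I) = walk J ->
    (forall x y, vertices I x -> vertices I y -> adj J (h x) (h y) = adj I x y) ->
    forall x, wg_ball I k x -> wg_ball J k (h x).
  move=> hw he; apply: wg_ball_image (leqnn k) hw _.
  by move=> x y /sub Ix /sub Iy; exact: he.
exists f; split=> //; last by move=> x y /sub Gx /sub Gy; exact: fe.
split=> [||y By]; first exact: im.
  by move=> x y /set_mem/sub Gx /set_mem/sub Gy; apply: finj; rewrite inE.
have/boolp.choice[h hP] : forall y, exists x, vertices H y -> vertices G x /\ f x = y.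
  move=> z; have [Hz|nHz] := pselect (vertices H z); last by exists 0%N.
  by have [x Gx <-] := fsurj z Hz; exists x.
have hK x : vertices G x -> h (f x) = x.
  move=> Gx; have [Gh fh] := hP _ (fV _ Gx).
  by apply: finj; rewrite ?inE.
exists (h y); last exact: (hP _ (sub _ _ By)).2.
apply: im By.
- rewrite -fw -map_comp -[RHS]map_id; apply/eq_in_map => x xw /=.
  by apply: hK; exact: walk_vertices.
- move=> x z Hx Hz; have [Gx {2}<-] := hP _ Hx; have [Gz {2}<-] := hP _ Hz.
  by rewrite fe.
Qed.

(** Neighbours of vertices of the [k]-ball lie in the [k.+1]-ball, in [G] and in [H], so an
    isomorphism of the larger balls carries whole neighbourhoods on the smaller one. *)
Lemma wg_ball_iso_nbhs G H k : wg_ball_iso k.+1 G H -> exists f,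
  [/\ map f (walk G) = walk H,
      forall x y, wg_ball G k.+1 x -> wg_ball G k.+1 y -> f x = f y -> x = y,
      forall x y, wg_ball G k.+1 x -> wg_ball G k.+1 y ->
        (f y \in neighbours (adj H) (f x)) = (y \in neighbours (adj G) x) &
      forall x, wg_ball G k x ->
        nbhs_iso (neighbours (adj G)) (neighbours (adj H)) f (wg_ball G k.+1) x].
Proof.
move=> [f [[fB finj fsurj] fw fe]]; exists f; split=> //.
- by move=> x y Bx By; apply: finj; rewrite inE.
- by move=> x y Bx By; rewrite !in_neighboursG fe.
move=> x Bx; have Bx' := wg_ball_le (leqnSn k) Bx; split=> //.
  by move=> y; rewrite in_neighboursG; exact: wg_ball_adj Bx.
apply/fsetP => y; rewrite in_neighboursG; apply/idP/imfsetP => [xy|[z /= + ->]].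
  have Bfx := wg_ball_image (leqnSn k) fw fe Bx.
  have [z Bz zy] := fsurj _ (wg_ball_adj Bfx xy); exists z => //=.
  by rewrite in_neighboursG -fe// zy.
by rewrite in_neighboursG => xz; rewrite fe//; exact: wg_ball_adj xz.
Qed.

End ball_iso.

Section invariants.
Context (D : nat).

(** Such a [phi] is locally constant on the space of classes, hence Borel, and does not depend on
    the representative picked by [repr]. *)
Definition ball_invariant (n k : nat) (V : Type) (phi : walk_graph D n -> V) :=
  forall G H, wg_ball_iso k G H -> phi G = phi H.

Lemma wg_ball_root (G : rooted_graph D) k : wg_ball G k (wg_root G).
Proof. by apply: wg_ball_walk; rewrite /wg_root /thead mem_tnth. Qed.

Let root_iso (G H : rooted_graph D) (f : nat -> nat) :
  map f (walk G) = walk H -> f (wg_root G) = wg_root H.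
Proof.
rewrite /wg_root; case: (walk G) (walk H) => -[|x [|y s]] sG [[|z [|t u]] sH]//=.
by rewrite /thead /tnth /= => -[].
Qed.

Lemma ball_invariant_triangles :
  @ball_invariant 0 2 nat (fun G => triangle_walks (neighbours (adj G)) (wg_root G)).
Proof.
move=> G H /wg_ball_iso_nbhs[f [fw fi fa fn]]; rewrite -(root_iso fw).
by apply/esym/(triangle_walks_iso fi fa)/fn; exact: wg_ball_root.
Qed.

Lemma ball_invariant_cherries :
  @ball_invariant 0 2 nat (fun G => cherry_walks (neighbours (adj G)) (wg_root G)).
Proof.
move=> G H /wg_ball_iso_nbhs[f [fw fi fa fn]]; rewrite -(root_iso fw).
by apply/esym/(cherry_walks_iso fi fa)/fn; exact: wg_ball_root.
Qed.

Lemma ball_invariant_cliques :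
  @ball_invariant 0 2 nat (fun G => clique_walks (neighbours (adj G)) (wg_root G)).
Proof.
move=> G H /wg_ball_iso_nbhs[f [fw fi fa fn]]; rewrite -(root_iso fw).
by apply/esym/(clique_walks_iso fi fa)/fn; exact: wg_ball_root.
Qed.

Let ball1 (G : rooted_graph D) a :
  a \in neighbours (adj G) (wg_root G) -> wg_ball G 1 a.
Proof. by rewrite in_neighboursG; apply: wg_ball_adj; exact: wg_ball_root. Qed.

Lemma ball_invariant_squares :
  @ball_invariant 0 2 nat (fun G => square_walks (neighbours (adj G)) (wg_root G)).
Proof.
move=> G H /wg_ball_iso_nbhs[f [fw fi fa fn]]; rewrite -(root_iso fw).
apply/esym/(square_walks_iso fi fa); first by apply: fn; exact: wg_ball_root.
by move=> a /ball1; exact: fn.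
Qed.

(** [rv] makes the root an end of the chord instead of the non-edge. [F] is the identity for the
    counts and a threshold [j < n] for the events used with unimodularity. *)
Definition sum_diamonds (rv : bool) (F : nat -> nat) (G : rooted_graph D) : nat :=
  let N := neighbours (adj G) in let u := wg_root G in
  (\sum_(a <- N u) F (if rv then diamonds N a u else diamonds N u a))%N.

Lemma ball_invariant_sum_diamonds rv F : ball_invariant 2 (sum_diamonds rv F).
Proof.
move=> G H /wg_ball_iso_nbhs[f [fw fi fa fn]]; rewrite /sum_diamonds -(root_iso fw).
have ho := fn _ (wg_ball_root G 1).
have [out inn] := sum_diamonds_iso fi fa F ho (fun a aG => fn a (ball1 aG)).
by case: rv; rewrite ?inn ?out.
Qed.

Lemma ball_invariant_degree :
  @ball_invariant 0 2 nat (fun G => #|` neighbours (adj G) (wg_root G)|).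
Proof.
move=> G H /wg_ball_iso_nbhs[f [fw fi fa fn]]; rewrite -(root_iso fw).
by apply/esym/(card_nbhs_iso fi)/fn; exact: wg_ball_root.
Qed.

Definition edge_diamonds (G : edge_graph D) : nat :=
  diamonds (neighbours (adj G)) (nth 0%N (walk G) 0) (nth 0%N (walk G) 1).

Lemma ball_invariant_edge_diamonds : ball_invariant 1 edge_diamonds.
Proof.
move=> G H /wg_ball_iso_nbhs[f [fw fi fa fn]].
have wE i : (i < 2)%N -> nth 0%N (walk H) i = f (nth 0%N (walk G) i).
  by move=> i2; rewrite -fw (nth_map 0%N) ?size_tuple.
rewrite /edge_diamonds !wE//; apply/esym/(diamonds_iso fi fa); apply: fn;
  by apply: wg_ball_walk; apply: mem_nth; rewrite size_tuple.
Qed.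

Lemma ball_invariant_rev_edge_diamonds :
  ball_invariant 1 (fun G => edge_diamonds (rev_edge G)).
Proof.
move=> G H [f [fb fw fe]]; apply: ball_invariant_edge_diamonds.
have ballE (I : edge_graph D) : wg_ball (rev_edge I) 1 = wg_ball I 1.
  by apply/seteqP; split=> x [u [p [uI pu lp sp]]]; exists u, p; split=> //;
    move: uI; rewrite mem_rev.
by exists f; rewrite !ballE; split=> //=; rewrite map_rev fw.
Qed.

End invariants.

(** * Finitely supported laws *)

Section finitely_supported.
Import HBNNSimple.
Local Open Scope ereal_scope.
Context (d : measure_display) (X : measurableType d) (R : realType).
Context (N : nat) (w : nat -> {nonneg R}) (a : nat -> X).
Hypothesis w1 : (\sum_(k < N) (w k)%:num = 1)%R.

Lemma exists_finitely_supported : exists P : probability X R,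
  forall g : X -> \bar R, measurable_fun setT g -> (forall x, 0 <= g x) ->
    \int[P]_x g x = \sum_(k < N) (w k)%:num%:E * g (a k).
Proof.
pose m := msum (fun k => mscale (w k) (@dirac d X (a k) R)) N.
have m1 : m setT = 1.
  rewrite /m /msum /= -w1 -sumEFin; apply: eq_bigr => k _.
  by rewrite /mscale /= diracT mule1.
pose P : probability X R := HB.pack m
  (Measure_isProbability.Build d X R m m1).
exists P => g mg g0; rewrite ge0_integral_measure_sum//.
apply: eq_bigr => k _; rewrite ge0_integral_mscale// integral_dirac//.
by rewrite diracT mul1e.
Qed.

Hypothesis a_measurable : forall k, measurable [set a k].

(* No measurability is needed of f, as all subsets of the support are
   measurable. *)
Lemma integral_finitely_supported (P : probability X R) :
  (forall g : X -> \bar R, measurable_fun setT g -> (forall x, 0 <= g x) ->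
    \int[P]_x g x = \sum_(k < N) (w k)%:num%:E * g (a k)) ->
  forall f : X -> \bar R, (forall x, 0 <= f x) ->
    \int[P]_x f x = \sum_(k < N) (w k)%:num%:E * f (a k).
Proof.
move=> PE f f0; pose S := a @` `I_N.
have mS (Y : set X) : measurable (S `&` Y).
  rewrite (_ : S `&` Y = \bigcup_(k in [set k | (k < N)%N /\ Y (a k)]) [set a k]).
    apply: fin_bigcup_measurable => [|k _]; last exact: a_measurable.
    by apply: (sub_finite_set _ (finite_II N)) => k [].
  apply/seteqP; split=> [x [[k kN <-] Yx]|x [k [kN Yk] ->]].
    by exists k.
  by split=> //; exists k.
have mg : measurable_fun setT (f \_ S).
  move=> _ Y mY; rewrite setTI.
  rewrite (_ : _ @^-1` _ = (S `&` f @^-1` Y) `|` (~` (S `&` setT) `&` [set _ | Y 0])).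
    apply: measurableU => //; apply: measurableI; first exact/measurableC/mS.
    have [Y0|Y0] := pselect (Y 0).
      by rewrite (_ : [set _ | _] = setT)//; apply/seteqP; split.
    by rewrite (_ : [set _ | _] = set0)//; apply/seteqP; split.
  rewrite setIT; apply/seteqP; split=> x /=; rewrite patchE.
    by case: ifPn => [/set_mem|/negP]; rewrite ?inE; [left|right].
  by case=> -[Sx Yx]; rewrite ?(mem_set Sx)// memNset.
have g0 x : 0 <= (f \_ S) x by rewrite erestrict_ge0.
(* The integral is a supremum over simple functions below [f]. Each of these is measurable, so the
   formula bounds it from above; the restriction of [f] to the support is measurable and bounds it
   from below. *)
apply/eqP; rewrite eq_le; apply/andP; split.
  rewrite ge0_integralTE//; apply: ge_ereal_sup => _ [h /= hf <-].
  rewrite -integralT_nnsfun PE => [||x]; last by rewrite lee_fin.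
    by apply: lee_sum => k _; exact: lee_wpmul2l.
  exact/measurable_EFinP.
apply: (@le_trans _ _ (\int[P]_x (f \_ S) x)).
  rewrite PE//; apply: lee_sum => k _; rewrite patchE mem_set//.
  by exists (val k) => /=.
rewrite !ge0_integralTE//; apply: ereal_sup_le => _ [h /= hf <-].
exists h => //= x; apply: (le_trans (hf x)).
by rewrite patchE; case: ifP.
Qed.

End finitely_supported.

(** * Topology of the space of isomorphism classes *)

Section space.
Context (R : realType) (D : nat).

Lemma pi_repr_iso n (G : walk_graph D n) :
  wg_iso (repr (\pi_(walk_space R D n) G)) G.
Proof.
have := reprK (\pi_(walk_space R D n) G).
by move/eqmodP/asboolP.
Qed.

Lemma ball_invariant_pi n k V (phi : walk_graph D n -> V) G :
  ball_invariant k phi -> phi (repr (\pi_(walk_space R D n) G)) = phi G.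
Proof. by move=> inv; apply: inv; apply: wg_iso_ball; exact: pi_repr_iso. Qed.

(** Classes at distance less than [1 / k.+1] have isomorphic [k]-balls. *)
Lemma open_invariant n k (A : set (walk_graph D n)) :
  ball_invariant k A -> open [set x : walk_space R D n | A (repr x)].
Proof.
move=> inv; rewrite openE => x Ax; apply/nbhs_ballP.
have e0 : 0 < (k.+1%:R^-1 : R) by rewrite invr_gt0.
exists k.+1%:R^-1 => //=.
move=> y /(wg_dist_ltP _ _ e0)[j [j0 jk xy]]; rewrite /= -(inv (repr x))//.
apply: wg_ball_iso_le xy.
by move: jk; rewrite ltf_pV2 ?posrE ?ltr0n// ltr_nat => /ltnW/ltnW.
Qed.

Lemma measurable_invariant k V (phi : rooted_graph D -> V) (A : set V) :
  ball_invariant k phi ->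
  measurable ([set x : rooted_space R D | A (phi (repr x))] : set (borel_rooted R D)).
Proof.
move=> inv; apply: sub_gen_smallest; apply: (@open_invariant _ k [set G | A (phi G)]).
by move=> G H /inv GH; rewrite /= GH.
Qed.

Lemma measurable_fun_invariant k (phi : rooted_graph D -> R) :
  ball_invariant k phi ->
  measurable_fun setT (fun x : borel_rooted R D => phi (repr (x : rooted_space R D))).
Proof.
move=> inv _ Y mY; rewrite setTI; exact: (measurable_invariant Y inv).
Qed.

Lemma finite_ball (G : rooted_graph D) : finite_set (vertices G) ->
  exists k, wg_ball G k = vertices G.
Proof.
move=> finG; have rG : vertices G (wg_root G).
  by apply: walk_vertices; rewrite /wg_root /thead mem_tnth.
have /boolp.choice[p pP] : forall x, exists p, vertices G x ->
    path (adj G) (wg_root G) p /\ last (wg_root G) p = x.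
  move=> x; have [Gx|nGx] := pselect (vertices G x); last by exists [::].
  by have [p pp lp] := graph_connected rG Gx; exists p.
exists (\max_(x <- fset_set (vertices G)) size (p x))%N.
apply/seteqP; split=> [|x Gx]; first exact: wg_ball_vertices.
have [px lx] := pP x Gx; exists (wg_root G), (p x); split=> //.
  by rewrite /wg_root /thead mem_tnth.
by apply: (@leq_bigmax_seq _ _ xpredT (fun x => size (p x))) => //; rewrite in_fset_set ?inE.
Qed.

(** The isomorphism maps [wg_ball G k.+1], which equals [wg_ball G k], onto [wg_ball H k.+1]. So the
    larger ball of [H] adds nothing to its [k]-ball, which is then all of [H] by connectedness. *)
Lemma wg_ball_iso_finite (G H : rooted_graph D) k :
  wg_ball G k = vertices G -> wg_ball_iso k.+1 G H -> wg_iso G H.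
Proof.
move=> Gk [f [[fB finj fsurj] fw fe]].
have Gk1 : wg_ball G k.+1 = vertices G.
  apply/seteqP; split; first exact: wg_ball_vertices.
  by rewrite -Gk; exact: wg_ball_le.
have Hk1 : wg_ball H k.+1 = vertices H.
  apply/seteqP; split=> [|y Hy]; first exact: wg_ball_vertices.
  have Hk z : wg_ball H k.+1 z -> wg_ball H k z.
    move=> /fsurj[x]; rewrite Gk1 -Gk => Gx <-.
    exact: wg_ball_image (leqnSn k) fw fe x Gx.
  have rH : vertices H (wg_root H).
    by apply: walk_vertices; rewrite /wg_root /thead mem_tnth.
  have [p pp <-] := graph_connected rH Hy.
  elim/last_ind: p pp => [_|p z IH]; first exact: wg_ball_root.
  rewrite rcons_path last_rcons => /andP[/IH Hlp]; apply: wg_ball_adj.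
  exact: Hk.
by exists f; split; rewrite -?Gk1 -?Hk1.
Qed.

(** The class of a finite graph is an isolated point: a large enough ball determines it. *)
Lemma measurable_finite_graph (G : rooted_graph D) : finite_set (vertices G) ->
  measurable ([set \pi_(rooted_space R D) G] : set (borel_rooted R D)).
Proof.
move=> /finite_ball[k Gk].
rewrite (_ : [set _] = [set x : rooted_space R D | wg_ball_iso k.+1 G (repr x)]).
  apply: (@measurable_invariant k.+1 _ (fun H => wg_ball_iso k.+1 G H) id) => H K HK.
  rewrite propeqE; split=> h; first exact: iso_on_trans h HK.
  by apply: iso_on_trans h _; exact: wg_ball_iso_sym.
apply/seteqP; split=> [x -> /=|x /= /(wg_ball_iso_finite Gk) Gx].
  by apply/wg_ball_iso_sym/wg_iso_ball/pi_repr_iso.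
by rewrite -[x]reprK; apply/esym/eqmodP/asboolP.
Qed.

End space.

Lemma card_adj D (G : graph D) r x :
  ([set y | adj G x y] #= `I_r)%card <-> #|` neighbours (adj G) x| = r.
Proof.
split=> [|rx]; first exact: card_fset_set.
apply/(fcard_eq (finite_adj G x) (finite_II r)).
by rewrite [RHS](card_fset_set (card_eqxx _)).
Qed.

Lemma wg_regular_iso D n r (G H : walk_graph D n) :
  wg_iso G H -> wg_regular r H -> wg_regular r G.
Proof.
move=> [f [[fV finj fsurj] fw fe]] rH x Gx; apply/card_adj.
rewrite -((card_adj _ _ _).1 (rH _ (fV _ Gx))); apply/esym.
have aV (I : graph D) u v : adj I u v -> vertices I v.
  by rewrite adj_sym; exact: adj_vertices.
apply: (@card_nbhs_iso _ _ _ _ f (vertices G)).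
  by move=> y z Gy Gz; apply: finj; rewrite inE.
split=> // [y|]; first by rewrite in_neighboursG; exact: aV.
apply/fsetP => y; rewrite in_neighboursG; apply/idP/imfsetP => [xy|[z /= + ->]].
  have [z Gz zy] := fsurj _ (aV _ _ _ xy); exists z => //=.
  by rewrite in_neighboursG -fe// zy.
by rewrite in_neighboursG => xz; rewrite fe//; exact: aV xz.
Qed.

(** * Components of finite graphs as random rooted graphs *)

Section finite_to_random.
Context (R : realType) (D r : nat) (hD : (r <= D)%N).
Context (T : finType) (e : rel T).
Hypotheses (e_sym : symmetric e) (e_irr : irreflexive e).
Hypothesis e_reg : forall x, #|e x| = r.

Let rk (y : T) : nat := enum_rank y.

Let rk_inj : injective rk.
Proof. by move=> y z /val_inj/enum_rank_inj. Qed.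

(** Restricted to the component of [x], since rooted graphs are connected, with vertices encoded by
    their ranks. As [x] enters only through its component, adjacent roots give the same graph. *)
Definition comp_adj (x : T) : rel nat := fun n m =>
  [exists y : T, exists z : T, [&& n == rk y, m == rk z, e y z & connect e x y]].

Definition comp_vertices (x : T) : set nat := [set rk y | y in [set y | connect e x y]].

Lemma comp_adjP x n m : reflect
  (exists y z, [/\ n = rk y, m = rk z, e y z & connect e x y]) (comp_adj x n m).
Proof.
apply: (iffP existsP) => [[y /existsP[z /and4P[/eqP -> /eqP -> yz xy]]]|].
  by exists y, z.
by move=> [y [z [-> -> yz xy]]]; exists y; apply/existsP; exists z; rewrite !eqxx yz.
Qed.

Lemma comp_adjE x y z : comp_adj x (rk y) (rk z) = e y z && connect e x y.
Proof.
apply/comp_adjP/andP => [[y' [z' [/rk_inj -> /rk_inj ->]]]//|[yz xy]].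
by exists y, z.
Qed.

Let connect_e x y z : e y z -> connect e x y -> connect e x z.
Proof. by move=> yz xy; apply: connect_trans xy (connect1 yz). Qed.

Lemma comp_adj_sym x : symmetric (comp_adj x).
Proof.
suff h n m : comp_adj x n m -> comp_adj x m n.
  by move=> n m; apply/idP/idP; exact: h.
move=> /comp_adjP[y [z [-> -> yz xy]]].
by rewrite comp_adjE e_sym yz; exact: connect_e xy.
Qed.

Lemma comp_adj_irr x : irreflexive (comp_adj x).
Proof. by move=> n; apply/comp_adjP => -[y [z [-> /rk_inj ->]]]; rewrite e_irr. Qed.

Lemma comp_adj_vertices x n m : comp_adj x n m -> comp_vertices x n.
Proof. by move=> /comp_adjP[y [z [-> _ _ xy]]]; exists y. Qed.

Lemma comp_connected x n m : comp_vertices x n -> comp_vertices x m ->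
  exists2 p : seq nat, path (comp_adj x) n p & last n p = m.
Proof.
move=> [y /= xy <-] [z /= xz <-].
have /connectP[p + ->] : connect e y z.
  by apply: connect_trans xz; rewrite (sym_connect_sym e_sym).
move=> pp; exists (map rk p); last by rewrite last_map.
elim: p y xy pp {xz} => //= z' p IH y xy /andP[yz pp].
by rewrite comp_adjE yz xy /= IH//; exact: connect_e xy.
Qed.

Let comp_nbhs x y : connect e x y ->
  [set m | comp_adj x (rk y) m] = [set rk z | z in [set z | e y z]].
Proof.
move=> xy; apply/seteqP; split=> [m /comp_adjP[y' [z [/rk_inj <- -> yz _]]]|m [z /= yz <-]].
  by exists z.
by rewrite comp_adjE yz.
Qed.

Let card_rk (P : pred T) : #|` fset_set [set rk z | z in [set z | P z]]| = #|P|.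
Proof.
rewrite fset_set_image; last exact: finite_finset.
rewrite card_imfset//= (@card_fset_set_seq _ _ (enum P)).
  by rewrite undup_id ?enum_uniq// -cardE.
by move=> z; rewrite mem_enum.
Qed.

Let comp_degree x n : comp_vertices x n -> ([set m | comp_adj x n m] #= `I_r)%card.
Proof.
move=> [y xy <-]; rewrite comp_nbhs//.
have fin : finite_set [set rk z | z in [set z | e y z]].
  exact/finite_image/finite_finset.
apply/(fcard_eq fin (finite_II r)).
by rewrite card_rk e_reg (card_fset_set (card_eqxx _)).
Qed.

Let comp_degree_bound x n : ([set m | comp_adj x n m] #<= `I_D)%card.
Proof.
have [xn|xn] := pselect (comp_vertices x n).
  apply: (@card_le_trans _ _ _ `I_r).
    by have := comp_degree xn; rewrite card_eq_le => /andP[].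
  by rewrite card_le_II.
rewrite (_ : [set m | _] = set0) ?card_le0x//.
by apply/seteqP; split=> m //= /comp_adj_vertices.
Qed.

Definition comp_graph x : graph D :=
  @Graph D (comp_vertices x) (comp_adj x) (@comp_adj_sym x) (@comp_adj_irr x)
    (@comp_adj_vertices x) (@comp_connected x) (comp_degree_bound x).

Let comp_root x n : n \in [:: rk x] -> comp_vertices x n.
Proof. by rewrite mem_seq1 => /eqP ->; exists x => //=; exact: connect0. Qed.

Definition comp_rooted x : rooted_graph D :=
  @WalkGraph D 0 (comp_graph x) [tuple rk x] (@comp_root x) isT.

Lemma comp_rooted_regular x : wg_regular r (comp_rooted x).
Proof. by move=> n; exact: comp_degree. Qed.

Lemma comp_rooted_finite x : finite_set (vertices (comp_rooted x)).
Proof. exact/finite_image/finite_finset. Qed.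

Let nbhs_iso_rk x y : connect e x y ->
  nbhs_iso (neighbours e) (neighbours (comp_adj x)) rk (fun y => connect e x y) y.
Proof.
move=> xy; split=> // [z|]; first by rewrite in_neighboursT => /connect_e; exact.
rewrite /neighbours comp_nbhs// fset_set_image//.
exact: finite_finset.
Qed.

Let rk_adj x y z : connect e x y -> connect e x z ->
  (rk z \in neighbours (adj (comp_graph x)) (rk y)) = (z \in neighbours e y).
Proof.
by move=> xy xz; rewrite in_neighboursT in_neighboursG /= comp_adjE xy andbT.
Qed.

Let rk_injc x y z : connect e x y -> connect e x z -> rk y = rk z -> y = z.
Proof. by move=> _ _ /rk_inj. Qed.

Lemma comp_triangles x :
  triangle_walks (neighbours (adj (comp_rooted x))) (wg_root (comp_rooted x)) =
  triangle_walks (neighbours e) x.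
Proof. exact: (triangle_walks_iso (@rk_injc x) (@rk_adj x) (nbhs_iso_rk (connect0 e x))). Qed.

Lemma comp_squares x :
  square_walks (neighbours (adj (comp_rooted x))) (wg_root (comp_rooted x)) =
  square_walks (neighbours e) x.
Proof.
apply: (square_walks_iso (@rk_injc x) (@rk_adj x) (nbhs_iso_rk (connect0 e x))).
by move=> y; rewrite in_neighboursT => /connect1 xy; exact: nbhs_iso_rk.
Qed.

Definition comp_edge (A : set (edge_space R D)) (x y : T) : bool :=
  `[< exists h : adj (comp_rooted x) (wg_root (comp_rooted x)) (rk y),
        A (\pi_(edge_space R D) (add_edge h)) >].

(** Adjacent [x] and [y] have the same component, so the reversal of the edge [(x, y)] seen from [x]
    is the edge [(y, x)] seen from [y]. *)
Lemma comp_edge_rev A x y :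
  comp_edge (@space_rev R D @^-1` A) x y = comp_edge A y x.
Proof.
suff main (h : adj (comp_rooted x) (wg_root (comp_rooted x)) (rk y))
    (h' : adj (comp_rooted y) (wg_root (comp_rooted y)) (rk x)) :
    space_rev (\pi_(edge_space R D) (add_edge h)) =
    \pi_(edge_space R D) (add_edge h').
  have hh' z t : adj (comp_rooted z) (wg_root (comp_rooted z)) (rk t) ->
      adj (comp_rooted t) (wg_root (comp_rooted t)) (rk z).
    rewrite /= !comp_adjE => /andP[zt _].
    by rewrite e_sym zt connect0.
  apply/asboolP/asboolP => -[h /= Ah].
    by exists (hh' _ _ h); rewrite -main.
  by exists (hh' _ _ h); rewrite /= (main _ h).
have xy : e x y by move: h; rewrite /= comp_adjE => /andP[].
have xyE : connect e x = connect e y.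
  apply/funext => z; apply: same_connect; first exact: sym_connect_sym.
  exact: connect1.
rewrite /space_rev; apply/eqmodP/asboolP.
have [f [fb fw fe]] := pi_repr_iso R (add_edge h).
apply: (@iso_on_trans _ (vertices (comp_graph x)) _ _ (comp_adj x) _ _ [:: rk y; rk x]).
  exists f; split=> //=.
  by rewrite map_rev fw.
exists id; split=> //.
  by rewrite /= /comp_vertices xyE; split=> // z; exists z.
by move=> z t _ _ /=; rewrite /comp_adj xyE.
Qed.

(** A general event is not decided by a ball of fixed radius, so independence of the representative
    is checked directly: an isomorphism matches the favourable neighbours of the two roots. *)
Lemma neighbour_prob_iso (A : set (edge_space R D)) (G H : rooted_graph D) :
  wg_iso G H -> neighbour_prob A G = neighbour_prob A H.
Proof.
move=> GH; have [f [[fV finj fsurj] fw fe]] := GH.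
have fr : f (wg_root G) = wg_root H.
  move: fw; rewrite /wg_root; case: (walk G) (walk H) => -[|z [|? ?]] ? [[|? [|? ?]] ?]//=.
  by rewrite /thead /tnth /= => -[].
have rG : vertices G (wg_root G).
  by apply: walk_vertices; rewrite /wg_root /thead mem_tnth.
have aV (I : rooted_graph D) v : adj I (wg_root I) v -> vertices I v.
  by rewrite adj_sym; exact: adj_vertices.
have card_f (S : set nat) : S `<=` [set v | adj G (wg_root G) v] ->
    #|` fset_set (f @` S)| = #|` fset_set S|.
  move=> SG; have finS : finite_set S := sub_finite_set SG (finite_adj _ _).
  rewrite fset_set_image// card_in_imfset//= => y z.
  rewrite !in_fset_set// !inE => /SG/aV Gy /SG/aV Gz.
  by apply: finj; rewrite inE.
rewrite /neighbour_prob; congr (_%:R / _%:R).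
  rewrite -[LHS]card_f; last by move=> v [].
  congr (#|` fset_set _|); apply/seteqP; split=> [_ [v [h Av] <-]|v [h Av]].
    have h' : adj H (wg_root H) (f v) by rewrite -fr fe//; exact: aV.
    exists h'; rewrite (_ : \pi_(edge_space R D) (add_edge h') =
      \pi_(edge_space R D) (add_edge h))//.
    apply/esym/eqmodP/asboolP; exists f; split=> //=.
    by rewrite fr.
  have [u Gu uv] := fsurj _ (aV _ _ h).
  have h' : adj G (wg_root G) u by rewrite -fe// fr uv.
  exists u => //; exists h'.
  rewrite (_ : \pi_(edge_space R D) (add_edge h') = \pi_(edge_space R D) (add_edge h))//.
  apply/eqmodP/asboolP; exists f; split=> //=.
  by rewrite fr uv.
rewrite -[LHS]card_f//; congr (#|` fset_set _|).
apply/seteqP; split=> [_ [v /= h <-]|v /= h].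
  by rewrite -fr fe//; exact: aV.
have [u Gu uv] := fsurj _ (aV _ _ h).
by exists u => //=; rewrite -fe// fr uv.
Qed.

Lemma comp_neighbour_prob A x :
  neighbour_prob A (comp_rooted x) = (\sum_y comp_edge A x y)%:R / r%:R.
Proof.
rewrite /neighbour_prob; congr (_%:R / _%:R).
  rewrite (_ : [set v | _] = [set rk y | y in [set y | comp_edge A x y]]).
    rewrite card_rk -sum1_card [LHS]big_mkcond; apply: eq_bigr => y _.
    by rewrite (_ : (y \in comp_edge A x) = comp_edge A x y)//; case: comp_edge.
  apply/seteqP; split=> [v [h Av]|_ [y /= /asboolP[h Ah] <-]]; last by exists h.
  have [_ [y [_ vE _ _]]] := comp_adjP _ _ _ h.
  by exists y => //=; apply/asboolP; move: h Av; rewrite vE => h Av; exists h.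
apply: card_fset_set; apply: comp_degree; exists x => //=; exact: connect0.
Qed.

Context (w : T -> R).
Hypotheses (w_ge0 : forall x, 0 <= w x) (w_sum : \sum_x w x = 1).
Hypothesis w_edge : forall x y, e x y -> w x = w y.

Lemma weighted_random_densities : random_densities R D r
  ((\sum_x w x * (triangle_walks (neighbours e) x)%:R) / 6%:R,
   (\sum_x w x * (square_walks (neighbours e) x)%:R) / 8%:R).
Proof.
have [x0 _] : exists x0 : T, true.
  apply/existsP; apply: contraT => /existsPn nT.
  by move: w_sum; rewrite big1 => [/esym/eqP|x]; rewrite ?oner_eq0//; have := nT x.
pose nx k := nth x0 (enum T) k.
pose wn k : {nonneg R} := NngNum (w_ge0 (nx k)).
pose a k : borel_rooted R D := \pi_(rooted_space R D) (comp_rooted (nx k)).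
have sumE (V : nmodType) (F : T -> V) : \sum_(k < #|T|) F (nx k) = \sum_x F x.
  by rewrite -[RHS]big_enum (big_nth x0) big_mkord -cardE.
have wn1 : \sum_(k < #|T|) (wn k)%:num = 1 by rewrite -w_sum -sumE.
have am k : measurable [set a k].
  exact: (measurable_finite_graph (comp_rooted_finite (nx k))).
have [P /(integral_finitely_supported am) PE] := exists_finitely_supported a wn1.
have intE (f : rooted_graph D -> R) (g : T -> R) : (forall G, 0 <= f G) ->
    (forall x, f (repr (\pi_(rooted_space R D) (comp_rooted x))) = g x) ->
    (\int[P]_x (f (repr (x : rooted_space R D)))%:E = (\sum_x w x * g x)%:E)%E.
  move=> f0 fg; rewrite PE => [|x]; last by rewrite lee_fin.
  rewrite -sumE -sumEFin; apply: eq_bigr => k _.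
  by rewrite fg EFinM.
have cycleE k (phi : rooted_graph D -> nat) (s : T -> nat) :
    (0 < k)%N -> ball_invariant 2 phi ->
    (forall G : rooted_graph D, phi G = (num_cycles_at (adj G) k (wg_root G)).*2) ->
    (forall x, phi (comp_rooted x) = s x) ->
    random_cycle_density k P = (\sum_x w x * (s x)%:R) / (k.*2)%:R.
  move=> k0 inv phiE phis; rewrite /random_cycle_density /Rintegral.
  have := intE (fun G => (num_cycles_at (adj G) k (wg_root G))%:R)
    (fun x => (s x)%:R / 2%:R) (fun=> ler0n _ _) => /= ->.
    rewrite /= -mul2n natrM invfM mulrA mulrC; congr (_ * _).
    by rewrite mulr_suml; apply: eq_bigr => x _; rewrite mulrA.
  move=> x; rewrite -phis -(ball_invariant_pi R (comp_rooted x) inv) phiE.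
  by rewrite -mul2n natrM mulrC mulKf// pnatr_eq0.
exists P; split.
- pose S := a @` `I_#|T|.
  have mS : measurable S.
    rewrite (_ : S = \bigcup_(k in `I_#|T|) [set a k]).
      by apply: fin_bigcup_measurable => // k _; exact: am.
    by apply/seteqP; split=> [_ [k kT <-]|x [k kT ->]]; exists k.
  exists (~` S); split; first exact: measurableC.
    have := integral_indic P measurableT (measurableC mS); rewrite setIT => <-.
    rewrite PE => [|x]; last by rewrite lee_fin.
    rewrite big1// => k _; rewrite indicE memNset ?mule0//.
    by apply; exists (val k) => /=.
  move=> x /= nreg Sx; apply: nreg; have [k _ <-] := Sx.
  exact: (wg_regular_iso (pi_repr_iso R _) (@comp_rooted_regular (nx k))).
- move=> A _; rewrite /edge_law.
  have lawE B : (\int[P]_x (neighbour_prob B (repr (x : rooted_space R D)))%:E =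
      (\sum_x w x * ((\sum_y comp_edge B x y)%:R / r%:R))%:E)%E.
    apply: intE => [G|x]; first by rewrite divr_ge0.
    by rewrite (neighbour_prob_iso _ (pi_repr_iso R (comp_rooted x))) comp_neighbour_prob.
  rewrite !lawE; congr (_%:E).
  have distr B : \sum_x w x * ((\sum_y comp_edge B x y)%:R / r%:R) =
      \sum_x \sum_y w x * ((comp_edge B x y)%:R / r%:R).
    apply: eq_bigr => x _; rewrite natr_sum mulr_suml mulr_sumr.
    by apply: eq_bigr.
  rewrite !distr [RHS]exchange_big; apply: eq_bigr => x _; apply: eq_bigr => y _ /=.
  rewrite comp_edge_rev; have [/asboolP[h _]|] := boolP (comp_edge A x y).
    by move: h; rewrite /= comp_adjE => /andP[xy _]; rewrite (w_edge xy).
  by rewrite !mul0r !mulr0.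
- congr pair; apply/esym.
    apply: (cycleE 3 (fun G => triangle_walks (neighbours (adj G)) (wg_root G))) => //.
    + exact: ball_invariant_triangles.
    + move=> G; apply: num_cycles_at3; [exact: adj_sym|exact: adj_irr|exact: in_neighboursG].
    + exact: comp_triangles.
  apply: (cycleE 4 (fun G => square_walks (neighbours (adj G)) (wg_root G))) => //.
  + exact: ball_invariant_squares.
  + move=> G; apply: num_cycles_at4; [exact: adj_sym|exact: adj_irr|exact: in_neighboursG].
  + exact: comp_squares.
Qed.

End finite_to_random.

(** * Random graphs lie in the polygon *)

Section polygon.
Context (R : realType) (r : nat).

Lemma extreme_pointE l : (0 < l)%N -> extreme_point R r l =
  (\sum_(1 <= i < l.+1) clique_x R (part_size r l i),
   \sum_(1 <= i < l.+1) clique_y R (part_size r l i)).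
Proof.
case: l => // l _; rewrite /extreme_point !mulr_sumr.
have bin2R (a : nat) : 'C(a, 2)%:R = a%:R * (a%:R - 1) / 2%:R :> R.
  elim: a => [|a IH]; first by rewrite bin0n !mul0r.
  by rewrite binS bin1 natrD IH -(natr1 a); lra.
congr pair; apply: eq_bigr => i _; rewrite ?natrM bin2R /clique_x /clique_y.
  by lra.
case: (part_size _ _ _) => [|a]; first by rewrite !(mul0r, mulr0).
by rewrite subn1 /= -(natr1 a); lra.
Qed.

Lemma density_polygon_extreme l : (l <= r)%N ->
  density_polygon R r (extreme_point R r l).
Proof. by move=> lr; apply: sub_gen_smallest; exists l. Qed.

Lemma convex_set2 (A : set (R^o * R^o)) :
  @convex_set R (R^o * R^o)%type A <-> convex2 (fun x y => A (x, y)).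
Proof.
split=> [cA t x y x' y' t0 t1 Axy Axy'|cA [x y] [x' y'] t /set_mem Axy /set_mem Axy'].
  have t01 : 0 <= t <= 1 by rewrite t0.
  have := cA (x, y) (x', y') (Itv01 t0 t1).
  by rewrite !inE => /(_ Axy Axy').
rewrite inE.
exact: (cA t%:num).
Qed.

Lemma convex_density_polygon : convex2 (fun x y => density_polygon R r (x, y)).
Proof.
apply/convex_set2 => p q t /set_mem Qp /set_mem Qq; rewrite inE => A [cA gA].
have := cA p q t; rewrite !inE; apply; [exact: Qp|exact: Qq].
Qed.

End polygon.

(** Partial sums are normalised by their weight [W]. Only terms of nonzero weight are controlled,
    because a value of the statistics that has probability zero may come from no regular graph. *)
Lemma convex2_sum (R : realFieldType) (Q : R -> R -> Prop) (I : finType)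
    (p X Y : I -> R) : convex2 Q -> (forall i, 0 <= p i) -> \sum_i p i = 1 ->
  (forall i, p i != 0 -> Q (X i) (Y i)) ->
  Q (\sum_i p i * X i) (\sum_i p i * Y i).
Proof.
move=> cQ p0 p1 QXY.
suff main (s : seq I) (W : R) : W = \sum_(i <- s) p i -> W != 0 ->
    Q ((\sum_(i <- s) p i * X i) / W) ((\sum_(i <- s) p i * Y i) / W).
  by have := main _ 1 (esym p1) (oner_neq0 _); rewrite !divr1.
elim: s W => [|i s IH] W; first by rewrite big_nil => ->; rewrite eqxx.
rewrite !big_cons => WE W0; set V := \sum_(j <- s) p j in WE.
have V0 : 0 <= V by apply: sumr_ge0.
have [Vz|Vn0] := eqVneq V 0.
  have pz j : j \in s -> p j = 0.
    move: Vz => /eqP; rewrite /V psumr_eq0// => /allP sz js; exact/eqP/sz.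
  rewrite !big_seq !big1 => [|j /pz ->|j /pz ->]; rewrite ?mul0r// !addr0.
  rewrite Vz addr0 in WE; rewrite WE in W0 *.
  by rewrite ![p i * _]mulrC !mulfK//; exact: QXY.
have [pi0|pin0] := eqVneq (p i) 0.
  by rewrite pi0 !mul0r !add0r; apply: IH => //; rewrite WE pi0 add0r.
have Wgt0 : 0 < W by rewrite lt_neqAle eq_sym W0 WE addr_ge0.
have := cQ (p i / W) _ _ _ _ _ _ (QXY _ pin0) (IH V erefl Vn0).
have -> : 1 - p i / W = V / W by rewrite -[1](divff W0) -mulrBl WE addrC addKr.
have VW Z : V / W * (Z / V) = Z / W.
  by rewrite mulrC mulrA divfK.
rewrite !VW ![p i / W * _]mulrAC -!mulrDl; apply; first by rewrite divr_ge0// ltW.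
by rewrite ler_pdivrMr// mul1r WE lerDl.
Qed.

Section bounds.
Local Open Scope nat_scope.

Lemma sum_seq_leq (I : Type) (s : seq I) (F : I -> nat) m k :
  size s <= m -> (forall i, F i <= k) -> \sum_(i <- s) F i <= m * k.
Proof.
move=> sm Fk; apply: (@leq_trans (\sum_(i <- s) k)); first exact: leq_sum.
rewrite -[k in X in X <= _]mul1n -big_distrl /= sum1_size.
by rewrite leq_mul2r sm orbT.
Qed.

Context (T : choiceType) (N : T -> {fset T}) (D : nat).
Hypothesis ND : forall x, #|` N x| <= D.

Lemma walks_bound o : [/\ triangle_walks N o <= D ^ 2, square_walks N o <= D ^ 3,
  cherry_walks N o <= D ^ 3, clique_walks N o <= D ^ 3
  & diamonds_out N o <= D ^ 3 /\ diamonds_in N o <= D ^ 3].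
Proof.
have s x : size (N x) <= D := ND x.
have b2 (F : T -> T -> bool) x y :
    \sum_(a <- N x) \sum_(b <- N y) F a b <= D ^ 2.
  rewrite -mulnn; apply: sum_seq_leq => // a.
  by rewrite -[D]muln1; apply: sum_seq_leq => // b; exact: leq_b1.
have b3 (F : T -> nat) x : (forall a, F a <= D ^ 2) -> \sum_(a <- N x) F a <= D ^ 3.
  by move=> FD; rewrite expnS; exact: sum_seq_leq.
split; last split; rewrite ?b2//; apply: b3 => a; rewrite ?b2//.
Qed.

Lemma diamonds_bound o a : diamonds N o a <= D ^ 2.
Proof.
rewrite -mulnn; apply: sum_seq_leq => [|c]; first exact: ND.
by rewrite -[D]muln1; apply: sum_seq_leq => [|b]; [exact: ND|exact: leq_b1].
Qed.

Lemma triangle_walks_le r o : #|` N o| = r -> (forall x, x \notin N x) ->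
  triangle_walks N o <= r * r.-1.
Proof.
move=> Nr Nirr.
rewrite -[X in X * _]Nr -[X in X * _]/(size (N o)) -sum1_size big_distrl /=.
rewrite /triangle_walks big_seq [leqRHS]big_seq; apply: leq_sum => a ao.
rewrite mul1n -Nr -(sum_neq ao); apply: leq_sum => b _.
by case: eqVneq => [->|_]; [rewrite (negbTE (Nirr _))|exact: leq_b1].
Qed.

End bounds.

Section random_to_polygon.
Context (R : realType) (D r : nat) (lambda : random_graph R D).

(** [Phi] has finitely many values and measurable fibres, so integrals of its functions are finite
    sums. A fibre of positive mass cannot lie inside the null set where [Reg] may fail, so its value
    is attained under [Reg]. *)
Lemma finite_law (V : finType) (Phi : rooted_graph D -> V)
    (Reg : rooted_graph D -> Prop) : ball_invariant 2 Phi ->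
  {ae lambda, forall x : borel_rooted R D, Reg (repr (x : rooted_space R D))} ->
  exists p : V -> R, [/\ forall v, 0 <= p v, \sum_v p v = 1,
    forall v, p v != 0 -> exists2 G, Reg G & Phi G = v &
    forall g : V -> R, (forall v, 0 <= g v) ->
      (\int[lambda]_x (g (Phi (repr (x : rooted_space R D))))%:E =
      (\sum_v p v * g v)%:E)%E].
Proof.
move=> inv [N [mN N0 subN]].
pose A v : set (borel_rooted R D) :=
  [set x | Phi (repr (x : rooted_space R D)) = v].
have mA v : measurable (A v) by exact: (measurable_invariant [set v] inv).
pose p v := fine (lambda (A v)).
have pE v : (p v)%:E = lambda (A v) by rewrite fineK// fin_num_measure.
have intE (g : V -> R) : (forall v, 0 <= g v) ->
    (\int[lambda]_x (g (Phi (repr (x : rooted_space R D))))%:E =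
    (\sum_v p v * g v)%:E)%E.
  move=> g0.
  under eq_integral => x _.
    rewrite (_ : g _ = \sum_v g v * \1_(A v) x); last first.
      rewrite (bigD1 (Phi (repr (x : rooted_space R D))))//= big1 => [|v vx].
        by rewrite addr0 indicE mem_set ?mulr1.
      by rewrite indicE memNset ?mulr0//= => /esym/eqP; rewrite (negbTE vx).
    rewrite -sumEFin; over.
  rewrite ge0_integral_sum//; first last.
  - by move=> v x _; rewrite lee_fin mulr_ge0.
  - by move=> v; apply/measurable_EFinP; apply: measurable_funM.
  rewrite -sumEFin; apply: eq_bigr => v _.
  under eq_integral do rewrite EFinM.
  rewrite ge0_integralZl//; first last.
  - by rewrite lee_fin.
  - by apply/measurable_EFinP.
  rewrite integral_indic// setIT [p v * _]mulrC EFinM; congr (_ * _)%E.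
  exact/esym/pE.
exists p; split=> //.
- by move=> v; exact/fine_ge0/measure_ge0.
- have := intE (fun=> 1) (fun=> ler01); rewrite integral_cst//.
  rewrite mul1e => /(etrans (esym (probability_setT lambda))).
  by under [X in _ = X%:E -> _]eq_bigr do rewrite mulr1; move=> [->].
move=> v pv; apply: contrapT => nv.
have AN : A v `<=` N.
  move=> x Ax; apply: subN => /= rx; apply: nv.
  by exists (repr (x : rooted_space R D)).
have : lambda (A v) = 0%E by exact: subset_measure0 AN N0.
by rewrite -pE => -[/eqP]; rewrite (negbTE pv).
Qed.

End random_to_polygon.

(** * Unimodularity applied to diamonds *)

Section unimodular_diamonds.
Context (R : realType) (D : nat).

Let root_walk (G : rooted_graph D) v (h : adj G (wg_root G) v) :
  edge_diamonds (add_edge h) = diamonds (neighbours (adj G)) (wg_root G) v /\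
  edge_diamonds (rev_edge (add_edge h)) =
    diamonds (neighbours (adj G)) v (wg_root G).
Proof. by []. Qed.

(** Unimodularity compares events, not means; these superlevel sets turn the number of diamonds at
    an edge into a sum of indicators. *)
Definition diamond_event (rv : bool) (j : nat) : set (edge_space R D) :=
  [set x | (j < edge_diamonds (if rv then rev_edge (repr x) else repr x))%N].

Lemma diamond_event_rev j :
  diamond_event true j = @space_rev R D @^-1` diamond_event false j.
Proof.
apply/seteqP; split=> x; rewrite /diamond_event /= /space_rev;
  by rewrite (ball_invariant_pi R _ (@ball_invariant_edge_diamonds D)).
Qed.

Lemma measurable_diamond_event rv j :
  <<s @open (edge_space R D) >> (diamond_event rv j).
Proof.
apply: sub_gen_smallest.
apply: (@open_invariant _ _ _ 1 [set G : edge_graph D |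
  (j < edge_diamonds (if rv then rev_edge G else G))%N]).
case: rv => G H GH.
  by have := ball_invariant_rev_edge_diamonds GH; rewrite /= => ->.
by have := ball_invariant_edge_diamonds GH; rewrite /= => ->.
Qed.

Lemma neighbour_probE rv j (G : rooted_graph D) :
  neighbour_prob (diamond_event rv j) G =
  (sum_diamonds rv (fun n => (j < n)%N) G)%:R /
    #|` neighbours (adj G) (wg_root G)|%:R.
Proof.
pose dd v := if rv then diamonds (neighbours (adj G)) v (wg_root G)
  else diamonds (neighbours (adj G)) (wg_root G) v.
rewrite /neighbour_prob; congr (_%:R / _).
rewrite /sum_diamonds (sum_bool_seq _ (fun v => j < dd v)%N) -size_filter.
rewrite (card_fset_set_seq (s := [seq v <- neighbours (adj G) (wg_root G) | (j < dd v)%N])).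
  by rewrite undup_id// filter_uniq// fset_uniq.
have evE v (h : adj G (wg_root G) v) :
    diamond_event rv j (\pi_(edge_space R D) (add_edge h)) = (j < dd v)%N :> Prop.
  have [d1 d2] := root_walk h.
  rewrite /diamond_event /dd /=; case: (rv).
    by rewrite (ball_invariant_pi R _ (@ball_invariant_rev_edge_diamonds D)) d2.
  by rewrite (ball_invariant_pi R _ (@ball_invariant_edge_diamonds D)) d1.
move=> v; rewrite mem_filter in_neighboursG andbC; split=> [[h]|/andP[h]].
  by rewrite evE => ->; rewrite h.
by rewrite -(evE v h) => ev; exists h.
Qed.

(** A count [d <= D ^ 2] is the number of [j < D ^ 2] with [j < d]. *)
Lemma sum_neighbour_prob rv (G : rooted_graph D) :
  \sum_(j < D ^ 2) neighbour_prob (diamond_event rv j) G =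
  (sum_diamonds rv id G)%:R / #|` neighbours (adj G) (wg_root G)|%:R.
Proof.
under eq_bigr do rewrite neighbour_probE.
rewrite -mulr_suml -natr_sum; congr (_%:R / _).
rewrite exchange_big /=; apply: eq_bigr => v _; set d := if _ then _ else _.
have dD : (d <= D ^ 2)%N.
  by rewrite /d; case: (rv); apply: diamonds_bound => ?; exact: card_neighboursG_le.
rewrite -(big_mkord xpredT (fun j => nat_of_bool (j < d)%N)) /=.
rewrite (@big_cat_nat _ _ _ d) //= big_nat (eq_bigr (fun=> 1%N)) => [|j /andP[_ ->]//].
rewrite -big_nat sum_nat_const_nat subn0 muln1 big_nat big1 ?addn0// => j /andP[dj _].
by rewrite ltnNge dj.
Qed.

Context (lambda : random_graph R D).
Hypothesis uni : unimodular lambda.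

Lemma unimodular_diamonds :
  (\int[lambda]_x ((sum_diamonds false id (repr (x : rooted_space R D)))%:R /
     #|` neighbours (adj (repr (x : rooted_space R D)))
         (wg_root (repr (x : rooted_space R D)))|%:R)%:E =
   \int[lambda]_x ((sum_diamonds true id (repr (x : rooted_space R D)))%:R /
     #|` neighbours (adj (repr (x : rooted_space R D)))
         (wg_root (repr (x : rooted_space R D)))|%:R)%:E)%E.
Proof.
have intE rv : (\int[lambda]_x ((sum_diamonds rv id (repr (x : rooted_space R D)))%:R /
     #|` neighbours (adj (repr (x : rooted_space R D)))
         (wg_root (repr (x : rooted_space R D)))|%:R)%:E =
    \sum_(j < D ^ 2) edge_law lambda (diamond_event rv j))%E.
  under eq_integral => x _ do rewrite -sum_neighbour_prob -sumEFin.
  rewrite ge0_integral_sum//.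
    move=> j; apply/measurable_EFinP.
    apply: (@measurable_fun_invariant _ _ 2 (neighbour_prob (diamond_event rv j))).
    move=> G H GH; rewrite !neighbour_probE (ball_invariant_sum_diamonds _ _ GH).
    by rewrite (ball_invariant_degree GH).
  move=> j x _; rewrite lee_fin; exact: divr_ge0.
rewrite !intE; apply: eq_bigr => j _.
rewrite diamond_event_rev; apply: uni; exact: measurable_diamond_event.
Qed.

End unimodular_diamonds.
Section random_to_polygon.
Context (R : realType) (D r : nat) (lambda : random_graph R D).
Hypotheses (r3 : (3 <= r)%N) (reg : random_regular r lambda).
Hypothesis uni : unimodular lambda.

Let r0 : (0 < r)%N. Proof. exact: leq_trans r3. Qed.

Definition root_stats (G : rooted_graph D) : seq nat :=
  let N := neighbours (adj G) in let u := wg_root G in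
  [:: #|` N u|; triangle_walks N u; square_walks N u; cherry_walks N u;
      clique_walks N u; diamonds_out N u; diamonds_in N u].

(** A common bound for the seven statistics, so that [inord] truncates nothing. *)
Let B := (D ^ 3 + D ^ 2 + D)%N.

Let Phi (G : rooted_graph D) : {ffun 'I_7 -> 'I_B.+1} :=
  [ffun i : 'I_7 => inord (nth 0%N (root_stats G) i)].

Let PhiE G (i : 'I_7) : Phi G i = nth 0%N (root_stats G) i :> nat.
Proof.
rewrite ffunE inordK// ltnS /B /root_stats.
have ND := card_neighboursG_le G.
have [t s c k [d1 d2]] := walks_bound ND (wg_root G).
have := ND (wg_root G).
case: i => -[|[|[|[|[|[|[|i]]]]]]]//= _; lia.
Qed.

Let Phi_inv : ball_invariant 2 Phi.
Proof.
move=> G H GH; rewrite /Phi; apply/ffunP => i; rewrite !ffunE; congr (inord (nth _ _ _)).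
have dout : diamonds_out (neighbours (adj G)) (wg_root G) =
    diamonds_out (neighbours (adj H)) (wg_root H).
  exact: (ball_invariant_sum_diamonds false id GH).
have din : diamonds_in (neighbours (adj G)) (wg_root G) =
    diamonds_in (neighbours (adj H)) (wg_root H).
  exact: (ball_invariant_sum_diamonds true id GH).
rewrite /root_stats dout din (ball_invariant_degree GH).
rewrite (ball_invariant_triangles GH) (ball_invariant_squares GH).
by rewrite (ball_invariant_cherries GH) (ball_invariant_cliques GH).
Qed.

Lemma random_densities_polygon : density_polygon R r
  (random_cycle_density 3 lambda, random_cycle_density 4 lambda).
Proof.
have [p [p0 p1 psupp intE]] := finite_law Phi_inv reg.
pose st (v : {ffun 'I_7 -> 'I_B.+1}) (i : nat) : R := (v (inord i) : nat)%:R.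
have stE G i : (i < 7)%N -> st (Phi G) i = (nth 0%N (root_stats G) i)%:R.
  by move=> i7; rewrite /st PhiE inordK.
have st0 v i : 0 <= st v i by exact: ler0n.
(* Means of the entries of [root_stats]: [E 1] to [E 4] are those of [T], [S], [C], [K], while [E 5]
   and [E 6] count diamonds with the root at the non-edge and at the chord. *)
pose E i := \sum_v p v * st v i.
have cycleE k i : (0 < k)%N -> (i < 7)%N ->
    (forall G : rooted_graph D,
      nth 0%N (root_stats G) i = (num_cycles_at (adj G) k (wg_root G)).*2) ->
    random_cycle_density k lambda = E i / (k.*2)%:R.
  move=> k0 i7 iE; rewrite /random_cycle_density /Rintegral.
  have -> : (\int[lambda]_x ((num_cycles_at (adj (repr (x : rooted_space R D))) k
      (wg_root (repr (x : rooted_space R D))))%:R)%:E)%E =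
      (\int[lambda]_x (st (Phi (repr (x : rooted_space R D))) i / 2%:R)%:E)%E.
    by apply: eq_integral => x _; rewrite stE// iE -mul2n natrM mulrC mulKf.
  rewrite (intE (fun v => st v i / 2%:R)) => [|v]; last exact: divr_ge0.
  rewrite /= -mul2n natrM invfM mulrA mulrC; congr (_ * _).
  by rewrite mulr_suml; apply: eq_bigr => v _; rewrite mulrA.
rewrite (cycleE 3 1%N) => [|//|//|G]; last first.
  by apply: num_cycles_at3; [exact: adj_sym|exact: adj_irr|exact: in_neighboursG].
rewrite (cycleE 4 2%N) => [|//|//|G]; last first.
  by apply: num_cycles_at4; [exact: adj_sym|exact: adj_irr|exact: in_neighboursG].
have supp v : p v != 0 -> exists2 G : rooted_graph D,
    (forall x, vertices G x -> #|` neighbours (adj G) x| = r) &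
    forall i, (i < 7)%N -> st v i = (nth 0%N (root_stats G) i)%:R.
  move=> /psupp[G regG <-]; exists G; last by move=> i; exact: stE.
  by move=> x Gx; apply/card_adj/regG.
have E_le (f g : {ffun 'I_7 -> 'I_B.+1} -> R) :
    (forall v, p v != 0 -> f v <= g v) -> \sum_v p v * f v <= \sum_v p v * g v.
  move=> fg; apply: ler_sum => v _; have [->|/fg fv] := eqVneq (p v) 0.
    by rewrite !mul0r.
  exact: ler_wpM2l.
have sumD (f g : {ffun 'I_7 -> 'I_B.+1} -> R) a b :
    \sum_v p v * (a * f v + b * g v) = a * \sum_v p v * f v + b * \sum_v p v * g v.
  rewrite !mulr_sumr -big_split; apply: eq_bigr => v _ /=; lra.
(* The law of a random edge divides the counts by the degree, which is [r] on every value of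
   positive mass and cancels. *)
have Eout : E 5%N = E 6%N.
  have := unimodular_diamonds uni.
  have -> : (\int[lambda]_x ((sum_diamonds false id (repr (x : rooted_space R D)))%:R /
     #|` neighbours (adj (repr (x : rooted_space R D)))
         (wg_root (repr (x : rooted_space R D)))|%:R)%:E)%E =
     (\int[lambda]_x (st (Phi (repr (x : rooted_space R D))) 5 /
       st (Phi (repr (x : rooted_space R D))) 0)%:E)%E.
    by apply: eq_integral => x _; rewrite !stE.
  have -> : (\int[lambda]_x ((sum_diamonds true id (repr (x : rooted_space R D)))%:R /
     #|` neighbours (adj (repr (x : rooted_space R D)))
         (wg_root (repr (x : rooted_space R D)))|%:R)%:E)%E =
     (\int[lambda]_x (st (Phi (repr (x : rooted_space R D))) 6 /
       st (Phi (repr (x : rooted_space R D))) 0)%:E)%E.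
    by apply: eq_integral => x _; rewrite !stE.
  rewrite (intE (fun v => st v 5 / st v 0)) => [|v]; last exact: divr_ge0.
  rewrite (intE (fun v => st v 6 / st v 0)) => [|v]; last exact: divr_ge0.
  have degE i : \sum_v p v * (st v i / st v 0) = E i / r%:R.
    rewrite /E mulr_suml; apply: eq_bigr => v _; rewrite -mulrA.
    have [->|/supp[G regG stG]] := eqVneq (p v) 0; first by rewrite !mul0r.
    by rewrite (stG 0%N)//= regG//; apply: walk_vertices; rewrite /wg_root /thead mem_tnth.
  rewrite !degE => -[] /mulIf; apply; rewrite invr_eq0 pnatr_eq0; lia.
pose Q x y := density_polygon R r (x, y).
have cQ : convex2 Q := @convex_density_polygon R r.
have Qbal l : (0 < l <= r)%N ->
    Q (\sum_(1 <= i < l.+1) clique_x R (part_size r l i))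
      (\sum_(1 <= i < l.+1) clique_y R (part_size r l i)).
  move=> /andP[l0 lr]; rewrite /Q -extreme_pointE//.
  exact: density_polygon_extreme.
have root_vertex (G : rooted_graph D) : vertices G (wg_root G).
  by apply: walk_vertices; rewrite /wg_root /thead mem_tnth.
pose y1 : R := (3%:R * E 3%N - E 4%N) / 16%:R.
have Q1 : Q (E 1%N / 6%:R) y1.
  have := @convex2_sum R Q _ p (fun v => st v 1 / 6%:R)
    (fun v => (3%:R * st v 3 - st v 4) / 16%:R) cQ p0 p1.
  have -> : \sum_i p i * (st i 1 / 6%:R) = E 1%N / 6%:R.
    by rewrite mulr_suml; apply: eq_bigr => v _; rewrite mulrA.
  have -> : \sum_i p i * ((3%:R * st i 3 - st i 4) / 16%:R) = y1.
    rewrite /y1 /E mulr_sumr -sumrB mulr_suml; apply: eq_bigr => v _; lra.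
  apply => v /supp[G regG stG]; rewrite !stG//.
  exact: (link_hull (@neighboursG_sym D G) (@neighboursG_irr D G) cQ r0 Qbal
    (regG _ (root_vertex G))).
have E_r : E 1%N <= (r * r.-1)%:R.
  have -> : (r * r.-1)%:R = \sum_v p v * (r * r.-1)%:R :> R.
    by rewrite -mulr_suml p1 mul1r.
  apply: E_le => v /supp[G regG stG]; rewrite stG// ler_nat.
  apply: triangle_walks_le; first exact: regG.
  exact: neighboursG_irr.
have E1_ge0 : 0 <= E 1%N by apply: sumr_ge0 => v _; exact: mulr_ge0.
have r1 : (r.-1%:R : R) = r%:R - 1 by rewrite -[in RHS](prednK r0) -natr1 addrK.
(* [y2] is the height over [E 1 / 6] of the segment from [P_0] to [P_1]; the end [P_1] corresponds
   to [T = r (r - 1)], which explains the denominator of [t]. *)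
pose y2 : R := (r%:R * (r%:R - 1) ^+ 2 - E 1%N) / 8%:R.
have Q2 : Q (E 1%N / 6%:R) y2.
  have r1_gt0 : 0 < r%:R * (r%:R - 1) :> R.
    by rewrite -r1 -natrM ltr0n muln_gt0; lia.
  pose t := E 1%N / (r%:R * (r%:R - 1)).
  have tE : t * (r%:R * (r%:R - 1)) = E 1%N by rewrite divfK// gt_eqF.
  have t0 : 0 <= t by rewrite divr_ge0// ltW.
  have t1 : t <= 1 by rewrite ler_pdivrMr// mul1r -r1 -natrM.
  have := Qbal 1%N r0; rewrite !big_nat1 /part_size addnK divn1 => QP1.
  have QP0 : Q 0 (r%:R * (r%:R - 1) ^+ 2 / 8%:R).
    have := @density_polygon_extreme R r 0 (leq0n r).
    by rewrite /extreme_point natrM natrX natrB.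
  have := cQ _ _ _ _ _ t0 t1 QP1 QP0.
  rewrite /clique_x /clique_y /y2; congr Q; lra.
have E_sum : E 6%N + E 4%N = E 3%N.
  rewrite -big_split; apply: eq_bigr => v _; rewrite /= -mulrDr.
  have [->|/supp[G _ stG]] := eqVneq (p v) 0; first by rewrite !mul0r.
  rewrite !stG// -natrD; congr (_ * _%:R).
  exact: (diamonds_inE (@neighboursG_irr D G)).
have E6_ge0 : 0 <= E 6%N by apply: sumr_ge0 => v _; exact: mulr_ge0.
have E2_ge : E 3%N + E 5%N <= E 2%N.
  rewrite -[E 3%N]mul1r -[E 5%N]mul1r -sumD; apply: E_le => v /supp[G _ stG].
  rewrite !mul1r !stG// -natrD ler_nat.
  exact: (square_walks_ge (@neighboursG_sym D G) (@neighboursG_irr D G)).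
have E2_le : E 2%N + E 1%N <= r%:R * (r%:R - 1) ^+ 2.
  have -> : r%:R * (r%:R - 1) ^+ 2 = \sum_v p v * (r * r.-1 ^ 2)%:R :> R.
    by rewrite -mulr_suml p1 mul1r natrM natrX r1.
  rewrite -[E 2%N]mul1r -[E 1%N]mul1r -sumD; apply: E_le => v /supp[G regG stG].
  rewrite !mul1r !stG// -natrD ler_nat /=.
  apply: (@square_walks_le _ _ _ _ (vertices G)) => //.
  - exact: neighboursG_sym.
  - exact: neighboursG_irr.
  - move=> x z _; rewrite in_neighboursG adj_sym; exact: adj_vertices.
pose y := E 2%N / 8%:R.
have [y1y yy2] : y1 <= y /\ y <= y2 by rewrite /y1 /y /y2; lra.
change (Q (E 1%N / 6%:R) y).
(* The point lies on a vertical segment between two points of the polygon; a degenerate segment,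
   where [t] would divide by zero, is treated apart. *)
have [y12|y21] := ltP y1 y2; last first.
  have -> : y = y1 by apply/eqP; rewrite eq_le y1y (le_trans yy2).
  exact: Q1.
pose t := (y2 - y) / (y2 - y1).
have tE : t * (y2 - y1) = y2 - y by rewrite divfK// subr_eq0 gt_eqF.
have t0 : 0 <= t by rewrite divr_ge0 ?subr_ge0// ltW.
have t1 : t <= 1 by rewrite ler_pdivrMr ?subr_gt0// mul1r lerB.
have := cQ _ _ _ _ _ t0 t1 Q1 Q2.
by congr Q; lra.
Qed.

End random_to_polygon.

(** * The points of the polygon are attained *)

Section attained.
Context (R : realType) (r : nat).

Lemma exists_extreme_graph l : (l <= r)%N -> (0 < r)%N ->
  exists (T : finType) (e : rel T), [/\ (0 < #|T|)%N, symmetric e, irreflexive e,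
    forall x, #|e x| = r &
    forall o, (triangle_walks (neighbours e) o)%:R / 6%:R = (extreme_point R r l).1 /\
      (square_walks (neighbours e) o)%:R / 8%:R = (extreme_point R r l).2].
Proof.
move=> lr r0; case: (posnP l) => [->|l0].
  exists (bool * 'I_r)%type, (@bipartite_rel r); split.
  - by rewrite card_prod card_bool card_ord muln_gt0.
  - by move=> x y; rewrite /bipartite_rel eq_sym.
  - by move=> x; rewrite /bipartite_rel eqxx.
  - exact: card_bipartite_rel.
  - move=> u; rewrite bipartite_triangles bipartite_squares /= mul0r.
    by rewrite subn1.
(* One more than the part, since a vertex is not its own neighbour in a clique. *)
pose n (i : 'I_l) := (part_size r l i.+1).+1.
have sum_ord (V : nmodType) (g : nat -> V) :
    \sum_(i < l) g (part_size r l i.+1) = \sum_(1 <= i < l.+1) g (part_size r l i).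
  by rewrite big_add1 /= big_mkord.
have [T [e [T0 es ei er ew]]] := @exists_clique_graph l n (fun=> ltn0Sn _).
exists T, e; split=> //.
  move=> x; rewrite er; under eq_bigr do rewrite subn1 /=.
  rewrite (sum_ord nat id).
  have {1 2}-> : r = (l * (r %/ l) + r %% l)%N by rewrite mulnC -divn_eq.
  rewrite (sum_part_size id) ?ltn_mod//.
  have natmulE (a b : nat) : a *+ b = (b * a)%N.
    by elim: b => // b IH; rewrite mulrS IH mulSn.
  rewrite !natmulE mulnBl mulnS.
  have : (r %% l * (r %/ l) <= l * (r %/ l))%N by rewrite leq_mul2r ltnW ?orbT// ltn_mod.
  lia.
move=> u; have [-> ->] := ew u; rewrite extreme_pointE// !natr_sum !mulr_suml /=.
rewrite -!sum_ord; split; apply: eq_bigr => i _; rewrite /n /clique_x /clique_y.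
  rewrite subn1 subSS /= natrM; congr (_ / _); case: (part_size _ _ _) => [|a].
    by rewrite !mul0r.
  by rewrite subn1 /= -(natr1 a) addrK.
rewrite subn1 !subSS /= !natrM; congr (_ / _); case: (part_size _ _ _) => [|[|a]].
- by rewrite !mul0r.
- by rewrite /= !subn1 /= subrr !(mulr0, mul0r).
- rewrite subn1 subn2 /= -(natr1 a.+1) -(natr1 a); lra.
Qed.

(* The weights are constant on the connected components, so the component of a
   vertex drawn with probability w is a unimodular random graph. *)
Definition weighted_densities (x y : R) : Prop :=
  exists (T : finType) (e : rel T) (w : T -> R),
    [/\ [/\ symmetric e, irreflexive e & forall x, #|e x| = r],
     forall x, 0 <= w x, \sum_x w x = 1, forall x y, e x y -> w x = w y &
     x = (\sum_x w x * (triangle_walks (neighbours e) x)%:R) / 6%:R /\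
     y = (\sum_x w x * (square_walks (neighbours e) x)%:R) / 8%:R].

(** Disjoint union, with the weights scaled by [t] and [1 - t]: no edge joins the two sides, so
    weights stay constant along edges. *)
Lemma convex_weighted_densities : convex2 weighted_densities.
Proof.
move=> t x y x' y' t0 t1.
move=> [T1 [e1 [w1 [[s1 i1 r1] w10 w11 w1e [-> ->]]]]].
move=> [T2 [e2 [w2 [[s2 i2 r2] w20 w21 w2e [-> ->]]]]].
pose w (x : T1 + T2) := match x with inl x => t * w1 x | inr x => (1 - t) * w2 x end.
exists (T1 + T2)%type, (sum_rel e1 e2), w; split.
- split; [exact: sum_rel_sym|exact: sum_rel_irr|].
  by move=> [z|z]; [have [-> _ _] := sum_rel_inl e1 e2 z|have [-> _ _] := sum_rel_inr e1 e2 z].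
- by move=> [z|z] /=; rewrite mulr_ge0// subr_ge0.
- by rewrite big_sumType /= -!mulr_sumr w11 w21 !mulr1 addrC subrK.
- by move=> [z|z] [z'|z'] //= zz'; rewrite ?(w1e _ _ zz') ?(w2e _ _ zz').
have sumE (f : T1 + T2 -> nat) f1 f2 (c : R) :
    (forall z, f (inl z) = f1 z) -> (forall z, f (inr z) = f2 z) ->
    t * ((\sum_z w1 z * (f1 z)%:R) / c) + (1 - t) * ((\sum_z w2 z * (f2 z)%:R) / c) =
    (\sum_z w z * (f z)%:R) / c.
  move=> f1E f2E; rewrite big_sumType /= [RHS]mulrDl !mulrA !mulr_sumr.
  by congr (_ * _ + _ * _); apply: eq_bigr => z _; rewrite ?f1E ?f2E mulrA.
split; apply: sumE => z; [have [_ -> _] := sum_rel_inl e1 e2 z|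
  have [_ -> _] := sum_rel_inr e1 e2 z|have [_ _ ->] := sum_rel_inl e1 e2 z|
  have [_ _ ->] := sum_rel_inr e1 e2 z]; by [].
Qed.

Lemma weighted_densities_uniform (T : finType) (e : rel T) :
  (0 < #|T|)%N -> symmetric e -> irreflexive e -> (forall x, #|e x| = r) ->
  weighted_densities
    ((\sum_x (triangle_walks (neighbours e) x)%:R) / 6%:R / #|T|%:R)
    ((\sum_x (square_walks (neighbours e) x)%:R) / 8%:R / #|T|%:R).
Proof.
move=> T0 es ei er; exists T, e, (fun=> #|T|%:R^-1); split=> //.
  by rewrite sumr_const -[X in X = _]mulr_natl divff// pnatr_eq0 -lt0n.
by split; rewrite -mulr_sumr [LHS]mulrC mulrA.
Qed.

Lemma density_polygon_weighted p : density_polygon R r p -> (0 < r)%N ->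
  weighted_densities p.1 p.2.
Proof.
move=> pQ r0.
apply: (pQ [set q | weighted_densities q.1 q.2]); split.
  by apply/convex_set2 => t x y x' y'; exact: convex_weighted_densities.
move=> _ [l /= lr <-].
have [T [e [T0 es ei er ew]]] := exists_extreme_graph lr r0.
have := weighted_densities_uniform T0 es ei er.
have TR0 : #|T|%:R != 0 :> R by rewrite pnatr_eq0 -lt0n.
congr weighted_densities; rewrite mulr_suml;
  rewrite (eq_bigr _ (fun x _ => (ew x).1)) || rewrite (eq_bigr _ (fun x _ => (ew x).2));
  by rewrite sumr_const -[X in X / _]mulr_natl mulrC mulKf.
Qed.

End attained.

Lemma near_convex (R : realDomainType) (e t s z c z' c' : R) : 0 <= t -> t <= 1 ->
  `|z - c| < e -> `|z' - c'| < e -> `|t - s| * `|c - c'| < e ->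
  `|t * z + (1 - t) * z' - (s * c + (1 - s) * c')| < e + e.
Proof.
move=> t0 t1 zc zc' cc.
have -> : t * z + (1 - t) * z' - (s * c + (1 - s) * c') =
    (t * (z - c) + (1 - t) * (z' - c')) + (t - s) * (c - c') by lra.
apply: (le_lt_trans (ler_normD _ _)); apply: ltr_leD; last by rewrite normrM ltW.
apply: (le_lt_trans (ler_normD _ _)).
rewrite !normrM (ger0_norm t0) (@ger0_norm _ (1 - t)) ?subr_ge0//.
(* Bounding both errors by their maximum keeps the inequality strict when [t] is 0 or 1. *)
apply: (@le_lt_trans _ _ (t * Num.max `|z - c| `|z' - c'| +
                          (1 - t) * Num.max `|z - c| `|z' - c'|)).
  by apply: lerD; apply: ler_wpM2l; rewrite ?subr_ge0// le_max lexx ?orbT.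
by rewrite -mulrDl addrC subrK mul1r gt_max zc.
Qed.

(** * Closure of the finite densities *)

Section finite_closure.
Context (R : realType) (r : nat).

(** Totals, unlike densities, add up under disjoint union; [n = 0] is allowed, so that zero copies
    of a graph make sense. *)
Definition total_walks (n s3 s4 : nat) : Prop :=
  exists (T : finType) (e : rel T), [/\ #|T| = n, symmetric e, irreflexive e,
    forall x, #|e x| = r &
    (\sum_x triangle_walks (neighbours e) x)%N = s3 /\
    (\sum_x square_walks (neighbours e) x)%N = s4].

Lemma finite_densitiesP (p : R^o * R^o) : finite_densities R r p <->
  exists n s3 s4, [/\ (0 < n)%N, total_walks n s3 s4 &
    p = (s3%:R / 6%:R / n%:R, s4%:R / 8%:R / n%:R)].
Proof.
have densE (T : finType) (e : rel T) : symmetric e -> irreflexive e ->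
    (cycle_density R e 3, cycle_density R e 4) =
    ((\sum_x triangle_walks (neighbours e) x)%:R / 6%:R / #|T|%:R,
     (\sum_x square_walks (neighbours e) x)%:R / 8%:R / #|T|%:R).
  move=> es ei; rewrite -(num_cycles3E es ei) -(num_cycles4E es ei) !natrM.
  by rewrite ![_%:R * (num_cycles _ _)%:R]mulrC !mulfK ?pnatr_eq0.
split=> [[T [e [T0 es ei er ->]]]|[n [s3 [s4 [n0 [T [e [Tn es ei er [s3E s4E]]]] ->]]]]].
  exists #|T|, (\sum_x triangle_walks (neighbours e) x)%N,
    (\sum_x square_walks (neighbours e) x)%N.
  by split; [exact: T0|exists T, e|exact: densE].
by exists T, e; split; rewrite ?Tn// densE// s3E s4E Tn.
Qed.

Lemma total_walksD n s3 s4 n' s3' s4' : total_walks n s3 s4 ->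
  total_walks n' s3' s4' -> total_walks (n + n') (s3 + s3') (s4 + s4').
Proof.
move=> [T1 [e1 [<- s1 i1 r1 [<- <-]]]] [T2 [e2 [<- s2 i2 r2 [<- <-]]]].
exists (T1 + T2)%type, (sum_rel e1 e2); split.
- exact: card_sum.
- exact: sum_rel_sym.
- exact: sum_rel_irr.
- by move=> [z|z]; [have [-> _ _] := sum_rel_inl e1 e2 z|have [-> _ _] := sum_rel_inr e1 e2 z].
split; rewrite big_sumType; congr addn; apply: eq_bigr => z _;
  by [have [_ -> _] := sum_rel_inl e1 e2 z|have [_ -> _] := sum_rel_inr e1 e2 z|
      have [_ _ ->] := sum_rel_inl e1 e2 z|have [_ _ ->] := sum_rel_inr e1 e2 z].
Qed.

Lemma total_walksM k n s3 s4 : total_walks n s3 s4 ->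
  total_walks (k * n) (k * s3) (k * s4).
Proof.
move=> nss; elim: k => [|k IH]; last by rewrite !mulSn; exact: total_walksD.
exists void, (fun _ _ => false); split=> //; first exact: card_void.
by split; rewrite big1// => -[].
Qed.

Lemma finite_densities_rational k m (x y x' y' : R) : (0 < m)%N -> (k <= m)%N ->
  let s := k%:R / m%:R in
  finite_densities R r (x, y) -> finite_densities R r (x', y') ->
  finite_densities R r (s * x + (1 - s) * x', s * y + (1 - s) * y').
Proof.
move=> m0 km s /finite_densitiesP[n [s3 [s4 [n0 tw [-> ->]]]]].
move=> /finite_densitiesP[n' [s3' [s4' [n0' tw' [-> ->]]]]].
apply/finite_densitiesP.
(* [k n'] copies of the first graph and [(m - k) n] of the second have [k n n'] and [(m - k) n n']
   vertices, hence shares [k / m] and [1 - k / m]. *)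
exists (k * n' * n + (m - k) * n * n')%N, (k * n' * s3 + (m - k) * n * s3')%N,
  (k * n' * s4 + (m - k) * n * s4')%N; split.
- by rewrite addn_gt0 !muln_gt0 n0 n0' !andbT -addn_gt0 subnKC.
- by apply: total_walksD; exact: total_walksM.
have nR : n%:R != 0 :> R by rewrite pnatr_eq0 -lt0n.
have n'R : n'%:R != 0 :> R by rewrite pnatr_eq0 -lt0n.
have mR : m%:R != 0 :> R by rewrite pnatr_eq0 -lt0n.
have sE (z z' : R) : s * z + (1 - s) * z' = (k%:R * z + (m - k)%:R * z') / m%:R.
  have -> : 1 - s = (m - k)%:R / m%:R by rewrite natrB// mulrBl divff.
  by rewrite mulrDl !(mulrAC _ _ m%:R^-1).
have main (t t' : nat) (c : R) : c != 0 ->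
    s * (t%:R / c / n%:R) + (1 - s) * (t'%:R / c / n'%:R) =
    (k * n' * t + (m - k) * n * t')%:R / c / (k * n' * n + (m - k) * n * n')%:R.
  move=> c0; rewrite sE; set N := n%:R * n'%:R : R.
  have -> : (k * n' * n + (m - k) * n * n')%:R = m%:R * N.
    by rewrite natrD !natrM natrB// /N; lra.
  have N0 : N != 0 by rewrite mulf_neq0.
  set a := t%:R / c / n%:R; set a' := t'%:R / c / n'%:R.
  have aE : t%:R = a * n%:R * c by rewrite /a !divfK.
  have a'E : t'%:R = a' * n'%:R * c by rewrite /a' !divfK.
  have -> : (k * n' * t + (m - k) * n * t')%:R = (k%:R * a + (m - k)%:R * a') * N * c.
    by rewrite natrD !natrM aE a'E /N; lra.
  by rewrite mulfK// invfM mulrACA divff// mulr1.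
by congr pair; apply: main; rewrite pnatr_eq0.
Qed.

Lemma closure2P (A : set (R^o * R^o)) x y : closure A (x, y) <->
  forall e : R, 0 < e -> exists x' y', [/\ A (x', y'), `|x - x'| < e & `|y - y'| < e].
Proof.
split=> [cA e e0|cA B /nbhs_ballP[e /= e0 eB]].
  have : nbhs ((x, y) : R^o * R^o) (ball ((x, y) : R^o * R^o) e) by exact: nbhsx_ballx.
  by move=> /cA[[x' y'] [Axy [/= bx by_]]]; exists x', y'.
have [x' [y' [Axy xx yy]]] := cA e e0.
by exists (x', y'); split=> //; apply: eB.
Qed.

Lemma convex_closure_finite :
  convex2 (fun x y => closure (finite_densities R r) (x, y)).
Proof.
move=> t x y x' y' t0 t1 /closure2P cxy /closure2P cxy'; apply/closure2P => e e0.
have e2 : 0 < e / 2%:R by rewrite divr_gt0.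
have [a [b [Aab xa yb]]] := cxy _ e2.
have [a' [b' [Aab' xa' yb']]] := cxy' _ e2.
(* [k] will be the integer part of [t m], so that [t] and [k / m] differ by less than [1 / m]; [m]
   is chosen with [M / m < e / 2]. *)
pose M := `|a - a'| + `|b - b'|.
have M0 : 0 <= M by rewrite addr_ge0.
pose m := (Num.truncn (M / (e / 2%:R))).+1.
have mM : M < e / 2%:R * m%:R.
  by rewrite mulrC -ltr_pdivrMr// truncnS_gt.
have m0 : 0 < m%:R :> R by rewrite ltr0n.
pose k := Num.truncn (t * m%:R).
have tm0 : 0 <= t * m%:R by rewrite mulr_ge0// ltW.
have kt : k%:R <= t * m%:R by rewrite truncn_le.
have tk : t * m%:R < k%:R + 1 by rewrite natr1 truncnS_gt.
have km : (k <= m)%N.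
  rewrite -(ler_nat R); apply: (le_trans kt).
  by rewrite -[leRHS]mul1r ler_wpM2r// ltW.
have sM : `|t - k%:R / m%:R| * M < e / 2%:R.
  have : 0 <= t - k%:R / m%:R by rewrite subr_ge0 ler_pdivrMr.
  have : t - k%:R / m%:R < m%:R^-1.
    by rewrite ltrBlDr -[X in X + _]mul1r -mulrDl addrC ltr_pdivlMr.
  move=> s1 s0; rewrite ger0_norm//.
  apply: (le_lt_trans (ler_wpM2r M0 (ltW s1))).
  by rewrite mulrC ltr_pdivrMr.
have := finite_densities_rational (ltn0Sn _) km Aab Aab'.
pose s : R := k%:R / m%:R.
exists (s * a + (1 - s) * a'), (s * b + (1 - s) * b'); split.
- exact: finite_densities_rational.
- rewrite [e]splitr; apply: near_convex => //; apply: le_lt_trans sM.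
  by rewrite ler_wpM2l// lerDl.
- rewrite [e]splitr; apply: near_convex => //; apply: le_lt_trans sM.
  by rewrite ler_wpM2l// lerDr.
Qed.

End finite_closure.

(** * Compactness of the polygon *)

Section closed_polygon.
Context (R : realType).

(** The convex hull as an iterated cone with apexes [P 1], ..., [P n]. Each stage is a continuous
    image of [[0, 1]] times a compact set, which exhibits a compactness that the smallest convex set
    hides. *)
Fixpoint cone_hull (P : nat -> R^o * R^o) (n : nat) : set (R^o * R^o) :=
  if n is n.+1 then
    [set (z.1 * (P n.+1).1 + (1 - z.1) * z.2.1, z.1 * (P n.+1).2 + (1 - z.1) * z.2.2) |
      z in `[0, 1]%classic `*` cone_hull P n]
  else [set P 0%N].

Lemma compact_cone_hull P n : compact (cone_hull P n).
Proof.
elim: n => [|n IH] /=; first exact: compact_set1.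
apply: continuous_compact; last by apply: compact_setX => //; exact: segment_compact.
apply: continuous_subspaceT => z.
have c1 : (fun z : R^o * (R^o * R^o) => z.1) x @[x --> z] --> z.1 by exact: cvg_fst.
have c2 : (fun z : R^o * (R^o * R^o) => z.2) x @[x --> z] --> z.2 by exact: cvg_snd.
have c21 : (fun z : R^o * (R^o * R^o) => z.2.1) x @[x --> z] --> z.2.1.
  by apply: cvg_comp c2 _; exact: cvg_fst.
have c22 : (fun z : R^o * (R^o * R^o) => z.2.2) x @[x --> z] --> z.2.2.
  by apply: cvg_comp c2 _; exact: cvg_snd.
have main (c : R^o) (h : R^o * (R^o * R^o) -> R^o) : h x @[x --> z] --> h z ->
    x.1 * c + (1 - x.1) * h x @[x --> z] --> z.1 * c + (1 - z.1) * h z.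
  move=> hz; apply: cvgD; apply: cvgM => //; first exact: cvg_cst.
  by apply: cvgB => //; exact: cvg_cst.
exact: (cvg_pair (main _ _ c21) (main _ _ c22)).
Qed.

Lemma cone_hull_convex P n : convex2 (fun x y => cone_hull P n (x, y)).
Proof.
elim: n => [|n IH] t x y x' y' t0 t1 /=.
  move=> <- [-> ->]; congr pair; lra.
move=> [[s [a b]] /= [+ Kab] [<- <-]] [[s' [a' b']] /= [+ Kab'] [<- <-]].
rewrite !in_itv /= => /andP[s0 s1] /andP[s'0 s'1].
(* [u] is the weight that the combination leaves to the base [cone_hull P n], and [v] is the share
   in it of the first base point. If [u = 0] the result is the apex and any base point serves as
   witness. *)
pose u := t * (1 - s) + (1 - t) * (1 - s').
have ts : 0 <= t * (1 - s) by rewrite mulr_ge0// subr_ge0.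
have ts' : 0 <= (1 - t) * (1 - s') by rewrite mulr_ge0// subr_ge0.
have u0 : 0 <= u by exact: addr_ge0.
have u1 : u <= 1.
  have : 0 <= t * s by exact: mulr_ge0.
  have : 0 <= (1 - t) * s' by rewrite mulr_ge0// subr_ge0.
  rewrite /u; lra.
have [uz|un0] := eqVneq u 0.
  have tsz : t * (1 - s) = 0.
    by move/eqP: uz; rewrite /u paddr_eq0// => /andP[/eqP].
  have tsz' : (1 - t) * (1 - s') = 0.
    by move/eqP: uz; rewrite /u paddr_eq0// => /andP[_ /eqP].
  have sE z z' z'' : t * (s * z + (1 - s) * z') + (1 - t) * (s' * z + (1 - s') * z'') = z.
    transitivity ((t + (1 - t)) * z - (t * (1 - s) + (1 - t) * (1 - s')) * z +
      t * (1 - s) * z' + (1 - t) * (1 - s') * z''); first by lra.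
    by rewrite tsz tsz'; lra.
  exists (1, (a, b)); rewrite /= ?in_itv /= ?lexx ?ler01//.
  by rewrite !sE; congr pair; lra.
pose v := t * (1 - s) / u.
have vu : v * u = t * (1 - s) by rewrite divfK.
have v0 : 0 <= v by exact: divr_ge0.
have v1 : v <= 1.
  by rewrite ler_pdivrMr ?mul1r ?lerDl// lt_neqAle eq_sym un0.
exists (1 - u, (v * a + (1 - v) * a', v * b + (1 - v) * b')) => /=.
  by split; [rewrite in_itv /=; lra|exact: IH].
have wE c d d' : (1 - u) * c + (1 - (1 - u)) * (v * d + (1 - v) * d') =
    t * (s * c + (1 - s) * d) + (1 - t) * (s' * c + (1 - s') * d').
  transitivity ((1 - u) * c + v * u * d + (u - v * u) * d'); first by lra.
  by rewrite vu /u; lra.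
by rewrite !wE.
Qed.

Lemma cone_hull_point P n k : (k <= n)%N -> cone_hull P n (P k).
Proof.
elim: n k => [|n IH] k; first by rewrite leqn0 => /eqP ->.
rewrite leq_eqVlt => /orP[/eqP ->|kn].
  exists (1, P 0%N) => /=; last by rewrite [P n.+1]surjective_pairing /=; congr pair; lra.
  split; first by rewrite in_itv /= lexx ler01.
  exact: IH.
exists (0, P k) => /=; last by rewrite [RHS]surjective_pairing /=; congr pair; lra.
split; first by rewrite in_itv /= lexx ler01.
exact: IH.
Qed.

Lemma cone_hull_sub P n (Q : R -> R -> Prop) : convex2 Q ->
  (forall k, (k <= n)%N -> Q (P k).1 (P k).2) -> cone_hull P n `<=` [set p | Q p.1 p.2].
Proof.
move=> cQ; elim: n => [|n IH] QP; first by move=> _ ->; exact: QP.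
move=> _ [[t q] /= [+ Kq] <-] /=; rewrite in_itv /= => /andP[t0 t1].
apply: cQ => //; first exact: QP.
by apply: IH => // k kn; exact/QP/leqW.
Qed.

Lemma closed_density_polygon r : closed (density_polygon R r).
Proof.
suff -> : density_polygon R r = cone_hull (extreme_point R r) r.
  by apply: compact_closed; [exact: norm_hausdorff|exact: compact_cone_hull].
apply/seteqP; split.
  apply: smallest_sub; first exact/convex_set2/cone_hull_convex.
  by move=> _ [l lr <-]; exact: cone_hull_point.
move=> [x y]; apply: (cone_hull_sub (@convex_density_polygon R r)) => k kr.
by have := @density_polygon_extreme R _ _ kr; case: extreme_point.
Qed.

End closed_polygon.

Lemma extreme_point_finite (R : realType) r l : (l <= r)%N -> (0 < r)%N ->
  finite_densities R r (extreme_point R r l).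
Proof.
move=> lr r0; have [T [e [T0 es ei er ew]]] := exists_extreme_graph R lr r0.
have TR0 : #|T|%:R != 0 :> R by rewrite pnatr_eq0 -lt0n.
apply/finite_densitiesP; exists #|T|, (\sum_x triangle_walks (neighbours e) x)%N,
  (\sum_x square_walks (neighbours e) x)%N; split=> //; first by exists T, e.
rewrite [LHS]surjective_pairing !natr_sum; congr pair; rewrite mulr_suml.
  rewrite (eq_bigr _ (fun x _ => (ew x).1)).
  by rewrite sumr_const -[X in X / _]mulr_natl mulrC mulKf.
rewrite (eq_bigr _ (fun x _ => (ew x).2)).
by rewrite sumr_const -[X in X / _]mulr_natl mulrC mulKf.
Qed.

Lemma finite_densities_weighted (R : realType) r p :
  finite_densities R r p -> weighted_densities r p.1 p.2.
Proof.
move=> /finite_densitiesP[n [s3 [s4 [n0 [T [e [nE es ei er [<- <-]]]] ->]]]].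
rewrite -nE in n0 *.
by rewrite !natr_sum; exact: weighted_densities_uniform.
Qed.

Lemma weighted_densities_random (R : realType) D r x y : (r <= D)%N ->
  @weighted_densities R r x y -> random_densities R D r (x, y).
Proof.
move=> rD [T [e [w [[es ei er] w0 w1 we [-> ->]]]]].
exact: weighted_random_densities.
Qed.

Theorem theorem3p1 (R : realType) (r : nat) (hr : (3 <= r)%N)
    (D : nat) (hD : (r <= D)%N) :
  random_densities R D r = density_polygon R r /\
  random_densities R D r = closure (finite_densities R r).
Proof.
have r0 : (0 < r)%N by exact: leq_trans hr.
have randomE : random_densities R D r = density_polygon R r.
  apply/seteqP; split=> [_ [lambda [reg uni ->]]|[x y] Qxy].
    exact: random_densities_polygon.
  by apply: (weighted_densities_random hD); exact: (density_polygon_weighted Qxy).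
(* The closure is convex and contains the extreme points. Conversely, uniform weights turn finite
   graphs into random ones, whose points lie in the closed polygon. *)
split=> //; rewrite randomE; apply/seteqP; split.
  apply: smallest_sub; first exact/convex_set2/convex_closure_finite.
  by move=> _ [l lr <-]; apply: subset_closure; exact: extreme_point_finite.
rewrite (closure_id (density_polygon R r)).1; last exact: closed_density_polygon.
apply: closureS; rewrite -randomE => -[x y] /finite_densities_weighted.
exact: weighted_densities_random.
Qed.
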